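(* Let $C$ be a countable real closed subfield of $\mathbb{R}$ which is not a Scott set. Let $G:=\bigoplus_{\mathbb{Q}}(C,+)$ be the Hahn sum of copies of the ordered group $(C,+,0,<)$ indexed by the linear order $\mathbb{Q}$, let $F:=C(t^g: g\in G)$, and let $K:=F^{\mathrm{rc}}$ be the real closure of $F$. Then $K$ is a countable non-Archimedean real closed field which admits left exponentiation, but $K$ is not recursively saturated (in the language $\{+,\cdot,0,1,<\}$); equivalently, $K$ has no integer part whose non-negative cone is a model of Peano Arithmetic.
   Context: Hahn sum: for a linearly ordered set $\Gamma$ and an Archimedean group $C$, $\bigoplus_\Gamma C$ is the group of functions $f:\Gamma\to C$ with finite support, with componentwise addition and lexicographic ordering (a non-zero $f$ is positive iff its value at the least element of its support is positive). $C((G))$ is the field of formal sums $\sum_{g\in G}c_gt^g$ with $c_g\in C$ and well-ordered support, with pointwise addition, convolution multiplication and the lexicographic ordering (a non-zero series is positive iff the coefficient at the least element of its support is positive). $C(t^g:g\in G)$ is its ordered subfield generated by $C$ and $\{t^g:g\in G\}$. Natural valuation on a real closed field $K$: for non-zero $x,y\in K$ put $x\sim y$ if there is $n\in\mathbb{N}$ with $n|x|\ge|y|$ and $n|y|\ge|x|$; let $v(x)$ be the $\sim$-class of $x$, with classes ordered by $v(y)<v(x)$ iff $n|x|<|y|$ for all $n\in\mathbb{N}$, addition $v(x)+v(y)=v(xy)$, and $v(0)=\infty$. Put $R_v=\{a\in K:v(a)\ge0\}$ and $\mathcal{U}_v^{>0}=\{a\in K^{>0}:v(a)=0\}$. Left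 exponentiation: the ordered groups $(K,+,0,<)$ and $(K^{>0},\cdot,1,<)$ are divisible, i.e. ordered $\mathbb{Q}$-vector spaces. $K$ admits left exponentiation if there is an order preserving group isomorphism from some ($\mathbb{Q}$-vector space) complement $A$ of $R_v$ in $(K,+,0,<)$ onto some ($\mathbb{Q}$-vector space) complement $B$ of $\mathcal{U}_v^{>0}$ in $(K^{>0},\cdot,1,<)$. Integer part: an integer part of an ordered field $R$ is a discretely ordered subring $Z\subseteq R$ such that for every $r\in R$ there is $z\in Z$ with $z\le r<z+1$. Its non-negative cone is $Z^{\ge0}$, regarded as a structure in $\{+,\cdot,0,1,<\}$. Peano Arithmetic is the theory of non-negative cones of discretely ordered commutative rings with $1$ together with induction for every first-order formula of $\{+,\cdot,0,1,<\}$. Recursively saturated: for a computable language $L$, an $L$-structure $M$ is recursively saturated if for every computable set of $L$-formulas $\tau(x,\bar y)$ and every tuple $\bar a$ in $M$ of the same length as $\bar y$ such that $\tau(x,\bar a)$ is finitely satisfiable in $M$, $\tau(x,\bar a)$ is realized in $M$. Scott set: a subset $\mathcal{T}\subseteq 2^{<\omega}$ is a tree if it is closed under taking initial segments; $f\in 2^\omega$ is a path through $\mathcal{T}$ if all finite initial segments of $f$ belong to $\mathcal{T}$. A non-empty set $S\subseteq\mathbb{R}$ is a Scott set if (1) whenever $r_1,\dots,r_n\in S$ and $r\in\mathbb{R}$ is computable from the Turing join $r_1\oplus\dots\oplus r_n$, then $r\in S$; and (2) every infinite tree $\mathcal{T}\subseteq 2^{<\omega}$ which is computable in some $r\in S$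 has a path that is computable in some $r'\in S$. Here a real number is used as an oracle in the usual way (e.g. via its Dedekind cut in $\mathbb{Q}$). There exist countable real closed subfields of $\mathbb{R}$ which are not Scott sets, e.g. the field of recursive reals. *)

(* Defs.v *)
From HB Require Import structures.
From Stdlib Require Cantor.
From mathcomp Require Import all_boot all_order all_algebra.
From mathcomp Require Import all_classical all_reals wochoice.

Set Implicit Arguments.
Unset Strict Implicit.
Unset Printing Implicit Defensive.

Import Order.TTheory GRing.Theory Num.Theory.

Local Open Scope classical_set_scope.
Local Open Scope ring_scope.

Definition npair (m n : nat) : nat := Cantor.to_nat (m, n).
Definition nfst (n : nat) : nat := (Cantor.of_nat n).1.
Definition nsnd (n : nat) : nat := (Cantor.of_nat n).2.

(** Unary mu-recursive functions with an oracle; functions of several arguments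
    are handled through the pairing [npair]. *)
Inductive rcode : Type :=
  | RZero | RSucc | RFst | RSnd | ROracle
  | RPair of rcode & rcode
  | RComp of rcode & rcode
  | RPrec of rcode & rcode
  | RMu of rcode.

Fixpoint prec_graph (P Q : nat -> nat -> Prop) (a k y : nat) : Prop :=
  if k is j.+1 then
    exists z, prec_graph P Q a j z /\ Q (npair a (npair j z)) y
  else P a y.

(** [rgraph A c x y]: the program [c] with oracle [A] halts on [x] with
    output [y]. *)
Fixpoint rgraph (A : pred nat) (c : rcode) : nat -> nat -> Prop :=
  match c with
  | RZero => fun _ y => y = 0%N
  | RSucc => fun x y => y = x.+1
  | RFst => fun x y => y = nfst x
  | RSnd => fun x y => y = nsnd x
  | ROracle => fun x y => y = A x
  | RPair c1 c2 => fun x y =>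
      exists y1 y2, [/\ rgraph A c1 x y1, rgraph A c2 x y2 & y = npair y1 y2]
  | RComp c1 c2 => fun x y => exists2 z, rgraph A c2 x z & rgraph A c1 z y
  | RPrec c1 c2 => fun x y =>
      prec_graph (rgraph A c1) (rgraph A c2) (nfst x) (nsnd x) y
  | RMu c1 => fun x y =>
      rgraph A c1 (npair x y) 0 /\
      (forall k, (k < y)%N -> exists z, rgraph A c1 (npair x k) z.+1)
  end.

Definition computable_fun_in (A : pred nat) (f : nat -> nat) : Prop :=
  exists c, forall x, rgraph A c x (f x).

Definition computable_set_in (A : pred nat) (X : set nat) : Prop :=
  computable_fun_in A (fun n => nat_of_bool `[< X n >]).

Definition computable_set (X : set nat) : Prop := computable_set_in pred0 X.

Definition turing_join (A B : pred nat) : pred nat :=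
  fun n => if odd n then B n./2 else A n./2.

Section ScottSets.
Variable R : realType.

(** The Dedekind cut of [r], each rational being written (a - b) / (c + 1). *)
Definition cut (r : R) : pred nat := fun n =>
  let a := nfst n in let b := nfst (nsnd n) in let c := nsnd (nsnd n) in
  (a%:R - b%:R) / c.+1%:R < r.

Definition cut_join (s : seq R) : pred nat :=
  foldr (fun r A => turing_join (cut r) A) pred0 s.

(** Bijective binary numeration of 2^{<omega}. *)
Fixpoint bcode (s : seq bool) : nat :=
  if s is b :: s' then (bcode s').*2 + b.+1 else 0%N.

Definition is_tree (T : set (seq bool)) : Prop :=
  forall s t, prefix s t -> T t -> T s.

Definition is_path (T : set (seq bool)) (f : nat -> bool) : Prop :=
  forall n, T (mkseq f n).

Definition scott_set (S : set R) : Prop :=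
  [/\ S !=set0,
      forall (s : seq R) (r : R), (0 < size s)%N -> [set` s] `<=` S ->
        computable_fun_in (cut_join s) (fun n => cut r n) -> S r
    & forall (T : set (seq bool)) (r : R), S r ->
        is_tree T -> infinite_set T -> computable_set_in (cut r) (bcode @` T) ->
        exists2 f : nat -> bool, is_path T f &
          exists2 r', S r' & computable_fun_in (cut r') (fun n => f n)].

End ScottSets.

Record ostruct : Type := OStruct {
  odom :> Type;
  ozero : odom;
  oone : odom;
  oadd : odom -> odom -> odom;
  omul : odom -> odom -> odom;
  olt : odom -> odom -> Prop }.

Inductive oterm : Type :=
  | TVar of nat | TZero | TOne
  | TAdd of oterm & oterm
  | TMul of oterm & oterm.

(** Variables are de Bruijn indices: a quantifier binds the variable 0. *)
Inductive oform : Type :=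
  | FEq of oterm & oterm
  | FLt of oterm & oterm
  | FNot of oform
  | FAnd of oform & oform
  | FOr of oform & oform
  | FImp of oform & oform
  | FAll of oform
  | FEx of oform.

Fixpoint tval (M : ostruct) (e : nat -> M) (t : oterm) : M :=
  match t with
  | TVar i => e i
  | TZero => ozero M
  | TOne => oone M
  | TAdd t1 t2 => oadd (tval e t1) (tval e t2)
  | TMul t1 t2 => omul (tval e t1) (tval e t2)
  end.

Definition scons (T : Type) (x : T) (e : nat -> T) : nat -> T :=
  fun i => if i is j.+1 then e j else x.

Fixpoint sat (M : ostruct) (e : nat -> M) (f : oform) : Prop :=
  match f with
  | FEq t1 t2 => tval e t1 = tval e t2
  | FLt t1 t2 => olt (tval e t1) (tval e t2)
  | FNot f1 => ~ sat e f1
  | FAnd f1 f2 => sat e f1 /\ sat e f2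
  | FOr f1 f2 => sat e f1 \/ sat e f2
  | FImp f1 f2 => sat e f1 -> sat e f2
  | FAll f1 => forall x, sat (scons x e) f1
  | FEx f1 => exists x, sat (scons x e) f1
  end.

Fixpoint tbelow (n : nat) (t : oterm) : bool :=
  match t with
  | TVar i => (i < n)%N
  | TZero | TOne => true
  | TAdd t1 t2 | TMul t1 t2 => tbelow n t1 && tbelow n t2
  end.

(** The free variables of [f] are among 0, ..., n - 1. *)
Fixpoint fbelow (n : nat) (f : oform) : bool :=
  match f with
  | FEq t1 t2 | FLt t1 t2 => tbelow n t1 && tbelow n t2
  | FNot f1 => fbelow n f1
  | FAnd f1 f2 | FOr f1 f2 | FImp f1 f2 => fbelow n f1 && fbelow n f2
  | FAll f1 | FEx f1 => fbelow n.+1 f1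
  end.

Fixpoint tcode (t : oterm) : nat :=
  match t with
  | TVar i => npair 0 i
  | TZero => npair 1 0
  | TOne => npair 2 0
  | TAdd t1 t2 => npair 3 (npair (tcode t1) (tcode t2))
  | TMul t1 t2 => npair 4 (npair (tcode t1) (tcode t2))
  end.

Fixpoint fcode (f : oform) : nat :=
  match f with
  | FEq t1 t2 => npair 0 (npair (tcode t1) (tcode t2))
  | FLt t1 t2 => npair 1 (npair (tcode t1) (tcode t2))
  | FNot f1 => npair 2 (fcode f1)
  | FAnd f1 f2 => npair 3 (npair (fcode f1) (fcode f2))
  | FOr f1 f2 => npair 4 (npair (fcode f1) (fcode f2))
  | FImp f1 f2 => npair 5 (npair (fcode f1) (fcode f2))
  | FAll f1 => npair 6 (fcode f1)
  | FEx f1 => npair 7 (fcode f1)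
  end.

(** In [tau], the variable 0 is x and the variables 1, ..., n are the
    parameters, interpreted by [a]. *)
Definition realizes (M : ostruct) (n : nat) (a : n.-tuple M)
    (tau : set oform) (x : M) : Prop :=
  forall f, tau f -> sat (fun i => nth x (x :: a) i) f.

Definition recursively_saturated (M : ostruct) : Prop :=
  forall (n : nat) (tau : set oform) (a : n.-tuple M),
    (forall f, tau f -> fbelow n.+1 f) ->
    computable_set (fcode @` tau) ->
    (forall D : set oform, D `<=` tau -> finite_set D ->
       exists x, realizes a D x) ->
    exists x, realizes a tau x.

(** The theory of non-negative cones of discretely ordered commutative rings
    with 1. *)
Record PA_minus (M : ostruct) : Prop := {
  pa_addA : forall x y z : M, oadd x (oadd y z) = oadd (oadd x y) z;
  pa_addC : forall x y : M, oadd x y = oadd y x;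
  pa_add0 : forall x : M, oadd x (ozero M) = x;
  pa_mulA : forall x y z : M, omul x (omul y z) = omul (omul x y) z;
  pa_mulC : forall x y : M, omul x y = omul y x;
  pa_mul0 : forall x : M, omul x (ozero M) = ozero M;
  pa_mul1 : forall x : M, omul x (oone M) = x;
  pa_mulDr : forall x y z : M, omul x (oadd y z) = oadd (omul x y) (omul x z);
  pa_ltxx : forall x : M, ~ olt x x;
  pa_lt_trans : forall x y z : M, olt x y -> olt y z -> olt x z;
  pa_lt_total : forall x y : M, [\/ olt x y, x = y | olt y x];
  pa_ltD : forall x y z : M, olt x y -> olt (oadd x z) (oadd y z);
  pa_ltM : forall x y z : M,
    olt (ozero M) z -> olt x y -> olt (omul x z) (omul y z);
  pa_lt_sub : forall x y : M, olt x y -> exists z, oadd x z = y;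
  pa_lt01 : olt (ozero M) (oone M);
  pa_discrete : forall x : M, olt (ozero M) x -> olt x (oone M) -> False;
  pa_ge0 : forall x : M, ~ olt x (ozero M) }.

Definition induction_scheme (M : ostruct) : Prop :=
  forall (f : oform) (e : nat -> M),
    sat (scons (ozero M) e) f ->
    (forall x, sat (scons x e) f -> sat (scons (oadd x (oone M)) e) f) ->
    forall x, sat (scons x e) f.

Definition PA_model (M : ostruct) : Prop := PA_minus M /\ induction_scheme M.

Definition ring_ostruct (K : numDomainType) : ostruct :=
  @OStruct K 0 1 +%R *%R (fun x y => x < y).

Section IntegerPart.
Variables (K : realFieldType) (Z : subringClosed K).

Definition integer_part : Prop :=
  (forall z, z \in Z -> 0 < z -> 1 <= z) /\
  (forall x : K, exists2 z, z \in Z & z <= x < z + 1).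

Definition cone : Type := {x : K | (x \in Z) && (0 <= x)}.

Fact cone0_subproof : (0 \in Z) && (0 <= 0 :> K).
Proof. by rewrite rpred0 lexx. Qed.

Fact cone1_subproof : (1 \in Z) && (0 <= 1 :> K).
Proof. by rewrite rpred1 ler01. Qed.

Fact coneD_subproof (x y : cone) :
  (val x + val y \in Z) && (0 <= val x + val y).
Proof.
have /andP[xZ x0] := valP x; have /andP[yZ y0] := valP y.
by rewrite rpredD ?addr_ge0.
Qed.

Fact coneM_subproof (x y : cone) :
  (val x * val y \in Z) && (0 <= val x * val y).
Proof.
have /andP[xZ x0] := valP x; have /andP[yZ y0] := valP y.
by rewrite rpredM ?mulr_ge0.
Qed.

Definition cone_ostruct : ostruct :=
  @OStruct cone (exist _ 0 cone0_subproof) (exist _ 1 cone1_subproof)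
    (fun x y => exist _ (val x + val y) (coneD_subproof x y))
    (fun x y => exist _ (val x * val y) (coneM_subproof x y))
    (fun x y => val x < val y).

End IntegerPart.

Section LeftExponentiation.
Variable K : rcfType.
Implicit Types (x y : K) (A B : set K).

(** v(x) = v(y), v(x) < v(y) and v(x) <= v(y). Since v(0) is the largest value
    for these relations, no special clause for v(0) is needed. The zero of the
    value group is v(1). *)
Definition val_eq x y : Prop :=
  exists n : nat, n%:R * `|x| >= `|y| /\ n%:R * `|y| >= `|x|.
Definition val_lt x y : Prop := forall n : nat, n%:R * `|y| < `|x|.
Definition val_le x y : Prop := val_lt x y \/ val_eq x y.

Definition valuation_ring : set K := [set a | val_le 1 a].
Definition pos_units : set K := [set a | 0 < a /\ val_eq a 1].

Definition add_subspace A : Prop :=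
  [/\ A 0,
      forall x y, A x -> A y -> A (x + y)
    & forall (q : rat) x, A x -> A (ratr q * x)].

(** The last clause says that B is closed under x |-> x^(m/n). *)
Definition mul_subspace B : Prop :=
  [/\ B `<=` [set x | 0 < x],
      B 1,
      forall x y, B x -> B y -> B (x * y)
    & forall (m : int) (n : nat) x y, (0 < n)%N ->
        B x -> 0 < y -> y ^+ n = x ^ m -> B y].

Definition add_complement A (S : set K) : Prop :=
  [/\ add_subspace A, A `&` S = [set 0]
    & forall x, exists a s, [/\ A a, S s & x = a + s]].

Definition mul_complement B (S : set K) : Prop :=
  [/\ mul_subspace B, B `&` S = [set 1]
    & forall x, 0 < x -> exists b s, [/\ B b, S s & x = b * s]].

Definition left_exponentiation : Prop :=
  exists A B (f : K -> K),
    [/\ add_complement A valuation_ring, mul_complement B pos_units,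
        set_bij A B f,
        forall x y, A x -> A y -> f (x + y) = f x * f y
      & forall x y, A x -> A y -> x < y -> f x < f y].

End LeftExponentiation.

Section Subfield.
Variables (R : realFieldType) (C : divringClosed R).

Record subfield : Type := Subfield {
  subfield_val :> R;
  _ : subfield_val \in C }.

HB.instance Definition _ := [isSub for subfield_val].
HB.instance Definition _ := [Choice of subfield by <:].
HB.instance Definition _ := [SubChoice_isSubComUnitRing of subfield by <:].
HB.instance Definition _ := [SubComUnitRing_isSubIntegralDomain of subfield by <:].
HB.instance Definition _ := [SubIntegralDomain_isSubField of subfield by <:].

Let le (x y : subfield) : bool := subfield_val x <= subfield_val y.
Let lt (x y : subfield) : bool := subfield_val x < subfield_val y.
Let norm (x : subfield) : subfield := if le 0 x then x else - x.

Fact subfield_le0_add x y : le 0 x -> le 0 y -> le 0 (x + y).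
Proof. exact: addr_ge0. Qed.

Fact subfield_le0_mul x y : le 0 x -> le 0 y -> le 0 (x * y).
Proof. exact: mulr_ge0. Qed.

Fact subfield_le0_anti x : le 0 x -> le x 0 -> x = 0.
Proof. by move=> x0 x1; apply/val_inj/le_anti/andP. Qed.

Fact subfield_sub_ge0 x y : le 0 (y - x) = le x y.
Proof. exact: subr_ge0. Qed.

Fact subfield_le0_total x : le 0 x || le x 0.
Proof. exact: le_total. Qed.

Fact subfield_normN x : norm (- x) = norm x.
Proof.
rewrite /norm opprK /le /= oppr_ge0.
by case: ltrgt0P => // x0; apply/val_inj => /=; rewrite x0 oppr0.
Qed.

Fact subfield_ge0_norm x : le 0 x -> norm x = x.
Proof. by rewrite /norm => ->. Qed.

Fact subfield_lt_def x y : lt x y = (y != x) && le x y.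
Proof. exact: lt_def. Qed.

HB.instance Definition _ := Num.IntegralDomain_isLeReal.Build subfield
  subfield_le0_add subfield_le0_mul subfield_le0_anti subfield_sub_ge0
  subfield_le0_total subfield_normN subfield_ge0_norm subfield_lt_def.

End Subfield.

(** Positivity for the lexicographic ordering: the value at the least element
    of the support exists and is positive. *)
Definition lex_pos (d : Order.disp_t) (I : porderType d) (C : numDomainType)
    (f : I -> C) : Prop :=
  exists i, 0 < f i /\ forall j, (j < i)%O -> f j = 0.

Section HahnSum.
Context {d : Order.disp_t} (I : orderType d) (C : realDomainType).

Definition fin_supp : {pred (I -> C)} :=
  [pred f : I -> C | `[< finite_set [set i | f i != 0] >]].

Record hahn_sum : Type := HahnSum {
  hahn_sum_val :> I -> C;
  _ : hahn_sum_val \in fin_supp }.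

HB.instance Definition _ := [isSub for hahn_sum_val].
HB.instance Definition _ := [Choice of hahn_sum by <:].

Fact fin_supp_zmod_closed : zmod_closed fin_supp.
Proof.
split=> [|f g /asboolP ff /asboolP fg]; apply/asboolP.
  by apply: (sub_finite_set _ (finite_set0 I)) => i /=; rewrite eqxx.
have fU : finite_set ([set i | f i != 0] `|` [set i | g i != 0]).
  by rewrite finite_setU.
apply: sub_finite_set fU => i /=.
have [fi0|] := eqVneq (f i) 0; last by left.
have [gi0|] := eqVneq (g i) 0; last by right.
by rewrite -[(f - g) i]/(f i - g i) fi0 gi0 subr0 eqxx.
Qed.

HB.instance Definition _ :=
  GRing.isZmodClosed.Build (I -> C) fin_supp fin_supp_zmod_closed.
HB.instance Definition _ := [SubChoice_isSubZmodule of hahn_sum by <:].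

Let lt (f g : hahn_sum) : bool := `[< lex_pos (g - f : hahn_sum) >].

Fact hahn_sum_lt_irr : irreflexive lt.
Proof.
by move=> f; apply/asboolP => -[i [+ _]]; rewrite subrr /= ltxx.
Qed.

Fact hahn_sum_lt_trans : transitive lt.
Proof.
move=> g f h /asboolP[i [fgi fgi0]] /asboolP[j [ghj ghj0]]; apply/asboolP.
have E k : (h - f : hahn_sum) k = (h - g : hahn_sum) k + (g - f : hahn_sum) k.
  by rewrite -[RHS]/(h k - g k + (g k - f k)) addrA subrK.
have [ij|ji|ij] := ltgtP i j.
- exists i; split=> [|k ki]; rewrite E; first by rewrite ghj0 // add0r.
  by rewrite fgi0 // ghj0 ?addr0 // (lt_trans ki).
- exists j; split=> [|k kj]; rewrite E; first by rewrite fgi0 // addr0.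
  by rewrite ghj0 // fgi0 ?addr0 // (lt_trans kj).
- rewrite -ij in ghj ghj0.
  exists i; split=> [|k ki]; rewrite E; first by rewrite addr_gt0.
  by rewrite fgi0 // ghj0 ?addr0.
Qed.

HB.instance Definition _ := Order.Lt_isPOrder.Build ring_display hahn_sum
  hahn_sum_lt_irr hahn_sum_lt_trans.

Fact hahn_sum_le_total : total (<=%O : rel hahn_sum).
Proof.
move=> f g; have [->|gf] := eqVneq f g; first by rewrite lexx.
suff [fg|fg] : f < g \/ g < f by rewrite (ltW fg) ?orbT.
have /asboolP/finite_seqP[s sE] := valP (g - f : hahn_sum).
have sP i : (i \in s) = ((g - f : hahn_sum) i != 0).
  by apply/idP/idP => [iS|iS]; [have : [set` s] i by []|suff : [set` s] i by []];
     rewrite -sE.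
have : exists2 i, i \in s & all (fun j => i <= j)%O s.
  have : s != [::].
    apply: contra_neq gf => s0; apply/esym/eqP; rewrite -subr_eq0; apply/eqP.
    apply/val_inj/funext => i; apply/eqP.
    by rewrite -[_ == _]/((g - f : hahn_sum) i == 0) -[_ == _]negbK -sP s0.
  elim: {sE sP} s => // i [|j s] IHs _.
    by exists i; rewrite ?mem_head //= lexx.
  have [//|k ks kmin] := IHs.
  have [ik|/ltW ki] := leP i k.
    exists i; rewrite ?mem_head //= lexx /=.
    by apply: sub_all kmin => l; apply: le_trans.
  exists k; first by rewrite in_cons ks orbT.
  by rewrite /= ki.
case=> i; rewrite sP => i0 /allP imin.
have iz j : (j < i)%O -> (g - f : hahn_sum) j = 0.
  by move=> ji; apply: contraTeq ji; rewrite -sP -leNgt => /imin.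
have [ip|ip|ip] := ltrgt0P ((g - f : hahn_sum) i).
- by left; apply/asboolP; exists i.
- right; apply/asboolP; exists i; rewrite -[f - g]opprB.
  by split=> [|j /iz jz]; rewrite -[(- (g - f)) _]/(- ((g - f) _)) ?oppr_gt0 ?jz ?oppr0.
- by rewrite ip eqxx in i0.
Qed.

HB.instance Definition _ := Order.POrder_isTotal.Build ring_display hahn_sum
  hahn_sum_le_total.

End HahnSum.

Section HahnSeries.
Variables (G : porderZmodType) (C : realFieldType).
Implicit Types f g : G -> C.

(** The elements of C((G)), as coefficient functions with pointwise addition. *)
Definition hahn_series : set (G -> C) :=
  [set f | wo_chain <=%R [pred x | f x != 0]].

Definition hahn_const (c : C) : G -> C := fun x => if x == 0 then c else 0.

Definition hahn_monomial (h : G) : G -> C := fun x => if x == h then 1 else 0.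

(** Convolution. [\sum_(x \in _)] is 0 when infinitely many terms are nonzero,
    which does not occur when [f] and [g] are Hahn series. *)
Definition hahn_mul f g : G -> C :=
  fun z => \sum_(x \in [set: G]) f x * g (z - x).

Definition hahn_lt f g : Prop := lex_pos (g - f).

(** The subfield of C((G)) generated by C and the t^g. *)
Inductive monomial_field : set (G -> C) :=
  | mf_const c : monomial_field (hahn_const c)
  | mf_monomial h : monomial_field (hahn_monomial h)
  | mf_add f g : monomial_field f -> monomial_field g -> monomial_field (f + g)
  | mf_opp f : monomial_field f -> monomial_field (- f)
  | mf_mul f g :
      monomial_field f -> monomial_field g -> monomial_field (hahn_mul f g)
  | mf_inv f g : monomial_field f -> hahn_series g ->
      hahn_mul f g = hahn_const 1 -> monomial_field g.

(** [K] is a real closure of the ordered subfield [F] of C((G)): an algebraic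
    real closed extension of [F], along the order embedding [iota], whose values
    outside [F] are irrelevant. *)
Definition real_closure_of (F : set (G -> C)) (K : rcfType) : Prop :=
  exists iota : (G -> C) -> K,
    [/\ iota (hahn_const 1) = 1,
        forall f g, F f -> F g -> iota (f + g) = iota f + iota g,
        forall f g, F f -> F g -> iota (hahn_mul f g) = iota f * iota g,
        forall f g, F f -> F g -> hahn_lt f g -> iota f < iota g
      & forall y : K, exists p : {poly K},
          [/\ p != 0, forall i, (iota @` F) p`_i & root p y]].

End HahnSeries.

(* Main.v *)
Require Import Defs.
From HB Require Import structures.
From mathcomp Require Import all_boot all_order all_algebra.
From mathcomp Require Import all_classical all_reals.
From mathcomp Require Import ring lra zify.
From mathcomp.real_closed Require Import complex polyrcf.

Set Implicit Arguments.
Unset Strict Implicit.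
Unset Printing Implicit Defensive.

Import Order.TTheory GRing.Theory Num.Theory.

Local Open Scope classical_set_scope.
Local Open Scope ring_scope.

(* Every non-zero element of K has a leading term c t^g: fractions of finite sums of
   terms have one, and it passes to algebraic extensions because G is divisible and C is
   real closed. Hence K has value group G and residue field C.

   Left exponentiation. As K is countable, it has a C-basis (b_g) with v(b_g) = g, so
   that K is isomorphic to the Hahn sum of C over G as an ordered group, the elements
   supported in G^{<0} forming a complement A of the valuation ring. The powers t^g form a
   complement B of the positive units. By Cantor's theorem G^{<0} is isomorphic to Q as an
   order; hence A is isomorphic to the Hahn sum of C over Q, which is G, which is B.

   Non-saturation. Suppose that the linear constraints on x listed by a function
   computable in the cuts of finitely many elements of C can be realized in K as soon as any
   finitely many of them can be realized in Q. Realizing the cut of a computable real, or the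
   condition of avoiding the dyadic intervals of the nodes outside a tree, and
   taking the residue of the solution, shows that C is a Scott set. Recursive saturation
   gives this realization property with a type in which finite oracle answers occur
   as hypotheses on the parameters. An integer part satisfying PA gives it by
   overspill, the oracle being read off an approximation with an infinite
   denominator. *)

(** * Orders of magnitude and leading terms *)

(** K is known only through the map [iota], so its elements are not series. Leading terms are
    therefore expressed inside K, by comparing magnitudes with the images of the t^g. That C is real
    closed enters as the splitting of a squared polynomial into sums of two squares, which catches a
    residue without forming a residue field. A residue forgets infinitesimals: an x with residue c
    may lie just below or just above c. Hence the separate treatment of rational elements of C and
    of binary expansions ending in zeros, where strict and weak inequalities must be told apart. The
    realization property concerns functions computable from elements of C, whereas recursive
    saturation admits only types computable without oracle, and a cone does not contain C. Both gaps
    are closed by finite information: the evaluator [eval] runs on finite pieces of the oracle, and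
    fractions with infinite denominator replace the elements of C. The constraints are linear with
    natural coefficients, so that one list makes sense in Q, in K and, once denominators are
    cleared, in a cone. *)

Notation ll x y := (val_lt y x).

Section Magnitude.
Variable K : rcfType.
Implicit Types x y z w : K.

(** This is x = O(y), that is v(y) <= v(x), while [ll x y] is v(y) < v(x); both are oriented like
    the order of absolute values. As K is totally ordered, [vle x y] is the negation of [ll y x],
    and proofs switch freely between the two. *)
Definition vle x y := exists n : nat, `|x| <= n%:R * `|y|.

Lemma ll_neq0 x y : ll x y -> y != 0.
Proof. by move=> /(_ 0%N); rewrite mul0r normr_gt0. Qed.

Lemma ll0 y : y != 0 -> ll 0 y.
Proof. by move=> y0 n; rewrite normr0 mulr0 normr_gt0. Qed.

Lemma llN x y : ll x y -> ll (- x) y.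
Proof. by move=> xy n; rewrite normrN. Qed.

Lemma llD x y z : ll x z -> ll y z -> ll (x + y) z.
Proof.
(* Twice the factor leaves half of [|z|] to each summand. *)
move=> xz yz n; have := xz (n * 2)%N; have := yz (n * 2)%N.
rewrite natrM => h1 h2.
have h3 : n%:R * `|x + y| <= n%:R * `|x| + n%:R * `|y|.
  by rewrite -mulrDr ler_wpM2l// ler_normD.
lra.
Qed.

Lemma llB x y z : ll x z -> ll y z -> ll (x - y) z.
Proof. by move=> xz yz; apply: llD => //; apply: llN. Qed.

Lemma ll_sum (I : eqType) (s : seq I) (P : pred I) (F : I -> K) z : z != 0 ->
  {in s, forall i, P i -> ll (F i) z} -> ll (\sum_(i <- s | P i) F i) z.
Proof.
move=> z0 sF; rewrite big_seq_cond; apply: (big_ind (fun x => ll x z)).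
- exact: ll0.
- by move=> x y; apply: llD.
- by move=> i /andP[/sF].
Qed.

Lemma ll_irr x : ~ ll x x.
Proof. by move=> /(_ 1%N); rewrite mul1r ltxx. Qed.

Lemma vle_refl x : vle x x.
Proof. by exists 1%N; rewrite mul1r. Qed.

Lemma le_vle x y : `|x| <= `|y| -> vle x y.
Proof. by exists 1%N; rewrite mul1r. Qed.

Lemma vle_trans x y z : vle x y -> vle y z -> vle x z.
Proof.
move=> [n xy] [m yz]; exists (n * m)%N; rewrite natrM -mulrA.
by rewrite (le_trans xy)// ler_wpM2l.
Qed.

Lemma vleM x y z w : vle x y -> vle z w -> vle (x * z) (y * w).
Proof.
move=> [n xy] [m yz]; exists (n * m)%N; rewrite natrM !normrM mulrACA.
by rewrite ler_pM.
Qed.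

Lemma vleX x y n : vle x y -> vle (x ^+ n) (y ^+ n).
Proof.
move=> xy; elim: n => [|n IHn]; first exact: vle_refl.
by rewrite !exprS; apply: vleM.
Qed.

Lemma vleD x y z : vle x z -> vle y z -> vle (x + y) z.
Proof.
move=> [n xz] [m yz]; exists (n + m)%N; rewrite natrD mulrDl.
by rewrite (le_trans (ler_normD _ _))// lerD.
Qed.

Lemma ll_vle x y : ll x y -> vle x y.
Proof. by move=> /(_ 1%N) xy; exists 1%N; rewrite mul1r ltW // -[X in X < _]mul1r. Qed.

Lemma vleNll x y : vle x y <-> ~ ll y x.
Proof.
split=> [[n xy] /(_ n)|]; first by rewrite ltNge xy.
move=> /existsNP[n /negP]; rewrite -leNgt => h; by exists n.
Qed.

Lemma llNvle x y : ll x y <-> ~ vle y x.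
Proof. by rewrite vleNll notK. Qed.

Lemma ll_vle_trans x y z : ll x y -> vle y z -> ll x z.
Proof. by rewrite !llNvle => xy yz zx; apply/xy/(vle_trans yz). Qed.

Lemma vle_ll_trans x y z : vle x y -> ll y z -> ll x z.
Proof. by rewrite !llNvle => xy yz zx; apply/yz/(vle_trans zx). Qed.

Lemma ll_trans x y z : ll x y -> ll y z -> ll x z.
Proof. by move=> xy; apply: vle_ll_trans; apply: ll_vle. Qed.

Lemma llM2r w x y : w != 0 -> ll x y -> ll (x * w) (y * w).
Proof. by move=> w0 xy n; rewrite !normrM mulrA ltr_pM2r ?normr_gt0. Qed.

Lemma llM x y z w : ll x y -> vle z w -> w != 0 -> ll (x * z) (y * w).
Proof.
move=> xy zw w0; apply: (@vle_ll_trans _ (x * w)); last exact: llM2r.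
by apply: vleM => //; apply: vle_refl.
Qed.

Lemma llMM x y z w : ll x y -> ll z w -> ll (x * z) (y * w).
Proof. by move=> xy zw; apply: llM => //; [apply: ll_vle|apply: ll_neq0 zw]. Qed.

Lemma llX x y n : (0 < n)%N -> ll x y -> ll (x ^+ n) (y ^+ n).
Proof.
case: n => // n _ xy; elim: n => [|n IHn]; first by rewrite !expr1.
by rewrite ![_ ^+ n.+2]exprS; apply: llMM.
Qed.

Lemma val_eqE x y : val_eq x y <-> vle x y /\ vle y x.
Proof.
split=> [[n [yx xy]]|[[n xy] [m yx]]]; first by split; exists n.
exists (n + m)%N; split.
  by rewrite (le_trans yx)// ler_wpM2r// ler_nat leq_addl.
by rewrite (le_trans xy)// ler_wpM2r// ler_nat leq_addr.
Qed.

Lemma llsum_neq0 x y : ll y x -> x + y != 0.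
Proof.
move=> yx; apply/eqP => /(canRL (addrK _)); rewrite sub0r => xy.
by apply: (@ll_irr x); rewrite {2}xy; apply: llN.
Qed.

Lemma llsub_vle x y : ll (x - y) y -> vle x y.
Proof. by move=> xy; rewrite -[x](subrK y); apply: vleD; [apply: ll_vle|apply: vle_refl]. Qed.

Lemma llsub_vler x y : ll (x - y) y -> vle y x.
Proof.
move=> xy; apply/vleNll => yx; apply: (@ll_irr y).
by rewrite -{2}[y](subKr x); apply: llB.
Qed.

Lemma ll_lt x y : ll x y -> `|x| < `|y|.
Proof. by move=> /(_ 1%N); rewrite mul1r. Qed.

Lemma llsub_gt0 x y : ll (x - y) y -> 0 < y -> 0 < x.
Proof.
move=> /ll_lt + y0; rewrite (gtr0_norm y0) ltr_norml => /andP[h _]; lra.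
Qed.

Lemma ll_prod_seq (I : Type) (s : seq I) (F : I -> K) :
  (forall i, vle 1 (F i)) -> vle 1 (\prod_(i <- s) F i).
Proof.
move=> h; apply: (big_ind (vle 1)) => //; first exact: vle_refl.
by move=> x y hx hy; rewrite -[1]mul1r; apply: vleM.
Qed.

Lemma exp_vle1 x n : (0 < n)%N -> vle (x ^+ n) 1 -> vle x 1.
Proof.
move=> n0; rewrite !vleNll => h x1; apply: h; rewrite -(expr1n _ n).
exact: llX.
Qed.

End Magnitude.

Section RcfMorphism.
Variables (C K : rcfType) (gamma : {rmorphism C -> K}).

(** Non-negative elements of a real closed field are squares, so every ring morphism out of it
    preserves the order. *)
Lemma rcf_morph_ge0 c : 0 <= c -> 0 <= gamma c.
Proof. by move=> c0; rewrite -(sqr_sqrtr c0) rmorphXn sqr_ge0. Qed.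

Lemma rcf_morph_lt c d : (gamma c < gamma d) = (c < d).
Proof.
have h a b : a <= b -> gamma a <= gamma b.
  by rewrite -subr_ge0 => /rcf_morph_ge0; rewrite rmorphB subr_ge0.
case: (ltP c d) => cd; last by rewrite ltNge h.
by rewrite lt_neqAle h ?ltW // fmorph_eq (lt_eqF cd).
Qed.

Lemma rcf_morph_le c d : (gamma c <= gamma d) = (c <= d).
Proof. by rewrite leNgt rcf_morph_lt -leNgt. Qed.

Lemma rcf_morph_norm c : `|gamma c| = gamma `|c|.
Proof.
case: (ger0P c) => c0; first by rewrite ger0_norm ?rcf_morph_ge0.
by rewrite ltr0_norm ?rmorphN // -(rmorph0 gamma) rcf_morph_lt.
Qed.

End RcfMorphism.

(** Over C(i) the polynomial splits, and conjugation turns its factorization into a second one.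
    Multiplying the two pairs each X - z with X - conj z, which gives a sum of two squares; squaring
    q thus avoids matching conjugate roots within a single factorization. *)
Lemma rcf_sqr_split (C : rcfType) (q : {poly C}) :
  exists s : seq (C * C), q ^+ 2 = (lead_coef q ^+ 2)%:P *
     \prod_(ab <- s) (('X - ab.1%:P) ^+ 2 + (ab.2 ^+ 2)%:P).
Proof.
have [rc [cj [I [cjrc cjI reim I2]]]] : exists (rc : {rmorphism C -> complex C})
    (cj : {rmorphism complex C -> complex C}) (I : complex C),
  [/\ forall a, cj (rc a) = rc a, cj I = - I,
      forall z, z = rc (complex.Re z) + I * rc (complex.Im z) & I * I = -1].
  exists (real_complex C), (@conjc C), 'i%C; split; first exact: conjc_real.
  - by apply/eqP; rewrite eq_complex /= oppr0 !eqxx.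
  - exact: complexE.
  - by rewrite -expr2 sqr_i.
have [r qr] := closed_field_poly_normal (map_poly rc q).
rewrite lead_coef_map -mul_polyC in qr.
have qc : map_poly cj (map_poly rc q) = map_poly rc q.
  by rewrite -map_poly_comp; apply: eq_map_poly => x; apply: cjrc.
have qr' : map_poly rc q =
    (rc (lead_coef q))%:P * \prod_(z <- r) ('X - (cj z)%:P).
  rewrite -[LHS]qc qr rmorphM /= map_polyC /= cjrc; congr (_ * _).
  rewrite rmorph_prod /=; apply: eq_bigr => z _.
  by rewrite rmorphB /= map_polyX map_polyC.
exists [seq (complex.Re z, complex.Im z) | z <- r].
apply: (map_poly_inj rc); rewrite rmorphXn /= expr2 {1}qr qr'.
rewrite mulrACA rmorphM rmorph_prod /= map_polyC /= rmorphXn expr2.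
rewrite polyCM big_map -big_split /=; congr (_ * _); apply: eq_bigr => z _.
rewrite rmorphD rmorphXn rmorphB /= map_polyX !map_polyC /=.
have -> : cj z = rc (complex.Re z) - I * rc (complex.Im z).
  by rewrite {1}[z]reim rmorphD rmorphM !cjrc cjI mulNr.
rewrite {1}[z]reim; move: (complex.Re z) (complex.Im z) => a b.
rewrite !rmorphXn /= polyCD polyCB !polyCM.
have := congr1 (@polyC _) I2; rewrite polyCM polyCN polyC1.
move: I%:P (rc a)%:P (rc b)%:P => i x y ii.
transitivity (('X - x) ^+ 2 - (i * i) * y ^+ 2); last by rewrite ii; ring.
by ring.
Qed.

(** * Leading terms and their passage to algebraic elements *)

Section LeadingTerms.
Variables (C K : rcfType) (gamma : {rmorphism C -> K}).
Variables (G : zmodType) (tau : G -> K).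
Hypothesis C_arch : forall c : C, exists n : nat, `|c| <= n%:R.
Hypothesis tau_gt0 : forall g, 0 < tau g.
Hypothesis tauD : forall g h, tau (g + h) = tau g * tau h.
(** [G] carries no order in this section: the magnitudes of the [tau g] replace it, and distinct
    exponents have different orders of magnitude. *)
Hypothesis tau_cmp : forall g, [\/ g = 0, ll (tau g) 1 | ll 1 (tau g)].
Hypothesis G_div : forall g n, (0 < n)%N -> exists h : G, h *+ n = g.

Lemma tau_neq0 g : tau g != 0. Proof. by rewrite gt_eqF. Qed.
Hint Resolve tau_neq0 : core.

Lemma tau0 : tau 0 = 1.
Proof. by apply: (mulfI (tau_neq0 0)); rewrite -tauD addr0 mulr1. Qed.

Lemma tauN g : tau (- g) = (tau g)^-1.
Proof. by apply: (mulfI (tau_neq0 g)); rewrite -tauD subrr tau0 mulfV. Qed.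

Lemma tauMn g n : tau (g *+ n) = tau g ^+ n.
Proof. by elim: n => [|n IHn]; rewrite ?tau0 // mulrS exprS tauD IHn. Qed.

Lemma tau_tri g h : [\/ g = h, ll (tau g) (tau h) | ll (tau h) (tau g)].
Proof.
have E : tau g = tau (g - h) * tau h by rewrite -tauD subrK.
rewrite E; case: (tau_cmp (g - h)) => [/eqP|/(llM2r (tau_neq0 h))|/(llM2r (tau_neq0 h))].
- by rewrite subr_eq0 => /eqP; constructor 1.
- by rewrite mul1r; constructor 2.
- by rewrite mul1r; constructor 3.
Qed.

Lemma tau_inj_vle g h : vle (tau g) (tau h) -> vle (tau h) (tau g) -> g = h.
Proof. by move=> /vleNll a /vleNll b; case: (tau_tri g h). Qed.

Lemma gamma_vle c : vle (gamma c) 1.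
Proof.
have [n cn] := C_arch c; exists n; rewrite rcf_morph_norm normr1 mulr1.
by rewrite -(rmorph_nat gamma) rcf_morph_le.
Qed.

Lemma vle_gamma c : c != 0 -> vle 1 (gamma c).
Proof.
move=> c0; have := vleM (gamma_vle c^-1) (vle_refl (gamma c)).
by rewrite -rmorphM mulVf// rmorph1 mul1r.
Qed.

Lemma gamma_neq0 c : c != 0 -> gamma c != 0.
Proof. by rewrite fmorph_eq0. Qed.

Definition leads c g x := c != 0 /\ ll (x - gamma c * tau g) (tau g).

Definition has_lead x := exists c g, leads c g x.

Lemma term_vle c g : vle (gamma c * tau g) (tau g).
Proof. by rewrite -[X in vle _ X]mul1r; apply: vleM; [exact: gamma_vle|exact: vle_refl]. Qed.

Lemma vle_term c g : c != 0 -> vle (tau g) (gamma c * tau g).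
Proof. by move=> c0; rewrite -[X in vle X _]mul1r; apply: vleM; [exact: vle_gamma|exact: vle_refl]. Qed.

Lemma leads_ll c g x : leads c g x -> ll (x - gamma c * tau g) (gamma c * tau g).
Proof. by case=> c0 /ll_vle_trans; apply; apply: vle_term. Qed.

Lemma leads_vle c g x : leads c g x -> vle x (tau g).
Proof. by move=> /leads_ll/llsub_vle/vle_trans; apply; apply: term_vle. Qed.

Lemma vle_leads c g x : leads c g x -> vle (tau g) x.
Proof.
move=> cx; apply: (@vle_trans _ _ (gamma c * tau g)); first by case: cx => /vle_term.
exact/llsub_vler/leads_ll.
Qed.

Lemma vle_neq0 (x y : K) : x != 0 -> vle x y -> y != 0.
Proof.
move=> x0 [n]; apply: contraTneq => ->.
by rewrite normr0 mulr0 normr_le0.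
Qed.

Lemma leads_neq0 c g x : leads c g x -> x != 0.
Proof. by move=> /vle_leads/vle_neq0; apply. Qed.

Lemma leads_term c g : c != 0 -> leads c g (gamma c * tau g).
Proof. by move=> c0; split; rewrite ?subrr//; apply: ll0. Qed.

Lemma leadsM c g x d h y : leads c g x -> leads d h y -> leads (c * d) (g + h) (x * y).
Proof.
move=> lx ly; split; first by rewrite mulf_neq0 ?(proj1 lx) ?(proj1 ly).
have -> : x * y - gamma (c * d) * tau (g + h) =
  (x - gamma c * tau g) * y + (gamma c * tau g) * (y - gamma d * tau h).
  by rewrite tauD rmorphM /=; ring.
rewrite tauD; apply: llD.
  by apply: llM => //; [exact: (proj2 lx)|exact: leads_vle ly].
rewrite ![_ * (y - _)]mulrC [tau g * _]mulrC; apply: llM => //; [exact: (proj2 ly)|exact: term_vle].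
Qed.

Lemma leadsV c g x : leads c g x -> leads c^-1 (- g) x^-1.
Proof.
move=> lx; have x0 := leads_neq0 lx; have [c0 lc] := lx.
have gc0 := gamma_neq0 c0; have t0 := tau_neq0 g.
split; first by rewrite invr_eq0.
have -> : x^-1 - gamma c^-1 * tau (- g) =
   (x - gamma c * tau g) * - (x * (gamma c * tau g))^-1.
  by rewrite tauN fmorphV; field; rewrite x0 t0 gc0.
rewrite mulrN; apply: llN.
(* Both sides are brought to a common factor [(x * tau g)^-1], which [llM2r] cancels; what remains
   compares the error of [x] with [x] itself. *)
have -> : tau (- g) = (tau g * x) * (x * tau g)^-1 * (tau g)^-1.
  by rewrite tauN; field; rewrite x0 t0.
have -> : (x - gamma c * tau g) / (x * (gamma c * tau g)) =
   (x - gamma c * tau g) * (gamma c)^-1 * (x * tau g)^-1.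
  by field; rewrite x0 t0 gc0.
have -> : tau g * x / (x * tau g) / tau g = x * (x * tau g)^-1.
  by field; rewrite x0 t0.
apply: llM2r; first by rewrite invr_eq0 mulf_neq0.
apply: (@ll_vle_trans _ _ (tau g)); last exact: vle_leads lx.
rewrite -[X in ll _ X]mulr1; apply: llM => //; last exact: oner_neq0.
by rewrite -fmorphV; apply: gamma_vle.
Qed.

Lemma has_leadM x y : has_lead x -> has_lead y -> has_lead (x * y).
Proof. by move=> [c [g l]] [d [h m]]; exists (c * d), (g + h); apply: leadsM. Qed.

Lemma has_leadV x : has_lead x -> has_lead x^-1.
Proof. by move=> [c [g l]]; exists c^-1, (- g); apply: leadsV. Qed.

Lemma has_lead_tau g : has_lead (tau g).
Proof. by exists 1, g; rewrite -[tau g]mul1r -(rmorph1 gamma); apply/leads_term/oner_neq0. Qed.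

(** The exponent of largest magnitude stands for the minimum of a support. Several entries may share
    it, hence the alternative [e i == g]. *)
Lemma max_tau (I : Type) (P : pred I) (s : seq I) (e : I -> G) : has P s ->
  exists g, has (fun i => P i && (e i == g)) s /\
     all (fun i => P i ==> (e i == g) || `[< ll (tau (e i)) (tau g) >]) s.
Proof.
elim: s => //= i s IHs; case Ps: (has P s); last first.
  rewrite orbF => Pi; exists (e i); rewrite Pi eqxx; split=> //=.
  by apply: sub_all (_ : all (predC P) s); [move=> j /= /negbTE->|rewrite all_predC Ps].
move=> _; have [g [sg ag]] := IHs Ps.
case Pi: (P i) => /=; last by exists g.
case: (tau_tri (e i) g) => [->|ig|gi].
- by exists g; rewrite eqxx.
- exists g; rewrite sg orbT ag; split=> //; apply/andP; split=> //; apply/orP; right; exact/asboolP.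
- exists (e i); rewrite eqxx; split=> //=.
  apply: sub_all ag => j /implyP ag; apply/implyP => /ag/orP[/eqP->|/asboolP jg].
    by apply/orP; right; apply/asboolP.
  by apply/orP; right; apply/asboolP/(ll_trans jg).
Qed.

Lemma gsum_lead (s : seq (C * G)) :
  \sum_(p <- s) gamma p.1 * tau p.2 = 0 \/
  has_lead (\sum_(p <- s) gamma p.1 * tau p.2).
Proof.
have [n] := ubnP (size s); elim: n s => // n IHn s sn.
case: s sn => [|p0 s'] sn; first by left; rewrite big_nil.
set s := p0 :: s' in sn *; set x := \sum_(p <- s) _.
have [|g [sg /allP ag]] := @max_tau _ predT s snd _; first by [].
pose c := \sum_(p <- s | p.2 == g) p.1.
have xE : x = gamma c * tau g + \sum_(p <- s | p.2 != g) gamma p.1 * tau p.2.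
  rewrite /x (bigID (fun p => p.2 == g)) /= rmorph_sum /= mulr_suml; congr (_ + _).
  by apply: eq_bigr => p /eqP->.
have [c0|c0] := eqVneq c 0.
  rewrite xE c0 rmorph0 mul0r add0r -big_filter; apply: IHn.
  rewrite size_filter (leq_trans _ (_ : size s <= n)%N)//.
  rewrite -(count_predC (fun p => p.2 == g)) -[X in (X < _)%N]add0n ltn_add2r.
  by rewrite -has_count.
right; exists c, g; split=> //; rewrite xE addrC addKr; apply: ll_sum => // p ps pg.
have /implyP/(_ isT) := ag p ps; rewrite (negbTE pg) /= => /asboolP.
by apply: vle_ll_trans; apply: term_vle.
Qed.

(** If no [u - gamma a] were infinitesimal, each factor (u - a)^2 + b^2 of q^2 would be at least the
    non-infinitesimal (u - a)^2, so their product, and with it q(u)^2, would not be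
    infinitesimal. *)
Lemma residue_root (q : {poly C}) (u : K) :
  q != 0 -> ll (map_poly gamma q).[u] 1 -> exists a, ll (u - gamma a) 1.
Proof.
move=> q0 qu; have [s sE] := rcf_sqr_split q.
apply: contrapT => /forallNP h.
have : ll ((map_poly gamma (q ^+ 2)).[u]) 1.
  by rewrite rmorphXn /= horner_exp -[X in ll _ X](expr1n _ 2); apply: llX.
rewrite sE rmorphM rmorph_prod /= map_polyC /= hornerM hornerC horner_prod.
apply/vleNll; rewrite -[X in vle X _]mulr1; apply: vleM.
  by apply: vle_gamma; rewrite expf_neq0 // lead_coef_eq0.
apply: ll_prod_seq => -[a b] /=.
rewrite rmorphD rmorphXn rmorphB /= map_polyX !map_polyC /= !hornerE.
apply: (@vle_trans _ _ ((u - gamma a) ^+ 2)).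
  by rewrite -[X in vle X _](expr1n _ 2); apply: vleX; apply/vleNll/h.
apply: le_vle; rewrite !ger0_norm ?sqr_ge0 // ?addr_ge0 ?sqr_ge0 // ?rmorphXn ?sqr_ge0 //.
by rewrite lerDl sqr_ge0.
Qed.

Lemma sum_neq0_dominant (n : nat) (F : 'I_n -> K) (i : 'I_n) : F i != 0 ->
  (forall j, j != i -> ll (F j) (F i)) -> \sum_(j < n) F j != 0.
Proof.
move=> Fi h; rewrite (bigD1 i)//= llsum_neq0 //; apply: ll_sum => // j _; exact: h.
Qed.

(* Two of the terms a_i y^i of largest magnitude must be comparable, so a power of
   y is comparable to some tau g. *)
Lemma algebraic_value (p : {poly K}) (y : K) : p != 0 ->
  (forall i, p`_i = 0 \/ has_lead p`_i) -> root p y -> y != 0 ->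
  exists g, vle y (tau g) /\ vle (tau g) y.
Proof.
move=> p0 pl /rootP py y0.
have [i0 pi0] : exists i : 'I_(size p), p`_i != 0.
  have sp : (size p > 0)%N by rewrite size_poly_gt0.
  have sp' : ((size p).-1 < size p)%N by rewrite ltn_predL.
  by exists (Ordinal sp') => /=; rewrite -lead_coefE lead_coef_eq0.
pose F (i : 'I_(size p)) := p`_i * y ^+ i.
have [i Fi] : exists i, forall j, `|F j| <= `|F i|.
  have := @arg_maxP _ _ _ i0 predT (fun i => `|F i|) isT.
  by case=> i _ h; exists i => j; apply: h.
have Fi0 : F i != 0.
  rewrite -normr_gt0 (lt_le_trans _ (Fi i0)) // normr_gt0 /F.
  by rewrite mulf_neq0 ?expf_neq0.
have [j ji jv] : exists2 j, j != i & vle (F i) (F j).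
  apply: contrapT => /forall2NP h.
  have /eqP[] : \sum_(j < size p) F j != 0.
    apply: (sum_neq0_dominant Fi0) => j ji; apply/llNvle.
    by case: (h j) => // /negP; rewrite ji.
  by rewrite -[RHS]py horner_coef.
have ij := le_vle (Fi j).
have p_lead k : vle (F i) (F k) -> has_lead p`_k.
  move=> ik; case: (pl k) => // pk; move: (vle_neq0 Fi0 ik).
  by rewrite /F pk mul0r eqxx.
have [k [l [kl hk hl klv lkv]]] : exists k l, [/\ (k < l)%N,
    has_lead p`_k, has_lead p`_l, vle (p`_k * y ^+ k) (p`_l * y ^+ l)
    & vle (p`_l * y ^+ l) (p`_k * y ^+ k)].
  case: (ltngtP i j) => [lij|lji|/val_inj eij].
  - by exists i, j; split=> //; apply: p_lead => //; apply: vle_refl.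
  - by exists j, i; split=> //; apply: p_lead => //; apply: vle_refl.
  - by rewrite eij eqxx in ji.
move: hk hl => [c [g lc]] [d [h ld]]; pose n := (l - k)%N.
have n0 : (0 < n)%N by rewrite subn_gt0.
(* The two comparable terms give y^n of the magnitude of [tau (g - h)]; divisibility of [G] supplies
   the n-th root of the latter. *)
have [e eE] := G_div (g - h) n0; exists e.
have yl : y ^+ l = y ^+ n * y ^+ k by rewrite -exprD subnK // ltnW.
have yk0 : y ^+ k != 0 by rewrite expf_neq0.
have red a b : vle (a * y ^+ k) (b * y ^+ k) -> vle a b.
  move=> /vleM/(_ (vle_refl (y ^+ k)^-1)).
  by rewrite -!mulrA mulfV // !mulr1.
have te : tau e ^+ n = tau g * (tau h)^-1 by rewrite -tauMn eE tauD tauN.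
have ndiv a b : b != 0 -> vle a b <-> vle (a * b^-1) 1.
  move=> b0; split=> [ab|].
    by rewrite -(mulfV b0); apply: vleM => //; apply: vle_refl.
  by move=> /vleM/(_ (vle_refl b)); rewrite mulfVK // mul1r.
have {}klv : vle (tau g) (tau h * y ^+ n).
  apply: vle_trans (vle_leads lc) _; apply: (@vle_trans _ _ (p`_l * y ^+ n)).
    by apply: red; rewrite -mulrA -yl.
  by apply: vleM; [exact: leads_vle ld|exact: vle_refl].
have {}lkv : vle (tau h * y ^+ n) (tau g).
  apply: vle_trans (leads_vle lc); apply: (@vle_trans _ _ (p`_l * y ^+ n)).
    by apply: vleM; [exact: vle_leads ld|exact: vle_refl].
  by apply: red; rewrite -mulrA -yl.
have h1 : vle ((y / tau e) ^+ n) 1.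
  rewrite expr_div_n te -ndiv ?mulf_neq0 ?invr_eq0 //.
  move: (vleM lkv (vle_refl (tau h)^-1)).
  by rewrite mulrAC mulfV // mul1r.
have h2 : vle ((tau e / y) ^+ n) 1.
  rewrite expr_div_n te -ndiv ?expf_neq0 //.
  move: (vleM klv (vle_refl (tau h)^-1)).
  by rewrite [X in vle _ X]mulrAC mulfV // mul1r.
split; first by rewrite ndiv //; apply: exp_vle1 h1.
by rewrite ndiv //; apply: exp_vle1 h2.
Qed.

(** Dividing p by the largest [tau g] among its coefficients and keeping only the leading
    coefficients at [g] gives a non-zero polynomial over C whose value at [u] is infinitesimal;
    [residue_root] then applies. *)
Lemma algebraic_residue (p : {poly K}) (u : K) : p != 0 ->
  (forall i, p`_i = 0 \/ has_lead p`_i) -> root p u -> vle u 1 ->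
  exists a, ll (u - gamma a) 1.
Proof.
move=> p0 pl /rootP pu u1.
have hs : has (fun i => p`_i != 0) (iota 0 (size p)).
  apply/hasP; exists (size p).-1; last by rewrite -lead_coefE lead_coef_eq0.
  by rewrite mem_iota /= add0n ltn_predL size_poly_gt0.
have /choice[cg cgP] : forall i, exists c : C * G, p`_i != 0 -> leads c.1 c.2 p`_i.
  move=> i.
  have [pi0|pi0] := eqVneq p`_i 0; first by exists (0, 0).
  by case: (pl i) pi0 => [->|[c [g cg]] _]; rewrite ?eqxx//; exists (c, g).
have [g [/hasP[i1 i1s /andP[pi1 /eqP gi1]] /allP gmax]] := max_tau (fun i => (cg i).2) hs.
pose q : {poly C} := \poly_(i < size p)
   (if (p`_i != 0) && ((cg i).2 == g) then (cg i).1 else 0).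
have i1p : (i1 < size p)%N by rewrite mem_iota in i1s.
have q0 : q != 0.
  apply: contraTneq (proj1 (cgP _ pi1)) => q0.
  by have := coef_poly (size p) (fun i => if (p`_i != 0) && ((cg i).2 == g) then (cg i).1 else 0) i1;
     rewrite -/q q0 coef0 i1p pi1 gi1 eqxx /= => ->; rewrite eqxx.
apply: (residue_root q0).
suff E : ll ((map_poly gamma q).[u] * tau g) (tau g).
  have := llM2r (_ : (tau g)^-1 != 0) E.
  by rewrite mulfK // mulfV //; apply; rewrite invr_eq0.
(* Since p(u) = 0, the value of q is up to sign the error made in replacing p by [tau g] times q,
   and each coefficient of that error is negligible against [tau g]. *)
have -> : (map_poly gamma q).[u] * tau g =
   - \sum_(i < size p) (p`_i - gamma q`_i * tau g) * u ^+ i.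
  rewrite (@horner_coef_wide _ (size p)); last first.
    by rewrite size_map_poly size_poly.
  apply/eqP; rewrite -addr_eq0 mulr_suml -big_split /=; apply/eqP.
  rewrite -[RHS]pu horner_coef; apply: eq_bigr => i _.
  by rewrite coef_map /=; ring.
apply: llN; apply: ll_sum => // i _ _; rewrite -[tau g]mulr1.
apply: llM; rewrite ?oner_neq0 //; last first.
  by rewrite -[1](expr1n _ i); apply: vleX.
rewrite coef_poly ltn_ord mulr1.
have [pi0|pi0] := eqVneq p`_i 0 => /=.
  by rewrite rmorph0 mul0r subr0; rewrite pi0; apply: ll0.
have := gmax i; rewrite mem_iota /= add0n ltn_ord => /(_ isT)/implyP/(_ pi0).
case: eqVneq => /= [<- _|_ /asboolP lg]; first by case: (cgP _ pi0).
rewrite rmorph0 mul0r subr0; apply: vle_ll_trans lg.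
exact: leads_vle (cgP _ pi0).
Qed.

(** Once y has the magnitude of [tau g], the quotient u = y / tau g is a root of p(tau g X), whose
    coefficients still have leading terms. The residue of u is the leading coefficient of y,
    non-zero because u is not infinitesimal. *)
Lemma algebraic_lead (p : {poly K}) (y : K) : p != 0 ->
  (forall i, p`_i = 0 \/ has_lead p`_i) -> root p y -> y != 0 -> has_lead y.
Proof.
move=> p0 pl py y0; have [g [yg gy]] := algebraic_value p0 pl py y0.
pose q := \poly_(i < size p) (p`_i * tau g ^+ i).
have qE i : q`_i = p`_i * tau g ^+ i.
  by rewrite coef_poly; case: ltnP => // /(nth_default 0) ->; rewrite mul0r.
have q0 : q != 0.
  apply: contra_neq p0 => q0; apply/polyP => i; apply/eqP; rewrite coef0.
  have := qE i; rewrite q0 coef0 => /esym/eqP.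
  by rewrite mulf_eq0 expf_eq0 (negbTE (tau_neq0 g)) andbF orbF.
have ql i : q`_i = 0 \/ has_lead q`_i.
  rewrite qE; case: (pl i) => [->|li]; first by left; rewrite mul0r.
  by right; apply: has_leadM => //; rewrite -tauMn; apply: has_lead_tau.
have qu : root q (y / tau g).
  apply/rootP; rewrite (@horner_coef_wide _ (size p)) ?size_poly //.
  rewrite -[RHS](rootP py) horner_coef; apply: eq_bigr => i _.
  by rewrite qE -mulrA -exprMn [tau g * _]mulrC divfK.
have u1 : vle (y / tau g) 1.
  by rewrite -(mulfV (tau_neq0 g)); apply: vleM => //; apply: vle_refl.
have [a ua] := algebraic_residue q0 ql qu u1.
exists a, g; split; last first.
  have := llM2r (tau_neq0 g) ua.
  by rewrite mul1r mulrBl divfK.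
apply/eqP => a0; move: ua; rewrite a0 rmorph0 subr0; apply/vleNll.
by rewrite -(mulfV (tau_neq0 g)); apply: vleM => //; apply: vle_refl.
Qed.

End LeadingTerms.

(** * Countable dense orders *)

Lemma seq_extrema {d : Order.disp_t} {T : orderType d} (s : seq T) :
  s != [::] -> (exists2 m, m \in s & {in s, forall x, x <= m}%O) /\
               (exists2 m, m \in s & {in s, forall x, m <= x}%O).
Proof.
elim: s => // a [|b s] IHs _.
  by split; exists a; rewrite ?mem_head // => x; rewrite inE => /eqP->.
have [//|[M Ms hM] [m ms hm]] := IHs; split.
- have [aM|/ltW Ma] := leP a M.
    by exists M; [rewrite inE Ms orbT|move=> x; rewrite inE => /predU1P[->|/hM]].
  exists a; first exact: mem_head.
  by move=> x; rewrite inE => /predU1P[->//|/hM/le_trans]; apply.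
- have [ma|/ltW am] := leP m a.
    by exists m; [rewrite inE ms orbT|move=> x; rewrite inE => /predU1P[->|/hm]].
  exists a; first exact: mem_head.
  by move=> x; rewrite inE => /predU1P[->//|/hm]; apply: le_trans.
Qed.

Definition unbounded_dense {d : Order.disp_t} {T : orderType d} (P : set T) :=
  [/\ P !=set0,
      forall x, P x -> exists2 y, P y & (y < x)%O,
      forall x, P x -> exists2 y, P y & (x < y)%O
    & forall x y, P x -> P y -> (x < y)%O -> exists2 z, P z & (x < z < y)%O].

(** This is the extension step of back-and-forth: the lists are the images of the points below and
    above a new one, and absence of endpoints covers the cases where one of them is empty. *)
Lemma unbounded_dense_between {d : Order.disp_t} {T : orderType d} (P : set T)
    (s t : seq T) : unbounded_dense P -> [set` s] `<=` P -> [set` t] `<=` P ->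
  {in s & t, forall a b, a < b}%O ->
  exists x, [/\ P x, {in s, forall a, a < x}%O & {in t, forall b, x < b}%O].
Proof.
move=> [[p Pp] lo hi mid] sP tP st.
have [s0|s0] := eqVneq s [::]; have [t0|t0] := eqVneq t [::].
- by exists p; rewrite s0 t0.
- have [_ [m mt hm]] := seq_extrema t0; have [x Px xm] := lo _ (tP _ mt).
  by exists x; rewrite s0; split=> // b /hm; apply: lt_le_trans.
- have [[m ms hm] _] := seq_extrema s0; have [x Px xm] := hi _ (sP _ ms).
  by exists x; rewrite t0; split=> // b /hm/le_lt_trans; apply.
- have [[m ms hm] _] := seq_extrema s0; have [_ [n nt hn]] := seq_extrema t0.
  have [x Px /andP[mx xn]] := mid _ _ (sP _ ms) (tP _ nt) (st _ _ ms nt).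
  exists x; split=> //; first by move=> a /hm/le_lt_trans; apply.
  by move=> b /hn; apply: lt_le_trans.
Qed.

Definition partial_iso {d d' : Order.disp_t} {T : orderType d} {U : orderType d'}
    (P : set T) (Q : set U) (l : seq (T * U)) :=
  (forall p, p \in l -> P p.1 /\ Q p.2) /\
  (forall p q, p \in l -> q \in l -> (p.1 < q.1)%O = (p.2 < q.2)%O).

Lemma partial_iso_extend {d d' : Order.disp_t} {T : orderType d} {U : orderType d'}
    (P : set T) (Q : set U) (l : seq (T * U)) x :
  unbounded_dense Q -> partial_iso P Q l -> P x ->
  exists l', [/\ partial_iso P Q l', {subset l <= l'} & exists y, (x, y) \in l'].
Proof.
move=> Qd [lP ll] Px.
have [/mapP[[x' y] xl /= ->]|xl] := boolP (x \in map fst l).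
  by exists l; split=> //; exists y.
pose s := [seq p.2 | p <- l & (p.1 < x)%O].
pose t := [seq p.2 | p <- l & (x < p.1)%O].
have [|||y [Qy sy yt]] := unbounded_dense_between (s := s) (t := t) Qd.
- by move=> _ /mapP[p + ->]; rewrite mem_filter => /andP[_ /lP[]].
- by move=> _ /mapP[p + ->]; rewrite mem_filter => /andP[_ /lP[]].
- move=> _ _ /mapP[p + ->] /mapP[q + ->].
  rewrite !mem_filter => /andP[px pl] /andP[xq ql].
  by rewrite -ll // (lt_trans px).
have cmp p : p \in l -> (p.1 < x)%O = (p.2 < y)%O /\ (x < p.1)%O = (y < p.2)%O.
  move=> pl; case: (ltgtP p.1 x) => px; last 1 first.
  - by case/negP: xl; rewrite -px; apply: map_f.
  - have h : p.2 \in s by apply: map_f; rewrite mem_filter px.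
    by rewrite (sy _ h); split=> //; rewrite lt_gtF // sy.
  - have h : p.2 \in t by apply: map_f; rewrite mem_filter px.
    by rewrite (yt _ h); split=> //; rewrite lt_gtF // yt.
exists ((x, y) :: l); split.
- split=> [p|p q]; rewrite !inE; first by move=> /predU1P[->|/lP].
  move=> /predU1P[->|pl] /predU1P[->|ql] /=; rewrite ?ltxx //.
  + by case: (cmp _ ql).
  + by case: (cmp _ pl).
  + exact: ll.
- by move=> p pl; rewrite inE pl orbT.
- by exists y; rewrite mem_head.
Qed.

Lemma partial_iso_swap {d d' : Order.disp_t} {T : orderType d} {U : orderType d'}
    (P : set T) (Q : set U) (l : seq (T * U)) :
  partial_iso P Q l -> partial_iso Q P [seq (p.2, p.1) | p <- l].
Proof.
move=> [lP ll]; split=> [_ /mapP[p /lP[] ? ? ->] //|].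
by move=> _ _ /mapP[p pl ->] /mapP[q ql ->] /=; rewrite ll.
Qed.

(** Back-and-forth along injections into [nat]: stage n treats the at most one element of P and the
    at most one element of Q with code n. *)
Theorem cantor_isomorphism {d d' : Order.disp_t} {T : orderType d} {U : orderType d'}
    (P : set T) (Q : set U) : countable P -> countable Q ->
  unbounded_dense P -> unbounded_dense Q ->
  exists f : T -> U, [/\ set_bij P Q f
    & forall x y, P x -> P y -> (f x < f y)%O = (x < y)%O].
Proof.
move=> /countable_injP[eP ePi] /countable_injP[eQ eQi] Pd Qd.
(* One stage, forth for P and then back for Q. The conclusion is conditional on [partial_iso], so
   that the choice function is defined on every list. *)
have /choice[F FP] : forall ln : seq (T * U) * nat, exists l',
    partial_iso P Q ln.1 -> [/\ partial_iso P Q l', {subset ln.1 <= l'},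
      forall x, P x -> eP x = ln.2 -> exists y, (x, y) \in l'
    & forall y, Q y -> eQ y = ln.2 -> exists x, (x, y) \in l'].
  move=> [l n] /=.
  have [lP|] := pselect (partial_iso P Q l); last by exists l.
  have [l1 [l1P ll1 hx]] : exists l1, [/\ partial_iso P Q l1, {subset l <= l1} &
      forall x, P x -> eP x = n -> exists y, (x, y) \in l1].
    have [[x Px ex]|h] := pselect (exists2 x, P x & eP x = n); last first.
      by exists l; split=> // x Px ex; case: h; exists x.
    have [l1 [? ? h]] := partial_iso_extend Qd lP Px; exists l1; split=> // x' Px' ex'.
    by have -> : x' = x by apply: ePi; rewrite ?inE // ex.
  have [[y Qy ey]|h] := pselect (exists2 y, Q y & eQ y = n); last first.
    by exists l1 => _; split=> // y Qy ey; case: h; exists y.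
  have [l2 [l2P ll2 [x xy]]] := partial_iso_extend Pd (partial_iso_swap l1P) Qy.
  exists [seq (p.2, p.1) | p <- l2] => _.
  have sub : {subset l1 <= [seq (p.2, p.1) | p <- l2]}.
    move=> [a b] ab; apply/mapP; exists (b, a) => //; apply: ll2.
    by apply/mapP; exists (a, b).
  split; first exact: partial_iso_swap.
  - by move=> p /ll1/sub.
  - by move=> x' Px' /hx[//|z /sub]; exists z.
  - move=> y' Qy' ey'; have -> : y' = y by apply: eQi; rewrite ?inE // ey.
    by exists x; apply/mapP; exists (y, x).
pose L := fix L n := if n is m.+1 then F (L m, m) else [::].
have LP n : partial_iso P Q (L n) by elim: n => //= n /(FP (L n, n))[].
have Lle m n : (m <= n)%N -> {subset L m <= L n}.
  move=> /subnK<-; elim: (n - m)%N => //= k IHk p /IHk.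
  by have [_ + _ _] := FP (L (k + m)%N, (k + m)%N) (LP _); apply.
have Lx x : P x -> exists y, exists n, (x, y) \in L n.
  move=> Px; have [_ _ + _] := FP (L (eP x), eP x) (LP _).
  by case/(_ x Px erefl) => y xy; exists y, (eP x).+1.
have Ly y : Q y -> exists x, exists n, (x, y) \in L n.
  move=> Qy; have [_ _ _] := FP (L (eQ y), eQ y) (LP _).
  by case/(_ y Qy erefl) => x xy; exists x, (eQ y).+1.
have Liso p q m n : p \in L m -> q \in L n -> (p.1 < q.1)%O = (p.2 < q.2)%O.
  move=> pm qn; have [_ h] := LP (maxn m n).
  by apply: h; [apply: (Lle m) pm; rewrite leq_maxl|apply: (Lle n) qn; rewrite leq_maxr].
have /choice[f fP] : forall x, exists y, P x -> exists n, (x, y) \in L n.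
  move=> x; have [/Lx[y h]|] := pselect (P x); first by exists y.
  by have [[y _] _ _ _] := Qd; exists y.
have mono x y : P x -> P y -> (f x < f y)%O = (x < y)%O.
  by move=> /fP[m hm] /fP[n hn]; rewrite -(Liso _ _ _ _ hm hn).
have inj x y : P x -> P y -> f x = f y -> x = y.
  move=> Px Py fxy; have := mono x y Px Py; have := mono y x Py Px.
  by rewrite fxy !ltxx; case: ltgtP.
exists f; split=> //; split.
- by move=> x /fP[n h]; have [/(_ _ h)[]] := LP n.
- by move=> x y; rewrite !inE; apply: inj.
- move=> y Qy; have [x [n xy]] := Ly y Qy.
  have Px : P x by have [/(_ _ xy)[]] := LP n.
  exists x => //; have [m fx] := fP x Px.
  have := Liso _ _ _ _ xy fx; have := Liso _ _ _ _ fx xy.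
  by rewrite /= !ltxx; case: ltgtP.
Qed.

(** * Hahn sums *)

Section HahnGroup.
Context {d : Order.disp_t} {I : orderType d} {C : realFieldType}.
Local Notation G := (hahn_sum I C).
Implicit Types f g : G.

Lemma hahn_sum_supp f : finite_set [set i | f i != 0].
Proof. by have /asboolP := valP f. Qed.

Lemma hahn_sumP f g : (forall i, f i = g i) -> f = g.
Proof. by move=> fg; apply/val_inj/funext. Qed.

Lemma hahn_sumD f g i : (f + g) i = f i + g i. Proof. by []. Qed.
Lemma hahn_sumN f i : (- f) i = - f i. Proof. by []. Qed.
Lemma hahn_sumMn f n i : (f *+ n) i = f i *+ n.
Proof. by elim: n => [|n IHn]; rewrite ?mulr0n // !mulrS hahn_sumD IHn. Qed.

Lemma finite_hahn_sum (h : I -> C) : finite_set [set i | h i != 0] ->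
  exists f : G, forall i, f i = h i.
Proof. by move=> hf; exists (@HahnSum _ I C h (asboolT hf)). Qed.

Lemma hahn_sum_ltP f g : reflect (lex_pos (g - f : G)) (f < g).
Proof. exact: asboolP. Qed.

Lemma hahn_sum_gt0P f : reflect (lex_pos f) (0 < f).
Proof. by rewrite -[X in lex_pos X]/(hahn_sum_val f) -{1}[f]subr0; apply: hahn_sum_ltP. Qed.

Lemma hahn_sum_subr_gt0 f g : (0 < g - f) = (f < g).
Proof. by apply/hahn_sum_gt0P/hahn_sum_ltP. Qed.

Lemma hahn_sum_addr_gt0 f g : 0 < f -> 0 < g -> 0 < f + g.
Proof.
rewrite -[f in 0 < f]opprK -sub0r [0 < 0 - _]hahn_sum_subr_gt0 => fg g0.
rewrite -[f]opprK addrC hahn_sum_subr_gt0; exact: lt_trans g0.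
Qed.

Lemma hahn_sum_oppr_gt0 f : (0 < - f) = (f < 0).
Proof. by rewrite -sub0r hahn_sum_subr_gt0. Qed.

Lemma hahn_sum_scale (c : C) f : exists g, forall i, g i = c * f i.
Proof.
apply: finite_hahn_sum; apply: sub_finite_set (hahn_sum_supp f) => i /=.
by apply: contra_neq => ->; rewrite mulr0.
Qed.

Lemma hahn_sum_div f n : (0 < n)%N -> exists g, g *+ n = f.
Proof.
move=> n0; have [g gE] := hahn_sum_scale n%:R^-1 f; exists g.
apply: hahn_sumP => i; rewrite hahn_sumMn gE -[LHS]mulr_natl mulrA mulfV ?mul1r //.
by rewrite pnatr_eq0 -lt0n.
Qed.

Lemma hahn_sum_pmulrn_lgt0 f n : (0 < n)%N -> (0 < f *+ n) = (0 < f).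
Proof.
move=> n0; apply/hahn_sum_gt0P/hahn_sum_gt0P => -[i [fi h]]; exists i.
  move: fi; rewrite hahn_sumMn pmulrn_lgt0 //; split=> // j /h.
  by rewrite hahn_sumMn => /eqP; rewrite mulrn_eq0 -leqn0 leqNgt n0 => /eqP.
by rewrite hahn_sumMn pmulrn_lgt0 //; split=> // j /h; rewrite hahn_sumMn => ->; rewrite mul0rn.
Qed.

Lemma hahn_sum_delta i0 : exists f, 0 < f /\ forall i, f i = (i == i0)%:R.
Proof.
have [|f fE] := @finite_hahn_sum (fun i => (i == i0)%:R).
  apply: sub_finite_set (finite_set1 i0) => i /=.
  by have [->|] := eqVneq i i0; rewrite ?eqxx.
exists f; split=> //; apply/hahn_sum_gt0P; exists i0; rewrite fE eqxx ltr01; split=> // j.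
by rewrite fE => /lt_eqF ->.
Qed.

(** Doubles, halves and means are the witnesses; the index [i0] provides a non-zero element to start
    from. *)
Lemma hahn_sum_neg_unbounded_dense (i0 : I) : unbounded_dense [set g : G | g < 0].
Proof.
split=> /=.
- have [f [f0 _]] := hahn_sum_delta i0; exists (- f) => /=.
  by rewrite -hahn_sum_oppr_gt0 opprK.
- move=> x x0; exists (x + x); rewrite -?hahn_sum_oppr_gt0 ?opprD.
    by rewrite hahn_sum_addr_gt0 // hahn_sum_oppr_gt0.
  by rewrite -hahn_sum_subr_gt0 opprD addrA subrr sub0r hahn_sum_oppr_gt0.
- move=> x x0; have [g gx] := hahn_sum_div x (isT : 0 < 2)%N.
  have g0 : g < 0.
    rewrite -hahn_sum_oppr_gt0 -(@hahn_sum_pmulrn_lgt0 _ 2) // mulNrn gx.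
    by rewrite hahn_sum_oppr_gt0.
  exists g => //; rewrite -hahn_sum_subr_gt0 -gx mulr2n opprD addrA subrr sub0r.
  by rewrite hahn_sum_oppr_gt0.
- move=> x y x0 y0 xy; have [z zE] := hahn_sum_div (x + y) (isT : 0 < 2)%N.
  have xz : x < z.
    rewrite -hahn_sum_subr_gt0 -(@hahn_sum_pmulrn_lgt0 _ 2) // mulrnBl zE.
    by rewrite mulr2n opprD addrA [x + y]addrC addrK hahn_sum_subr_gt0.
  have zy : z < y.
    rewrite -hahn_sum_subr_gt0 -(@hahn_sum_pmulrn_lgt0 _ 2) // mulrnBl zE.
    by rewrite mulr2n opprD addrA addrAC addrK hahn_sum_subr_gt0.
  by exists z; [exact: lt_trans zy y0|rewrite xz].
Qed.

Lemma countable_hahn_sum : countable [set: I] -> countable [set: C] ->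
  countable [set: G].
Proof.
move=> /countable_injP[eI eIi] /countable_injP[eC eCi]; apply/countable_injP.
have /choice[supp suppE] : forall f, exists s : seq I, forall i, (i \in s) = (f i != 0).
  move=> f; have /finite_seqP[s sE] := hahn_sum_supp f; exists s => i.
  apply/idP/idP => h; first by have : [set` s] i by []; rewrite -sE.
  by have : [set i | f i != 0] i by []; rewrite sE.
exists (fun f => pickle [seq (eI i, eC (f i)) | i <- supp f]).
move=> f g _ _ /(pcan_inj pickleK) fg.
have key (u v : G) i : [seq (eI i, eC (u i)) | i <- supp u] =
    [seq (eI i, eC (v i)) | i <- supp v] -> u i != 0 -> u i = v i.
  move=> uv ui; have : (eI i, eC (u i)) \in [seq (eI i, eC (u i)) | i <- supp u].
    by apply: map_f; rewrite suppE.
  rewrite uv => /mapP[j _ [/eIi ij /eCi]].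
  by rewrite ij ?inE // => ->; rewrite ?inE.
apply: hahn_sumP => i; have [f0|] := eqVneq (f i) 0; last exact: key.
have [g0|] := eqVneq (g i) 0; first by rewrite f0.
by move=> /(key g f i (esym fg)).
Qed.

End HahnGroup.

Lemma rat_unbounded_dense : unbounded_dense [set: rat].
Proof.
split=> [|x _|x _|x y _ _ xy]; first by exists 0.
- by exists (x - 1) => //; rewrite ltrBlDr ltrDl.
- by exists (x + 1) => //; rewrite ltrDl.
- by exists ((x + y) / 2); rewrite ?midf_lt.
Qed.

(** * Left exponentiation *)

Section ValuationBasis.
Variables (C K : rcfType) (gamma : {rmorphism C -> K}).
Variables (G : zmodType) (tau : G -> K).
Hypothesis C_arch : forall c : C, exists n : nat, `|c| <= n%:R.
Hypothesis tau_gt0 : forall g, 0 < tau g.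
Hypothesis tauD : forall g h, tau (g + h) = tau g * tau h.
Hypothesis tau_cmp : forall g, [\/ g = 0, ll (tau g) 1 | ll 1 (tau g)].
Hypothesis K_lead : forall y, y != 0 -> has_lead gamma tau y.

Local Notation leads := (leads gamma tau).

Lemma leads_uniq c g d h x : leads c g x -> leads d h x -> g = h.
Proof.
move=> lc ld; apply: (tau_inj_vle tau_gt0 tauD tau_cmp).
  exact: vle_trans (vle_leads C_arch lc) (leads_vle C_arch ld).
exact: vle_trans (vle_leads C_arch ld) (leads_vle C_arch lc).
Qed.

Lemma leads_gt0 c g x : leads c g x -> 0 < c -> 0 < x.
Proof.
move=> /(leads_ll C_arch)/llsub_gt0 h c0; apply: h; rewrite mulr_gt0 //.
by rewrite -(rmorph0 gamma) rcf_morph_lt.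
Qed.

(** Replacing each [b h] by [tau h] costs only something smaller than [tau h], so the dominant
    exponent alone decides. *)
Lemma comb_lead (s : seq G) (b : G -> K) (c : G -> C) g :
  {in s, forall h, leads 1 h (b h)} -> uniq s -> g \in s -> c g != 0 ->
  {in s, forall h, c h != 0 -> h = g \/ ll (tau h) (tau g)} ->
  leads (c g) g (\sum_(h <- s) gamma (c h) * b h).
Proof.
move=> sb us gs cg h; split=> //; rewrite (bigD1_seq g) //= addrAC.
have tg0 := tau_neq0 tau_gt0 g.
apply: llD.
  rewrite -mulrBr; apply: (vle_ll_trans (y := b g - tau g)).
    rewrite -[X in vle _ X]mul1r; apply: vleM; [exact: gamma_vle|exact: vle_refl].
  by have [_] := sb g gs; rewrite rmorph1 mul1r.
apply: ll_sum => // k ks kg; have [->|ck] := eqVneq (c k) 0.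
  by rewrite rmorph0 mul0r; apply: ll0.
case: (h k ks ck) => [kg'|]; first by rewrite kg' eqxx in kg.
apply: vle_ll_trans; rewrite -[X in vle _ X]mul1r; apply: vleM; first exact: gamma_vle.
exact: leads_vle (sb k ks).
Qed.

Definition basis_list (l : seq (G * K)) :=
  uniq [seq p.1 | p <- l] /\ {in l, forall p, leads 1 p.1 p.2}.

Definition spans (l : seq (G * K)) x :=
  exists c : G -> C, x = \sum_(p <- l) gamma (c p.1) * p.2.

Lemma spans0 l : spans l 0.
Proof.
exists (fun=> 0); rewrite big1 // => p _.
by rewrite rmorph0 mul0r.
Qed.

Lemma spansD l x y : spans l x -> spans l y -> spans l (x + y).
Proof.
move=> [c ->] [d ->]; exists (fun g => c g + d g).
by rewrite -big_split; apply: eq_bigr => p _; rewrite /= rmorphD mulrDl.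
Qed.

Lemma spans_cons p l x c : p.1 \notin [seq q.1 | q <- l] -> spans l x ->
  spans (p :: l) (gamma c * p.2 + x).
Proof.
move=> pl [d ->]; exists (fun g => if g == p.1 then c else d g).
rewrite big_cons eqxx; congr (_ + _); apply: eq_big_seq => q ql.
by case: eqP => // qp; rewrite -qp map_f in pl.
Qed.

(* Each element of the list is subtracted at most once, since the values of the
   successive remainders increase. *)
Lemma spans_reduce l x : basis_list l -> exists y,
  [/\ spans l y, x - y = 0 \/ exists c g, leads c g (x - y) /\ g \notin [seq p.1 | p <- l]
    & vle (x - y) x].
Proof.
elim: l x => [|[g0 b] l IHl] x [ul vl].
  exists 0; rewrite subr0; split; [exact: spans0| |exact: vle_refl].
  have [->|/K_lead[c [g h]]] := eqVneq x 0; first by left.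
  by right; exists c, g.
move: ul => /= /andP[gl ul].
have {}vl' : {in l, forall p, leads 1 p.1 p.2} by move=> p pl; apply: vl; rewrite inE pl orbT.
have sub y c : spans l y -> spans ((g0, b) :: l) (gamma c * b + y) by apply: spans_cons.
have sub0 y : spans l y -> spans ((g0, b) :: l) y.
  by move=> /(sub _ 0); rewrite rmorph0 mul0r add0r.
have [y [ly yx xy]] := IHl x (conj ul vl').
case: yx => [yx|[c [g [cg gNl]]]].
  by exists y; split; [exact: sub0|left|].
have [gg0|gg0] := eqVneq g g0; last first.
  by exists y; split; [exact: sub0|right; exists c, g; rewrite inE negb_or gg0|].
rewrite {}gg0 {gNl} in cg.
have lb : leads 1 g0 b := vl (g0, b) (mem_head _ _).
have zl : ll (x - y - gamma c * b) (tau g0).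
  rewrite -[X in ll (X - _) _](subrK (gamma c * tau g0)) -addrA -mulrBr.
  apply: llD; first by case: cg.
  apply: (vle_ll_trans (y := tau g0 - b)).
    by rewrite -[X in vle _ X]mul1r; apply: vleM; [exact: gamma_vle|exact: vle_refl].
  by rewrite -opprB; apply: llN; case: lb; rewrite rmorph1 mul1r.
(* Removing the term at [g0] may uncover an exponent of the tail, so the tail is used a second time.
   What is left is negligible against [tau g0], and therefore the exponent [g0] cannot come back. *)
have [y' [ly' yx' xy']] := IHl (x - y - gamma c * b) (conj ul vl').
exists (gamma c * b + (y + y')).
have -> : x - (gamma c * b + (y + y')) = x - y - gamma c * b - y' by ring.
split; first by apply/sub/spansD.
  case: yx' => [->|[c' [g' [cg' gl']]]]; first by left.
  right; exists c', g'; split=> //=; rewrite inE negb_or gl' andbT.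
  apply/eqP => gg; have : ll (tau g') (tau g0).
    exact: vle_ll_trans (vle_leads C_arch cg') (vle_ll_trans xy' zl).
  by rewrite gg => /ll_irr.
apply: (vle_trans xy'); apply: vle_trans xy; apply: vle_trans (vle_leads C_arch cg).
exact: ll_vle.
Qed.

(** The reduced remainder has an exponent not yet in the list; divided by its leading coefficient it
    becomes the new basis vector. *)
Lemma basis_list_step l x : basis_list l ->
  exists l', [/\ basis_list l', {subset l <= l'} & spans l' x].
Proof.
move=> bl; have [y [ly yx _]] := spans_reduce x bl.
case: yx => [/eqP|[c [g [cg gl]]]]; first by rewrite subr_eq0 => /eqP->; exists l; split.
have gc0 : gamma c != 0 by apply: gamma_neq0; case: cg.
exists ((g, (x - y) / gamma c) :: l); split.
- case: bl => ul vl; split; first by rewrite /= gl.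
  move=> p; rewrite inE => /predU1P[->|/vl//] /=.
  split; first exact: oner_neq0.
  rewrite rmorph1 mul1r; have [_ h] := cg.
  have -> : (x - y) / gamma c - tau g = gamma c^-1 * (x - y - gamma c * tau g).
    by rewrite fmorphV; field.
  apply: vle_ll_trans h; rewrite -[X in vle _ X]mul1r.
  by apply: vleM; [exact: gamma_vle|exact: vle_refl].
- by move=> p pl; rewrite inE pl orbT.
- have := spans_cons c (p := (g, (x - y) / gamma c)) gl ly.
  by rewrite /= [gamma c * _]mulrC divfK // subrK.
Qed.

Lemma basis_list_inj l p q : basis_list l -> p \in l -> q \in l -> p.1 = q.1 -> p = q.
Proof.
case=> + _; elim: l => //= r l IHl /andP[rl ul].
rewrite !inE => /predU1P[->|pl] /predU1P[->|ql] // pq; last exact: IHl.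
- by rewrite pq map_f in rl.
- by rewrite -pq map_f in rl.
Qed.

(* Brown's theorem on valuation bases, in the case where the residue field is the
   field of scalars. *)
Theorem valuation_basis : countable [set: K] ->
  exists b : G -> K, (forall g, leads 1 g (b g)) /\
    forall x, exists (s : seq G) (c : G -> C),
      uniq s /\ x = \sum_(g <- s) gamma (c g) * b g.
Proof.
move=> /countable_injP[e e_inj].
have /choice[F FP] : forall ln : seq (G * K) * nat, exists l', basis_list ln.1 ->
    [/\ basis_list l', {subset ln.1 <= l'} & forall x, e x = ln.2 -> spans l' x].
  move=> [l n] /=; have [[x ex]|h] := pselect (exists x, e x = n); last first.
    by exists l => bl; split=> // x ex; case: h; exists x.
  have [bl|nbl] := pselect (basis_list l); last by exists l.
  have [l' [bl' ll' lx]] := basis_list_step x bl; exists l' => _; split=> // x' ex'.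
  by have -> : x' = x by apply: e_inj; rewrite ?inE // ex.
pose L := fix L n := if n is m.+1 then F (L m, m) else [::].
have LP n : basis_list (L n) by elim: n => //= n /(FP (L n, n))[].
have Lle m n : (m <= n)%N -> {subset L m <= L n}.
  move=> /subnK<-; elim: (n - m)%N => //= k IHk p /IHk.
  by have [_ + _] := FP (L (k + m)%N, (k + m)%N) (LP _); apply.
have Lx x : spans (L (e x).+1) x by have [_ _ +] := FP (L (e x), e x) (LP _); apply.
have Linj p q m n : p \in L m -> q \in L n -> p.1 = q.1 -> p = q.
  move=> pm qn; apply: (@basis_list_inj (L (maxn m n))) => //.
    by apply: (Lle m) pm; rewrite leq_maxl.
  by apply: (Lle n) qn; rewrite leq_maxr.
have /choice[b bP] : forall g, exists b, exists n, (g, b) \in L n.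
  (* Every exponent occurs: [tau g] is spanned by some stage, and the dominant basis vector in that
     combination must have exponent [g], as leading exponents are unique. *)
  move=> g; have [c cE] := Lx (tau g); set l := L _ in cE.
  have [ul vl] := LP (e (tau g)).+1; rewrite -/l in ul vl.
  have [hc|/hasPn hc] := boolP (has (fun p => c p.1 != 0) l); last first.
    have /eqP[] := tau_neq0 tau_gt0 g; rewrite cE big_seq big1 // => p /hc.
    by rewrite negbK => /eqP->; rewrite rmorph0 mul0r.
  have [g' [/hasP[p pl /andP[cp /eqP pg]] /allP gm]] :=
    max_tau tau_gt0 tauD tau_cmp (fun p : G * K => p.1) hc.
  (* The list read as a function of the exponent, the form that [comb_lead] expects; the default 0
     is never met on exponents of the list. *)
  pose bl h := nth 0 [seq q.2 | q <- l] (index h [seq q.1 | q <- l]).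
  have blE q : q \in l -> bl q.1 = q.2.
    move=> ql; rewrite /bl; have hi : (index q.1 [seq r.1 | r <- l] < size l)%N.
      by rewrite -(size_map fst) index_mem map_f.
    rewrite (nth_map (0, 0)) //.
    have := nth_index 0 (map_f fst ql); rewrite (nth_map (0, 0)) // => hq.
    by rewrite (basis_list_inj (conj ul vl) _ ql hq) // mem_nth.
  have lg : leads (c g') g' (\sum_(h <- [seq q.1 | q <- l]) gamma (c h) * bl h).
    apply: comb_lead => //.
    - by move=> _ /mapP[q ql ->]; rewrite blE //; apply: vl.
    - by rewrite -pg map_f.
    - by rewrite -pg.
    - move=> _ /mapP[q ql ->] cq; have := gm q ql; rewrite cq /=.
      by case/orP => [/eqP|/asboolP]; [left|right].
  exists p.2, (e (tau g)).+1.
  suff gp : g = p.1 by have -> : (g, p.2) = p by rewrite gp; case: (p).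
  have tg := leads_term gamma tau_gt0 g (oner_neq0 C).
  rewrite rmorph1 mul1r in tg.
  have cE' : tau g = \sum_(q <- l) gamma (c q.1) * bl q.1.
    by apply: (etrans cE); apply: eq_big_seq => q /blE ->.
  rewrite pg; apply: leads_uniq tg _; rewrite big_map -cE' in lg; exact: lg.
exists b; split=> [g|x].
  by have [n gn] := bP g; have [_ /(_ _ gn)] := LP n.
have [c cE] := Lx x; exists [seq p.1 | p <- L (e x).+1], c.
split; first by case: (LP (e x).+1).
apply: (etrans cE); rewrite big_map; apply: eq_big_seq => p pl; congr (_ * _).
have [n gn] := bP p.1; by rewrite {1}(Linj _ _ _ _ pl gn erefl).
Qed.

End ValuationBasis.

Lemma valuation_ringP (K : rcfType) (x : K) : valuation_ring x <-> vle x 1.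
Proof.
rewrite /valuation_ring /= /val_le; split=> [[/ll_vle//|/val_eqE[]//]|x1].
have [x2|/llNvle] := pselect (vle 1 x); last by left.
by right; apply/val_eqE.
Qed.

(** * The isomorphism with a Hahn sum and the left exponential *)

Section ValuedExponential.
Context {d : Order.disp_t} {I : orderType d}.
Variables (C K : rcfType) (gamma : {rmorphism C -> K}).
Local Notation G := (hahn_sum I C).
Variable tau : G -> K.
Hypothesis C_arch : forall c : C, exists n : nat, `|c| <= n%:R.
Hypothesis tau_gt0 : forall g, 0 < tau g.
Hypothesis tauD : forall g h, tau (g + h) = tau g * tau h.
Hypothesis tau_small : forall g, 0 < g -> ll (tau g) 1.

Local Notation leads := (leads gamma tau).
Let tau_neq0 := tau_neq0 tau_gt0.
Let tau0 := tau0 tau_gt0 tauD.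
Let tauN := tauN tau_gt0 tauD.

Lemma tau_lt g h : g < h -> ll (tau h) (tau g).
Proof.
rewrite -hahn_sum_subr_gt0 => /tau_small/(llM2r (tau_neq0 g)).
by rewrite mul1r -tauD subrK.
Qed.

Lemma tau_cmp g : [\/ g = 0, ll (tau g) 1 | ll 1 (tau g)].
Proof.
case: (ltgtP g 0) => [g0|/tau_small|]; last by constructor 1.
  by constructor 3; rewrite -tau0; apply: tau_lt.
by constructor 2.
Qed.

Lemma tau_eq1 g : vle (tau g) 1 -> vle 1 (tau g) -> g = 0.
Proof. by move=> /vleNll h1 /vleNll h2; case: (tau_cmp g). Qed.

Hypothesis K_lead : forall y, y != 0 -> has_lead gamma tau y.

Section Expansion.
Variable b : G -> K.
Hypothesis b_lead : forall g, leads 1 g (b g).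
Hypothesis b_span : forall x, exists (s : seq G) (c : G -> C),
  uniq s /\ x = \sum_(g <- s) gamma (c g) * b g.

(** There are two levels of Hahn sums: [c] is indexed by [G], itself a Hahn sum indexed by [I]. With
    a valuation basis [b] this is the isomorphism of ordered groups from the Hahn sum of C over [G]
    onto K. *)
Definition expansion (c : hahn_sum G C) : K :=
  \sum_(g \in [set: G]) gamma (c g) * b g.

Lemma expansionE (c : hahn_sum G C) (s : seq G) : uniq s ->
  (forall g, c g != 0 -> g \in s) ->
  expansion c = \sum_(g <- s) gamma (c g) * b g.
Proof.
move=> us cs; rewrite /expansion (@fsbigE _ _ _ _ _ s) // => [|g _ gs].
  by apply: eq_bigl => g; exact: in_setT.
have [->|/cs] := eqVneq (c g) 0; first by rewrite rmorph0 mul0r.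
by rewrite (negbTE gs).
Qed.

Lemma hahn_sum_supp_seq (c : hahn_sum G C) :
  exists2 s : seq G, uniq s & forall g, c g != 0 -> g \in s.
Proof.
have /finite_seqP[s sE] := hahn_sum_supp c; exists (undup s); first exact: undup_uniq.
move=> g cg; rewrite mem_undup.
by have : [set g | c g != 0] g by []; rewrite sE.
Qed.

Lemma expansionD c c' : expansion (c + c') = expansion c + expansion c'.
Proof.
have [s us cs] := hahn_sum_supp_seq c; have [s' us' cs'] := hahn_sum_supp_seq c'.
rewrite !(@expansionE _ (undup (s ++ s'))) ?undup_uniq // => [|g|g|g].
- rewrite -big_split; apply: eq_bigr => g _.
  by rewrite hahn_sumD rmorphD mulrDl.
- by move=> /cs'; rewrite mem_undup mem_cat orbC => ->.
- by move=> /cs; rewrite mem_undup mem_cat => ->.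
- rewrite mem_undup mem_cat hahn_sumD.
  have [->|/cs->//] := eqVneq (c g) 0; rewrite add0r => /cs' ->.
  by rewrite orbT.
Qed.

Lemma expansion0 : expansion 0 = 0.
Proof. by apply: (addrI (expansion 0)); rewrite -expansionD !addr0. Qed.

Lemma expansionB c c' : expansion (c - c') = expansion c - expansion c'.
Proof. by apply: (addIr (expansion c')); rewrite -expansionD !subrK. Qed.

Lemma expansion_lead (c : hahn_sum G C) g : c g != 0 -> (forall h, h < g -> c h = 0) ->
  leads (c g) g (expansion c).
Proof.
move=> cg cl; have [s us cs] := hahn_sum_supp_seq c.
rewrite (expansionE us cs); apply: comb_lead => //.
- exact: cs.
- move=> h _ ch; case: (ltgtP h g) => [/cl hc|/tau_lt|]; [|by right|by left].
  by rewrite hc eqxx in ch.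
Qed.

Lemma expansion_gt0 c : 0 < c -> 0 < expansion c.
Proof.
move=> /hahn_sum_gt0P[g [cg cl]].
apply: (leads_gt0 C_arch tau_gt0 (expansion_lead _ cl)) => //.
by rewrite gt_eqF.
Qed.

Lemma expansion_mono c c' : (expansion c < expansion c') = (c < c').
Proof.
have h e e' : e < e' -> expansion e < expansion e'.
  by rewrite -hahn_sum_subr_gt0 => /expansion_gt0; rewrite expansionB subr_gt0.
case: (ltgtP c c') => [/h//|/h cc|->]; last by rewrite ltxx.
by rewrite lt_gtF.
Qed.

Lemma expansion_inj : injective expansion.
Proof.
move=> c c' cc; have := expansion_mono c c'; have := expansion_mono c' c.
by rewrite cc !ltxx; case: ltgtP.
Qed.

Lemma expansion_surj x : exists c, x = expansion c.
Proof.
have [s [c [us ->]]] := b_span x.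
have [|c' cE] := @finite_hahn_sum _ G C (fun g => if g \in s then c g else 0).
  apply: (sub_finite_set _ (finite_seq s)) => g /=.
  by case: ifP => //; rewrite eqxx.
exists c'; rewrite (@expansionE _ s us) => [|g]; last by rewrite cE; case: ifP; rewrite ?eqxx.
by apply: eq_big_seq => g gs; rewrite cE gs.
Qed.

Variable phi : I -> G.
Hypothesis phi_bij : set_bij [set: I] [set g | g < 0] phi.
Hypothesis phi_mono : forall i j, (phi i < phi j) = (i < j)%O.

Definition neg_part : set K :=
  [set x | exists2 c : hahn_sum G C, (forall g, 0 <= g -> c g = 0) & x = expansion c].

(** Expansions are cut at exponent 0. A non-zero sum over negative exponents has a negative leading
    exponent and so is infinite, which gives the trivial intersection; terms with exponent at least
    0 are finite, which gives the decomposition. *)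
Lemma neg_part_complement : add_complement neg_part (@valuation_ring K).
Proof.
have sz (q : rat) (c : hahn_sum G C) : exists2 e : hahn_sum G C,
    forall g, e g = ratr q * c g & expansion e = ratr q * expansion c.
  have [e eE] := hahn_sum_scale (ratr q) c; exists e => //.
  have [s us cs] := hahn_sum_supp_seq c; rewrite !(@expansionE _ s) //.
    by rewrite mulr_sumr; apply: eq_bigr => g _; rewrite eE rmorphM fmorph_rat mulrA.
  by move=> g; rewrite eE mulf_eq0 negb_or => /andP[_ /cs].
split.
- split.
  + by exists 0 => //; rewrite expansion0.
  + move=> _ _ [c cP ->] [e eP ->]; exists (c + e); last by rewrite expansionD.
    by move=> g g0; rewrite hahn_sumD cP // eP // addr0.
  + move=> q _ [c cP ->]; have [e eE eq] := sz q c; exists e => // g g0.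
    by rewrite eE cP // mulr0.
- apply/seteqP; split=> [x [[c cP ->]]|_ ->] /=; last first.
    split; first by exists 0 => //; rewrite expansion0.
    by apply/valuation_ringP; exists 0%N; rewrite normr0 mul0r.
  move=> /valuation_ringP c1; have [->|] := eqVneq c 0; first exact: expansion0.
  rewrite neq_lt => c0; suff [g [cg cl]] : exists g, c g != 0 /\ forall h, h < g -> c h = 0.
    have g0 : g < 0 by rewrite ltNge; apply/negP => /cP /eqP; apply/negP.
    case: (vleNll (expansion c) 1) => /(_ c1) + _; case.
    have := tau_lt g0; rewrite tau0 => /ll_vle_trans; apply.
    exact: vle_leads (expansion_lead cg cl).
  case/orP: c0 => [|/hahn_sum_gt0P[g [cg cl]]]; last by exists g; rewrite gt_eqF.
  rewrite -hahn_sum_oppr_gt0 => /hahn_sum_gt0P[g [cg cl]]; exists g; split.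
    by move: cg; rewrite hahn_sumN oppr_gt0 => /lt_eqF ->.
  by move=> h /cl; rewrite hahn_sumN => /eqP; rewrite oppr_eq0 => /eqP.
- move=> x; have [c ->] := expansion_surj x.
  have [|c1 c1E] := @finite_hahn_sum _ G C (fun g => if g < 0 then c g else 0).
    by apply: sub_finite_set (hahn_sum_supp c) => g /=; case: ifP; rewrite ?eqxx.
  exists (expansion c1), (expansion (c - c1)); split.
  + by exists c1 => // g g0; rewrite c1E ltNge g0.
  + apply/valuation_ringP; have [s us cs] := hahn_sum_supp_seq (c - c1).
    rewrite (expansionE us cs); apply: (big_ind (fun x => vle x 1)).
    * by exists 0%N; rewrite normr0 mul0r.
    * by move=> ? ?; apply: vleD.
    move=> g _; rewrite hahn_sumD hahn_sumN c1E; case: ltP => g0.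
      by rewrite subrr rmorph0 mul0r; exists 0%N; rewrite normr0 mul0r.
    rewrite subr0 -[1]mulr1; apply: vleM; first exact: gamma_vle.
    apply: vle_trans (leads_vle C_arch (b_lead g)) _.
    move: g0; rewrite le_eqVlt => /predU1P[<-|/tau_lt]; rewrite tau0.
      exact: vle_refl.
    exact: ll_vle.
  + by rewrite -expansionD addrCA subrr addr0.
Qed.

(** Closure under rational powers combines divisibility of [G] with uniqueness of positive roots; a
    positive x splits as [tau g] times a unit, where [g] is its leading exponent. *)
Lemma tau_range_complement : mul_complement (range tau) (@pos_units K).
Proof.
have tauz (m : int) g : exists h, tau g ^ m = tau h.
  case: m => n; first by exists (g *+ n); rewrite (tauMn tau_gt0 tauD).
  by exists (- (g *+ n.+1)); rewrite tauN (tauMn tau_gt0 tauD).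
split.
- split.
  + by move=> _ [g _ <-]; apply: tau_gt0.
  + by exists 0.
  + by move=> _ _ [g _ <-] [h _ <-]; exists (g + h).
  + move=> m n _ y n0 [g _ <-] y0 yn; have [h hE] := tauz m g.
    have [e eE] := hahn_sum_div h n0; exists e => //.
    apply/eqP; rewrite -(@eqrXn2 _ n) ?ltW //.
    by rewrite yn hE -eE (tauMn tau_gt0 tauD).
- apply/seteqP; split=> [_ [[g _ <-]] [_ /val_eqE[h1 h2]]|_ ->] /=.
    by rewrite (tau_eq1 h1 h2).
  split; first by exists 0.
  by split; [exact: ltr01|apply/val_eqE; split; apply: vle_refl].
- move=> x x0; have [c [g cg]] := K_lead (lt0r_neq0 x0).
  exists (tau g), (x / tau g); split; first by exists g.
    split; first by rewrite divr_gt0.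
    apply/val_eqE; rewrite -(mulfV (tau_neq0 g)); split; apply: vleM; try exact: vle_refl.
      exact: leads_vle cg.
    exact: vle_leads cg.
  by rewrite mulrCA mulfV // mulr1.
Qed.

Lemma expansion_exponential : left_exponentiation K.
Proof.
have [phi_neg phi_inj phi_surj] := phi_bij.
have phiN i : phi i < 0 by apply: (phi_neg i).
have phiI i j : phi i = phi j -> i = j by apply: phi_inj; rewrite inE.
have /choice[inv invE] := expansion_surj.
(* Coefficients indexed by negative exponents are read along [phi] as an element of [G]. The sign
   compensates for [tau] being decreasing: a larger [c] must give a smaller exponent. *)
have /choice[psi psiE] : forall c : hahn_sum G C, exists g : G, forall i, g i = - c (phi i).
  move=> c; apply: finite_hahn_sum.
  have [s us cs] := hahn_sum_supp_seq c.
  have : finite_set [set i | phi i \in s].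
    by apply: (@finite_preimage _ _ [set` s] phi); rewrite ?finite_seq // => i j _ _; apply: phiI.
  by apply: sub_finite_set => i /=; rewrite oppr_eq0 => /cs.
exists neg_part, (range tau), (fun x => tau (psi (inv x))).
have psiD c c' : psi (c + c') = psi c + psi c'.
  by apply: hahn_sumP => i; rewrite hahn_sumD !psiE hahn_sumD opprD.
have invD x y : inv (x + y) = inv x + inv y.
  by apply: expansion_inj; rewrite expansionD -!invE.
have invK c : inv (expansion c) = c by apply: expansion_inj; rewrite -invE.
have mono x y : neg_part x -> neg_part y -> x < y -> tau (psi (inv x)) < tau (psi (inv y)).
  move=> [c cP ->] [e eP ->]; rewrite !invK expansion_mono => /hahn_sum_ltP[g [eg el]].
  have g0 : g < 0.
    rewrite ltNge; apply/negP => g0; move: eg.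
    by rewrite hahn_sumD hahn_sumN cP // eP // subr0 ltxx.
  have [i _ ig] := phi_surj g g0.
  have : psi e < psi c.
    apply/hahn_sum_ltP; exists i; split.
      by move: eg; rewrite !hahn_sumD !hahn_sumN !psiE ig opprK addrC.
    move=> j ji; have := el (phi j); rewrite -ig phi_mono => /(_ ji).
    by rewrite !hahn_sumD !hahn_sumN !psiE opprK addrC.
  by move=> /tau_lt/ll_lt; rewrite !gtr0_norm.
split=> //.
- exact: neg_part_complement.
- exact: tau_range_complement.
- split.
  + by move=> x _; exists (psi (inv x)).
  + move=> x y; rewrite !inE => Ax Ay xy.
    by case: (ltgtP x y) => // /mono => [/(_ Ax Ay)|/(_ Ay Ax)]; rewrite xy ltxx.
  + move=> _ [g _ <-].
    (* Preimage of [tau g]: [- g] is transported along the inverse of [phi] and extended by 0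
       outside the range, that is to exponents at least 0. *)
    have /choice[v vE] : forall h, exists v : C,
        (forall i, phi i = h -> v = - g i) /\ ((forall i, phi i <> h) -> v = 0).
      move=> h; have [[i ih]|/forallNP nh] := pselect (exists i, phi i = h).
        exists (- g i); split; last by move=> /(_ i).
        by move=> j jh; congr (- g _); apply: phiI; rewrite ih.
      by exists 0; split=> // i /nh.
    have v_supp h : v h != 0 -> exists2 i, g i != 0 & phi i = h.
      have [[i ih]|/forallNP nh] := pselect (exists i, phi i = h).
        by rewrite (proj1 (vE h) i ih) oppr_eq0; exists i.
      by rewrite (proj2 (vE h) nh) eqxx.
    have [|c cE] := @finite_hahn_sum _ G C v.
      apply: (sub_finite_set _ (finite_image phi (hahn_sum_supp g))) => h /=.
      by move=> /v_supp[i gi ih]; exists i.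
    exists (expansion c).
      exists c => // h h0; rewrite cE; apply: (proj2 (vE h)) => i ih.
      by have := phiN i; rewrite ih ltNge h0.
    congr tau; rewrite invK; apply: hahn_sumP => i.
    by rewrite psiE cE (proj1 (vE (phi i)) i erefl) opprK.
- by move=> x y _ _; rewrite invD psiD tauD.
Qed.
End Expansion.
End ValuedExponential.

(** * The real closure *)

Section RealClosureData.
Context {d : Order.disp_t} {I : orderType d}.
Variables (C K : rcfType).
Local Notation G := (hahn_sum I C).
Local Notation F := (@monomial_field G C).

(** Convolution is computed only when the left factor has a single term; all other products are seen
    through [iotaM]. *)
Lemma hahn_mul_monom (a : C) (h : G) (g : G -> C) :
  hahn_mul (fun x => if x == h then a else 0) g = fun z => a * g (z - h).
Proof.
apply/funext => z; rewrite /hahn_mul -(@fsbig_widen _ _ _ _ [set h]) //.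
  by rewrite fsbig_set1 eqxx.
move=> x [_ /= /eqP xh]; by rewrite (negbTE xh) mul0r.
Qed.

Lemma hahn_const0 : hahn_const 0 = 0 :> (G -> C).
Proof. by apply/funext => x; rewrite /hahn_const; case: ifP. Qed.

Lemma hahn_constD (a b : C) : hahn_const (a + b) = hahn_const a + hahn_const b :> (G -> C).
Proof.
apply/funext => x; rewrite -[RHS]/(hahn_const a x + hahn_const b x) /hahn_const.
by case: ifP; rewrite ?addr0.
Qed.

Lemma hahn_constM (a b : C) : hahn_const (a * b) = hahn_mul (hahn_const a) (hahn_const b) :> (G -> C).
Proof.
rewrite /hahn_const hahn_mul_monom; apply/funext => x; rewrite subr0.
by case: ifP; rewrite ?mulr0.
Qed.

Lemma hahn_monomialD (g h : G) :
  hahn_monomial C (g + h) = hahn_mul (hahn_monomial C g) (hahn_monomial C h).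
Proof.
rewrite /hahn_monomial hahn_mul_monom; apply/funext => x.
by rewrite mul1r subr_eq addrC.
Qed.

Variable iota : (G -> C) -> K.
Hypothesis iota1 : iota (hahn_const 1) = 1.
Hypothesis iotaD : forall f g, F f -> F g -> iota (f + g) = iota f + iota g.
Hypothesis iotaM : forall f g, F f -> F g -> iota (hahn_mul f g) = iota f * iota g.
Hypothesis iota_lt : forall f g, F f -> F g -> hahn_lt f g -> iota f < iota g.

Definition iota_const (c : C) := iota (hahn_const c).
Definition iota_monomial (g : G) := iota (hahn_monomial C g).

Lemma iota0 : iota 0 = 0.
Proof.
have F0 : F 0 by rewrite -hahn_const0; apply: mf_const.
by apply: (addrI (iota 0)); rewrite -iotaD // !addr0.
Qed.

Lemma iotaN f : F f -> iota (- f) = - iota f.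
Proof.
move=> Ff; apply: (addrI (iota f)); rewrite -iotaD //; last exact: mf_opp.
by rewrite !subrr iota0.
Qed.

Lemma iota_const_zmod : zmod_morphism iota_const.
Proof.
move=> a b; rewrite /iota_const.
have -> : hahn_const (a - b) = hahn_const a - hahn_const b :> (G -> C).
  by apply: (addIr (hahn_const b)); rewrite subrK -hahn_constD subrK.
by rewrite iotaD ?iotaN //; [exact: mf_const|exact: mf_const|apply/mf_opp/mf_const].
Qed.

Lemma iota_const_monoid : monoid_morphism iota_const.
Proof.
split=> // a b; rewrite /iota_const hahn_constM iotaM //; exact: mf_const.
Qed.

Definition residue_embedding : {rmorphism C -> K} := HB.pack iota_const
  (GRing.isZmodMorphism.Build C K iota_const iota_const_zmod)
  (GRing.isMonoidMorphism.Build C K iota_const iota_const_monoid).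

Lemma iota_monomial_gt0 g : 0 < iota_monomial g.
Proof.
rewrite -iota0; apply: iota_lt; first by rewrite -hahn_const0; apply: mf_const.
  exact: mf_monomial.
rewrite /hahn_lt subr0; exists g; rewrite /hahn_monomial eqxx ltr01; split=> // j.
by move=> /lt_eqF ->.
Qed.

Lemma iota_monomialD g h : iota_monomial (g + h) = iota_monomial g * iota_monomial h.
Proof. by rewrite /iota_monomial hahn_monomialD iotaM //; apply: mf_monomial. Qed.

(** Lexicographically n t^g < 1 for every n: the series 1 - n t^g has coefficient 1 at exponent 0
    and nothing below, because g > 0. *)
Lemma iota_monomial_small g : 0 < g -> ll (iota_monomial g) 1.
Proof.
move=> g0 n; rewrite normr1 gtr0_norm ?iota_monomial_gt0 //.
have -> : n%:R = iota (hahn_const n%:R) :> K.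
  by rewrite -[RHS]/(residue_embedding n%:R) rmorph_nat.
rewrite -iotaM -1?iota1; try by [apply: mf_const|apply: mf_monomial].
apply: iota_lt; try by [apply: mf_const|apply: mf_mul; [apply: mf_const|apply: mf_monomial]].
have E j : (hahn_const 1 - hahn_mul (hahn_const n%:R) (hahn_monomial C g)) j =
    (j == 0)%:R - n%:R * (j == g)%:R :> C.
  rewrite -[LHS]/(hahn_const 1 j - hahn_mul (hahn_const n%:R) (hahn_monomial C g) j).
  rewrite /hahn_const hahn_mul_monom subr0 /hahn_monomial.
  by case: (j == 0); case: (j == g).
exists 0; rewrite E eqxx lt_eqF // mulr0 subr0 ltr01; split=> // j j0.
by rewrite E (lt_eqF j0) (lt_eqF (lt_trans j0 g0)) mulr0 subr0.
Qed.

Definition gsum (x : K) := exists s : seq (C * G),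
  x = \sum_(p <- s) iota_const p.1 * iota_monomial p.2.

Lemma gsum_term c g : gsum (iota_const c * iota_monomial g).
Proof. by exists [:: (c, g)]; rewrite big_seq1. Qed.

Lemma gsumD x y : gsum x -> gsum y -> gsum (x + y).
Proof. by move=> [s ->] [t ->]; exists (s ++ t); rewrite big_cat. Qed.

Lemma gsumN x : gsum x -> gsum (- x).
Proof.
move=> [s ->]; exists [seq (- p.1, p.2) | p <- s].
rewrite big_map -sumrN; apply: eq_bigr => p _ /=.
by rewrite -mulNr; congr (_ * _); rewrite -[RHS]/(residue_embedding (- p.1)) rmorphN.
Qed.

Lemma gsumM x y : gsum x -> gsum y -> gsum (x * y).
Proof.
move=> [s ->] [t ->]; rewrite big_distrlr /=.
apply: (big_ind gsum); first by exists [::]; rewrite big_nil.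
  exact: gsumD.
move=> p _; apply: (big_ind gsum); first by exists [::]; rewrite big_nil.
  exact: gsumD.
move=> q _; rewrite mulrACA -iota_monomialD.
have -> : iota_const p.1 * iota_const q.1 = iota_const (p.1 * q.1).
  by rewrite -[RHS]/(residue_embedding (p.1 * q.1)) rmorphM.
exact: gsum_term.
Qed.

(** Induction on the generation of the subfield. For an inverse the fraction is turned over, and f g
    = 1 shows that its numerator is non-zero. *)
Lemma iota_fraction f : F f -> exists P Q, [/\ gsum P, gsum Q, Q != 0 & iota f = P / Q].
Proof.
have m0 : iota_monomial 0 = 1 := tau0 iota_monomial_gt0 iota_monomialD.
have gc c : gsum (iota_const c) by have := gsum_term c 0; rewrite m0 mulr1.
have gm h : gsum (iota_monomial h) by have := gsum_term 1 h; rewrite [iota_const 1]iota1 mul1r.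
have g1 : gsum 1 by rewrite -m0.
elim=> {f} [c|h|f g Ff [P [Q [gP gQ Q0 fE]]] Fg [P' [Q' [gP' gQ' Q0' gE]]]
  |f Ff [P [Q [gP gQ Q0 fE]]]|f g Ff [P [Q [gP gQ Q0 fE]]] Fg [P' [Q' [gP' gQ' Q0' gE]]]
  |f g Ff [P [Q [gP gQ Q0 fE]]] hg fg].
- by exists (iota_const c), 1; rewrite divr1 oner_neq0.
- by exists (iota_monomial h), 1; rewrite divr1 oner_neq0.
- exists (P * Q' + P' * Q), (Q * Q'); rewrite iotaD // fE gE addf_div // mulf_neq0 //.
  by split=> //; [apply: gsumD; apply: gsumM|apply: gsumM].
- by exists (- P), Q; rewrite iotaN // fE mulNr; split=> //; apply: gsumN.
- exists (P * P'), (Q * Q'); rewrite iotaM // fE gE mulf_div mulf_neq0 //.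
  by split=> //; apply: gsumM.
- have Fg : F g by apply: mf_inv Ff hg fg.
  have : iota f * iota g = 1 by rewrite -iotaM // fg iota1.
  rewrite fE => PQg; exists Q, P.
  have P0 : P != 0.
    by apply/eqP => P0; move: PQg; rewrite P0 !mul0r => /esym/eqP; rewrite oner_eq0.
  split=> //; apply: (mulfI (_ : P / Q != 0)); first by rewrite mulf_neq0 ?invr_eq0.
  by rewrite PQg; field; rewrite P0 Q0.
Qed.

Hypothesis C_arch : forall c : C, exists n : nat, `|c| <= n%:R.
Hypothesis iota_alg : forall y : K, exists p : {poly K},
  [/\ p != 0, forall i, (iota @` F) p`_i & root p y].

Lemma real_closure_lead y : y != 0 -> has_lead residue_embedding iota_monomial y.
Proof.
move=> y0; have [p [p0 pF py]] := iota_alg y.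
have t0 := iota_monomial_gt0; have tD := iota_monomialD.
have tc := @tau_cmp _ I C K iota_monomial t0 tD iota_monomial_small.
apply: (algebraic_lead C_arch t0 tD tc (@hahn_sum_div _ I C) p0 _ py y0).
move=> i; have [f Ff <-] := pF i; have [P [Q [[s PE] [t QE] Q0 ->]]] := iota_fraction Ff.
have := gsum_lead residue_embedding C_arch t0 tD tc s; rewrite -PE => -[->|lP].
  by left; rewrite mul0r.
have := gsum_lead residue_embedding C_arch t0 tD tc t; rewrite -QE => -[/eqP|lQ].
  by rewrite (negbTE Q0).
by right; apply: has_leadM => //; apply: has_leadV.
Qed.

(** An element of K is coded by a polynomial together with the rank of the element among the roots;
    the coefficients are coded by finite trees recording how they are built from constants and
    monomials. *)
Lemma real_closure_countable : countable [set: C] -> countable [set: G] ->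
  countable [set: K].
Proof.
have surj (T : Type) (x0 : T) : countable [set: T] -> exists u : nat -> T, forall x, exists n, u n = x.
  move=> /countable_injP[e e_inj].
  have /choice[u uE] : forall n, exists x, forall y, e y = n -> x = y.
    move=> n; have [[y ye]|h] := pselect (exists y, e y = n); last first.
      by exists x0 => y ye; case: h; exists y.
    by exists y => z ze; apply: e_inj; rewrite ?inE // ye.
  by exists u => x; exists (e x); apply: uE.
move=> /(surj _ 0)[uC uCP] /(surj _ 0)[uG uGP].
(* A unary node negates if its label is 1 and inverts otherwise; label 3 is used for inverses
   below. *)
pose ev := fix ev (t : GenTree.tree (nat + nat)) : K := match t with
  | GenTree.Leaf (inl n) => iota_const (uC n)
  | GenTree.Leaf (inr n) => iota_monomial (uG n)
  | GenTree.Node 0 [:: a; b] => ev a + ev b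
  | GenTree.Node 1 [:: a] => - ev a
  | GenTree.Node 2 [:: a; b] => ev a * ev b
  | GenTree.Node _ [:: a] => (ev a)^-1
  | _ => 0 end.
have evF f : F f -> exists t, ev t = iota f.
  elim=> {f} [c|h|f g Ff [s sE] Fg [t tE]|f Ff [s sE]|f g Ff [s sE] Fg [t tE]|f g Ff [s sE] hg fg].
  - by have [n nE] := uCP c; exists (GenTree.Leaf (inl n)); rewrite /= nE.
  - by have [n nE] := uGP h; exists (GenTree.Leaf (inr n)); rewrite /= nE.
  - by exists (GenTree.Node 0 [:: s; t]); rewrite iotaD //= sE tE.
  - by exists (GenTree.Node 1 [:: s]); rewrite iotaN //= sE.
  - by exists (GenTree.Node 2 [:: s; t]); rewrite iotaM //= sE tE.
  - have Fg : F g by apply: mf_inv Ff hg fg.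
    have fg1 : iota f * iota g = 1 by rewrite -iotaM // fg iota1.
    exists (GenTree.Node 3 [:: s]); rewrite /= sE -[LHS]mulr1 -fg1 mulKf //.
    by apply/eqP => f0; move: fg1; rewrite f0 mul0r => /esym/eqP; rewrite oner_eq0.
pose Fn (c : seq (GenTree.tree (nat + nat)) * nat) : K :=
  nth 0 (rootsR (Poly [seq ev t | t <- c.1])) c.2.
have Fn_surj y : exists c, Fn c = y.
  have [p [p0 pF py]] := iota_alg y.
  have /choice[t tE] : forall i, exists t, ev t = p`_i.
    by move=> i; have [f /evF[t <-] <-] := pF i; exists t.
  have pE : Poly [seq ev u | u <- mkseq t (size p)] = p.
    rewrite -[RHS]polyseqK; congr Poly; apply: (@eq_from_nth _ 0).
      by rewrite size_map size_mkseq.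
    rewrite size_map size_mkseq => i ip.
    by rewrite (nth_map (t 0%N)) ?size_mkseq // nth_mkseq.
  exists (mkseq t (size p), index y (rootsR p)); rewrite /Fn /= pE nth_index //.
  by rewrite -(roots_on_rootsR p0) py andbT in_itv.
suff -> : [set: K] = range Fn.
  by apply: (card_le_trans (card_image_le _ _)); apply: countableP.
by apply/seteqP; split=> // y _; have [c <-] := Fn_surj y; exists c.
Qed.

End RealClosureData.

Theorem hahn_real_closure (C K : rcfType) :
  (forall c : C, exists n : nat, `|c| <= n%:R) -> countable [set: C] ->
  real_closure_of (@monomial_field (hahn_sum rat C) C) K ->
  [/\ countable [set: K], exists x : K, ll 1 x, left_exponentiation K
    & exists gamma : {rmorphism C -> K},
        forall x, vle x 1 -> exists c, ll (x - gamma c) 1].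
Proof.
move=> C_arch C_count [iota [iota1 iotaD iotaM iota_lt iota_alg]].
have C_count' : countable [set: hahn_sum rat C] by exact: (@countable_hahn_sum _ rat C (countableP _) C_count).
pose gamma := residue_embedding iota1 iotaD iotaM.
pose tau := iota_monomial iota.
have t0 : forall g, 0 < tau g := iota_monomial_gt0 iotaD iota_lt.
have tD : forall g h, tau (g + h) = tau g * tau h := iota_monomialD iotaM.
have ts : forall g, 0 < g -> ll (tau g) 1 := iota_monomial_small iota1 iotaD iotaM iota_lt.
have lead : forall y, y != 0 -> has_lead gamma tau y :=
  real_closure_lead iota1 iotaD iotaM iota_lt C_arch iota_alg.
have tc := tau_cmp t0 tD ts.
have K_count : countable [set: K].
  exact: (real_closure_countable iota1 iotaD iotaM iota_alg).
split=> //.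
- have [f [f0 _]] := @hahn_sum_delta _ rat C 0; exists (tau (- f)).
  rewrite -(tau0 t0 tD); apply: (tau_lt t0 tD ts).
  by rewrite -hahn_sum_oppr_gt0 opprK.
- have [b [b_lead b_span]] := valuation_basis C_arch t0 tD tc lead K_count.
  have neg_count : countable [set g : hahn_sum rat C | g < 0].
    exact: sub_countable (subset_card_le _) C_count'.
  have [phi [phi_bij phi_mono]] := cantor_isomorphism (countableP [set: rat])
    neg_count rat_unbounded_dense (hahn_sum_neg_unbounded_dense 0).
  apply: (expansion_exponential C_arch t0 tD ts lead b_lead b_span phi_bij).
  by move=> i j; apply: phi_mono.
(* A finite non-zero [x] has leading exponent [g] at least 0: for g = 0 its leading coefficient is
   the residue, for g > 0 the residue is 0. *)
exists gamma => x x1; have [->|/lead[c [g cg]]] := eqVneq x 0.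
  by exists 0; rewrite rmorph0 subrr; apply/ll0/oner_neq0.
have g1 : vle (tau g) 1 := vle_trans (vle_leads C_arch cg) x1.
case: (tc g) => [g0|gl|]; last by move: g1 => /vleNll.
  by exists c; case: cg => _; rewrite g0 (tau0 t0 tD) mulr1.
exists 0; rewrite rmorph0 subr0; apply: vle_ll_trans gl; exact: leads_vle cg.
Qed.

(** * Relative computability *)

Lemma npairK1 m n : nfst (npair m n) = m.
Proof. by rewrite /nfst /npair Cantor.cancel_of_to. Qed.

Lemma npairK2 m n : nsnd (npair m n) = n.
Proof. by rewrite /nsnd /npair Cantor.cancel_of_to. Qed.

Lemma npairK n : npair (nfst n) (nsnd n) = n.
Proof. by rewrite /npair /nfst /nsnd -surjective_pairing Cantor.cancel_to_of. Qed.

Lemma leq_npair m n : (m + n <= npair m n)%N.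
Proof. by apply/ssrnat.leP; rewrite addnC; apply: Cantor.to_nat_non_decreasing. Qed.

Section Computability.
Variable A : pred nat.
Local Notation comp := (computable_fun_in A).

Lemma comp_id : comp id.
Proof. by exists (RPair RFst RSnd) => x; exists (nfst x), (nsnd x); split=> //; rewrite npairK. Qed.

Lemma comp_comp f g : comp f -> comp g -> comp (fun x => f (g x)).
Proof. by move=> [c cf] [e eg]; exists (RComp c e) => x; exists (g x). Qed.

Lemma comp_succ f : comp f -> comp (fun x => (f x).+1).
Proof. by move=> [c cf]; exists (RComp RSucc c) => x; exists (f x). Qed.

Lemma comp_const n : comp (fun=> n).
Proof. by elim: n => [|n /comp_succ//]; exists RZero. Qed.

Lemma comp_fst f : comp f -> comp (fun x => nfst (f x)).
Proof. by move=> [c cf]; exists (RComp RFst c) => x; exists (f x). Qed.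

Lemma comp_snd f : comp f -> comp (fun x => nsnd (f x)).
Proof. by move=> [c cf]; exists (RComp RSnd c) => x; exists (f x). Qed.

Lemma comp_pair f g : comp f -> comp g -> comp (fun x => npair (f x) (g x)).
Proof. by move=> [c cf] [e eg]; exists (RPair c e) => x; exists (f x), (g x). Qed.

Lemma comp_oracle f : comp f -> comp (fun x => nat_of_bool (A (f x))).
Proof. by move=> [c cf]; exists (RComp ROracle c) => x; exists (f x). Qed.

Lemma comp2 F f g : comp (fun p => F (nfst p) (nsnd p)) -> comp f -> comp g ->
  comp (fun x => F (f x) (g x)).
Proof.
move=> cF cf cg; have [c h] := comp_comp cF (comp_pair cf cg).
by exists c => x; have := h x; rewrite npairK1 npairK2.
Qed.

Lemma comp_rec h H k : comp h ->
  comp (fun p => H (nfst p) (nfst (nsnd p)) (nsnd (nsnd p))) -> comp k ->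
  comp (fun x => nat_rect (fun=> nat) (h x) (fun j z => H x j z) (k x)).
Proof.
move=> [ch hh] [cH HH] ck; have [ci hi] := comp_pair comp_id ck.
exists (RComp (RPrec ch cH) ci) => x; exists (npair x (k x)); first exact: hi.
rewrite /= npairK1 npairK2; elim: (k x) => [|j IHj]; first exact: hh.
by eexists; split; [exact: IHj|have := HH (npair x (npair j (nat_rect (fun=> nat) (h x) (fun j z => H x j z) j))); rewrite !(npairK1, npairK2)].
Qed.

Lemma comp_if0 b f g : comp b -> comp f -> comp g ->
  comp (fun x => if b x == 0%N then f x else g x).
Proof.
move=> cb cf cg; have [|c h] := comp_rec (H := fun x _ _ => g x) cf _ cb.
  exact: (comp_comp cg (comp_fst comp_id)).
by exists c => x; have := h x; case: (b x).
Qed.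

Lemma comp_if b f g : comp (fun x => nat_of_bool (b x)) -> comp f -> comp g ->
  comp (fun x => if b x then f x else g x).
Proof.
move=> cb cf cg; have [c h] := comp_if0 cb cg cf.
by exists c => x; have := h x; case: (b x).
Qed.

Lemma comp_pred f : comp f -> comp (fun x => (f x).-1).
Proof.
move=> cf; have [|c h] := comp_rec (H := fun _ j _ => j) (comp_const 0) _ cf.
  exact: comp_fst (comp_snd comp_id).
by exists c => x; have := h x; case: (f x).
Qed.

Lemma comp_add f g : comp f -> comp g -> comp (fun x => (f x + g x)%N).
Proof.
move=> cf cg; have [|c h] := comp_rec (H := fun _ _ z => z.+1) cf _ cg.
  exact: comp_succ (comp_snd (comp_snd comp_id)).
exists c => x; have := h x; suff -> : forall m n,
  nat_rect (fun=> nat) m (fun _ z => z.+1) n = (m + n)%N by [].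
by move=> m; elim=> [|n IHn] /=; rewrite ?addn0 // IHn addnS.
Qed.

Lemma comp_mul f g : comp f -> comp g -> comp (fun x => (f x * g x)%N).
Proof.
move=> cf cg; have [|c h] := comp_rec (H := fun x _ z => (z + f x)%N) (comp_const 0) _ cg.
  by apply: comp_add; [exact: comp_snd (comp_snd comp_id)|exact: comp_comp (comp_fst comp_id)].
exists c => x; have := h x; suff -> : forall m n,
  nat_rect (fun=> nat) 0 (fun _ z => (z + m)%N) n = (m * n)%N by [].
by move=> m; elim=> [|n IHn] /=; rewrite ?muln0 // IHn mulnS addnC.
Qed.

Lemma comp_sub f g : comp f -> comp g -> comp (fun x => (f x - g x)%N).
Proof.
move=> cf cg; have [|c h] := comp_rec (H := fun _ _ z => z.-1) cf _ cg.
  exact: comp_pred (comp_snd (comp_snd comp_id)).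
exists c => x; have := h x; suff -> : forall m n,
  nat_rect (fun=> nat) m (fun _ z => z.-1) n = (m - n)%N by [].
by move=> m; elim=> [|n IHn] /=; rewrite ?subn0 // IHn subnS.
Qed.

Lemma comp_not b : comp (fun x => nat_of_bool (b x)) -> comp (fun x => nat_of_bool (~~ b x)).
Proof.
move=> cb; have [c h] := comp_sub (comp_const 1) cb.
by exists c => x; have := h x; case: (b x).
Qed.

Lemma comp_or a b : comp (fun x => nat_of_bool (a x)) -> comp (fun x => nat_of_bool (b x)) ->
  comp (fun x => nat_of_bool (a x || b x)).
Proof.
move=> ca cb; have [c h] := comp_if ca (comp_const 1) cb.
by exists c => x; have := h x; case: (a x).
Qed.

Lemma comp_eq0 f : comp f -> comp (fun x => nat_of_bool (f x == 0%N)).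
Proof.
move=> cf; have [c h] := comp_if0 cf (comp_const 1) (comp_const 0).
by exists c => x; have := h x; case: (f x).
Qed.

Lemma comp_leq f g : comp f -> comp g -> comp (fun x => nat_of_bool (f x <= g x)%N).
Proof. by move=> cf cg; apply: comp_eq0; apply: comp_sub. Qed.

Lemma comp_eq f g : comp f -> comp g -> comp (fun x => nat_of_bool (f x == g x)%N).
Proof.
move=> cf cg; have [c h] := comp_eq0 (comp_add (comp_sub cf cg) (comp_sub cg cf)).
by exists c => x; have := h x; rewrite addn_eq0 !subn_eq0 eqn_leq.
Qed.

Lemma comp_odd f : comp f -> comp (fun x => nat_of_bool (odd (f x))).
Proof.
move=> cf; have [|c h] := comp_rec (H := fun _ _ z => (1 - z)%N) (comp_const 0) _ cf.
  by apply: comp_sub; [exact: comp_const|exact: comp_snd (comp_snd comp_id)].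
exists c => x; have := h x; suff -> : forall n,
  nat_rect (fun=> nat) 0 (fun _ z => (1 - z)%N) n = odd n by [].
by elim=> //= n ->; case: (odd n).
Qed.

Lemma comp_half f : comp f -> comp (fun x => (f x)./2).
Proof.
move=> cf; have [|c h] := comp_rec (H := fun _ j z => (odd j + z)%N) (comp_const 0) _ cf.
  apply: comp_add; [apply: comp_odd|]; last exact: comp_snd (comp_snd comp_id).
  exact: comp_fst (comp_snd comp_id).
exists c => x; have := h x; suff -> : forall n,
  nat_rect (fun=> nat) 0 (fun j z => (odd j + z)%N) n = n./2 by [].
by elim=> //= n ->; rewrite uphalf_half.
Qed.

Lemma comp_exists (b : nat -> nat -> bool) f :
  comp (fun p => nat_of_bool (b (nfst p) (nsnd p))) -> comp f ->
  comp (fun x => nat_of_bool (has (b x) (iota 0 (f x)))).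
Proof.
move=> cb cf.
have [|c h] := comp_rec (H := fun x j z => nat_of_bool ((z != 0%N) || b x j)) (comp_const 0) _ cf.
  apply: comp_or; first by apply/comp_not/comp_eq0/comp_snd/comp_snd/comp_id.
  apply: (comp2 (F := fun x y => nat_of_bool (b x y)) cb); first exact: comp_fst comp_id.
  exact: comp_fst (comp_snd comp_id).
exists c => x; have := h x; suff -> : forall n,
  nat_rect (fun=> nat) 0 (fun j z => nat_of_bool ((z != 0%N) || b x j)) n =
  has (b x) (iota 0 n) by [].
elim=> // n IHn; rewrite -[in RHS]addn1 iotaD has_cat [LHS]/= IHn /= orbF add0n.
by case: (has _ _).
Qed.

Lemma comp_iter (F : nat -> nat -> nat) h k :
  comp (fun p => F (nfst p) (nsnd p)) -> comp h -> comp k ->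
  comp (fun x => iter (k x) (F x) (h x)).
Proof.
move=> cF ch ck; have [|c hc] := comp_rec (H := fun x _ z => F x z) ch _ ck.
  apply: (comp2 cF); first exact: comp_fst comp_id.
  exact: comp_snd (comp_snd comp_id).
exists c => x; have := hc x; suff -> : forall n,
  nat_rect (fun=> nat) (h x) (fun _ z => F x z) n = iter n (F x) (h x) by [].
by elim=> //= n ->.
Qed.

End Computability.

Ltac comp_step :=
  match goal with
  | H : computable_fun_in ?A ?f |- computable_fun_in ?A ?f => exact H
  | |- computable_fun_in _ (fun _ => ?n) => refine (@comp_const _ n)
  | |- computable_fun_in _ (fun x => x) => refine (@comp_id _)
  | |- computable_fun_in _ nfst => refine (comp_fst (comp_id _))
  | |- computable_fun_in _ nsnd => refine (comp_snd (comp_id _))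
  | |- computable_fun_in _ succn => refine (comp_succ (comp_id _))
  | |- computable_fun_in _ predn => refine (comp_pred (comp_id _))
  | |- computable_fun_in _ (fun x => nfst (@?f x)) => refine (@comp_fst _ f _)
  | |- computable_fun_in _ (fun x => nsnd (@?f x)) => refine (@comp_snd _ f _)
  | |- computable_fun_in _ (fun x => npair (@?f x) (@?g x)) => refine (@comp_pair _ f g _ _)
  | |- computable_fun_in _ (fun x => S (@?f x)) => refine (@comp_succ _ f _)
  | |- computable_fun_in _ (fun x => predn (@?f x)) => refine (@comp_pred _ f _)
  | |- computable_fun_in _ (fun x => half (@?f x)) => refine (@comp_half _ f _)
  | |- computable_fun_in _ (fun x => addn (@?f x) (@?g x)) => refine (@comp_add _ f g _ _)
  | |- computable_fun_in _ (fun x => subn (@?f x) (@?g x)) => refine (@comp_sub _ f g _ _)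
  | |- computable_fun_in _ (fun x => muln (@?f x) (@?g x)) => refine (@comp_mul _ f g _ _)
  | |- computable_fun_in _ (fun x => nat_of_bool (@?f x == @?g x)) =>
      refine (@comp_eq _ f g _ _)
  | |- computable_fun_in _ (fun x => nat_of_bool (leq (@?f x) (@?g x))) =>
      refine (@comp_leq _ f g _ _)
  | |- computable_fun_in _ (fun x => nat_of_bool (odd (@?f x))) => refine (@comp_odd _ f _)
  | |- computable_fun_in _ (fun x => nat_of_bool (~~ (@?f x))) => refine (@comp_not _ f _)
  | |- computable_fun_in _ (fun x => nat_of_bool (@?f x || @?g x)) => refine (@comp_or _ f g _ _)
  | |- computable_fun_in ?A (fun x => nat_of_bool (?A (@?f x))) => refine (@comp_oracle A f _)
  | |- computable_fun_in _ (fun x => match _ with _ => _ end) =>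
      first [refine (@comp_if0 _ _ _ _ _ _ _) | refine (@comp_if _ _ _ _ _ _ _)]
  end; cbv beta.

Ltac comp_tac := repeat comp_step.

(** * Change of oracle and evaluation with finite oracles *)

Fixpoint oracle_subst (e c : rcode) : rcode :=
  match c with
  | ROracle => e
  | RPair c1 c2 => RPair (oracle_subst e c1) (oracle_subst e c2)
  | RComp c1 c2 => RComp (oracle_subst e c1) (oracle_subst e c2)
  | RPrec c1 c2 => RPrec (oracle_subst e c1) (oracle_subst e c2)
  | RMu c1 => RMu (oracle_subst e c1)
  | c => c
  end.

Lemma comp_subst A B f : computable_fun_in A (fun n => nat_of_bool (B n)) ->
  computable_fun_in B f -> computable_fun_in A f.
Proof.
move=> [e eB] [c cf]; exists (oracle_subst e c) => x; move: (f x) (cf x) => {f cf} y.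
elim: c x y => //=.
- by move=> x y ->.
- by move=> c1 IH1 c2 IH2 x y [y1 [y2 [/IH1 h1 /IH2 h2 ->]]]; exists y1, y2.
- by move=> c1 IH1 c2 IH2 x y [z /IH2 h2 /IH1 h1]; exists z.
- move=> c1 IH1 c2 IH2 x y; elim: (nsnd x) y => [|j IHj] y /=; first exact: IH1.
  by move=> [z [/IHj h /IH2 h2]]; exists z.
- move=> c IH x y [/IH h0 h]; split=> // k /h[z /IH hz]; by exists z.
Qed.

Definition bit (b i : nat) : bool := odd (iter i half b).

Definition agrees (A : pred nat) (w : nat) :=
  forall i, (i < nfst w)%N -> bit (nsnd w) i = A i.

(* The finite oracle w = <k, b> answers i < k by the bit i of b. The value is 0 if
   the computation queries the oracle beyond k or needs an unbounded search of
   length at least k, and y + 1 if it produces y. *)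
Fixpoint eval (c : rcode) (w x : nat) : nat :=
  match c with
  | RZero => 1
  | RSucc => x.+2
  | RFst => (nfst x).+1
  | RSnd => (nsnd x).+1
  | ROracle => if (x < nfst w)%N then (bit (nsnd w) x).+1 else 0
  | RPair c1 c2 =>
      if eval c1 w x == 0%N then 0%N else if eval c2 w x == 0%N then 0%N else
      (npair (eval c1 w x).-1 (eval c2 w x).-1).+1
  | RComp c1 c2 =>
      if eval c2 w x == 0%N then 0%N else eval c1 w (eval c2 w x).-1
  | RPrec c1 c2 =>
      nat_rect (fun=> nat) (eval c1 w (nfst x)) (fun j z =>
        if z == 0%N then 0%N else eval c2 w (npair (nfst x) (npair j z.-1))) (nsnd x)
  | RMu c1 =>
      (nat_rect (fun=> nat) 0 (fun j z => if z == 0%N then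
         (if eval c1 w (npair x j) == 0%N then 1%N else
          if eval c1 w (npair x j) == 1%N then j.+2 else 0%N) else z) (nfst w)).-1
  end.

(** For fixed [c], by induction on [c]: unbounded search has become a recursion of length [nfst w],
    and the oracle has become a number. *)
Lemma comp_eval A c : computable_fun_in A (fun p => eval c (nfst p) (nsnd p)).
Proof.
elim: c => [|||||c1 IH1 c2 IH2|c1 IH1 c2 IH2|c1 IH1 c2 IH2|c1 IH1] /=.
- by comp_tac.
- by comp_tac.
- by comp_tac.
- by comp_tac.
- rewrite /bit; comp_tac.
  by apply: (comp_iter (F := fun _ z => half z)); comp_tac.
- by comp_tac.
- by comp_tac; apply: (comp2 IH1); comp_tac.
- apply: comp_rec; comp_tac; first by apply: (comp2 IH1); comp_tac.
  by apply: (comp2 IH2); comp_tac.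
- by apply: comp_pred; apply: comp_rec; comp_tac; apply: (comp2 IH1); comp_tac.
Qed.

Lemma eval_sound A c w x y : agrees A w -> eval c w x = y.+1 -> Defs.rgraph A c x y.
Proof.
move=> Aw; elim: c x y => [x y [<-]|x y [<-]|x y [<-]|x y [<-]|x y /=
  |c1 IH1 c2 IH2 x y /=|c1 IH1 c2 IH2 x y /=|c1 IH1 c2 IH2 x y /=|c1 IH1 x y /=] //.
- by case: ifP => // xw [<-]; rewrite Aw.
- case E1: (eval c1 w x) => [//|y1] /=; case E2: (eval c2 w x) => [//|y2] /= [<-].
  by exists y1, y2; split=> //; [apply: IH1|apply: IH2].
- by case E2: (eval c2 w x) => [//|z] /= E1; exists z; [apply: IH2|apply: IH1].
- elim: (nsnd x) y => [|j IHj] y /=; first exact: IH1.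
  move: IHj; set r := nat_rect _ _ _ j => IHj.
  by case E: r => [//|z] /= E2; exists z; split; [exact: IHj|exact: IH2].
(* States of the search: 0 while all values met are positive, 1 once a value is undefined, z + 2
   once the first zero is found at z. The final predecessor turns this into the convention of
   [eval]. *)
- set R := nat_rect (fun=> nat) _ _; have key n : (R n = 0%N -> forall k, (k < n)%N ->
      exists z, Defs.rgraph A c1 (npair x k) z.+1) /\ (forall z, R n = z.+2 ->
      Defs.rgraph A (RMu c1) x z).
    elim: n => [|n [IHn IHn']] //; rewrite /=.
    case: (R n) IHn IHn' => [|z] IHn IHn' /=; last by split=> // z' h; apply: IHn'.
    case E: (eval c1 w (npair x n)) => [|[|v]] /=; split=> //.
    + move=> z [<-]; split; first exact: IH1.
      exact: IHn.
    + by move=> _ k; rewrite ltnS leq_eqVlt => /predU1P[->|/IHn]; [exists v; apply: IH1|apply].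
  have [_ h] := key (nfst w); case E: (R (nfst w)) => [//|z] /= zy.
  by apply: h; rewrite E zy.
Qed.

Lemma uniform_bound (P : nat -> nat -> Prop) n :
  (forall k, (k < n)%N -> exists m0, forall m, (m0 <= m)%N -> P k m) ->
  exists m0, forall k m, (k < n)%N -> (m0 <= m)%N -> P k m.
Proof.
elim: n => [|n IHn] h; first by exists 0%N.
have [k kn|m1 h1] := IHn; first by apply: h; apply: ltnW.
have [m2 h2] := h n (leqnn _); exists (maxn m1 m2) => k m.
rewrite ltnS leq_eqVlt geq_max => /predU1P[->|kn] /andP[? ?]; [exact: h2|exact: h1].
Qed.

(** A halting computation consults finitely much of the oracle. The claim covers all lengths from
    [k0] on, so that the bounds of subcomputations combine by maximum; a search also needs a length
    exceeding its result. *)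
Lemma eval_complete A c x y : Defs.rgraph A c x y ->
  exists k0, forall k, (k0 <= k)%N -> forall w, agrees A w -> nfst w = k -> eval c w x = y.+1.
Proof.
elim: c x y => [x y ->|x y ->|x y ->|x y ->|x y ->|c1 IH1 c2 IH2 x y|c1 IH1 c2 IH2 x y
  |c1 IH1 c2 IH2 x y|c1 IH1 x y] /=; try by exists 0%N.
- by exists x.+1 => k kx w Aw wk; rewrite wk kx Aw // wk.
- move=> [y1 [y2 [/IH1[k1 h1] /IH2[k2 h2] ->]]]; exists (maxn k1 k2) => k.
  rewrite geq_max => /andP[kk1 kk2] w Aw wk.
  by rewrite (h1 _ kk1 w Aw wk) (h2 _ kk2 w Aw wk).
- move=> [z /IH2[k2 h2] /IH1[k1 h1]]; exists (maxn k1 k2) => k.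
  rewrite geq_max => /andP[kk1 kk2] w Aw wk.
  by rewrite (h2 _ kk2 w Aw wk) /= (h1 _ kk1 w Aw wk).
- elim: (nsnd x) y => [|j IHj] y /=; first exact: IH1.
  move=> [z [/IHj[k1 h1] /IH2[k2 h2]]]; exists (maxn k1 k2) => k.
  rewrite geq_max => /andP[kk1 kk2] w Aw wk.
  by rewrite (h1 _ kk1 w Aw wk) /= (h2 _ kk2 w Aw wk).
- move=> [/IH1[k0 h0] h].
  have [k1 h1] := @uniform_bound (fun j k => forall w, agrees A w -> nfst w = k ->
    exists z, eval c1 w (npair x j) = z.+2) y
    (fun j jy => let: ex_intro z hz := h j jy in
      let: ex_intro m0 hm := IH1 _ _ hz in
      ex_intro _ m0 (fun m mm w Aw wm => ex_intro _ z (hm m mm w Aw wm))).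
  exists (maxn y.+1 (maxn k0 k1)) => k; rewrite !geq_max => /and3P[yk kk0 kk1] w Aw wk.
  set R := nat_rect (fun=> nat) _ _.
  have R0 n : (n <= y)%N -> R n = 0%N.
    elim: n => //= n IHn ny; rewrite IHn ?(ltnW ny) //=.
    by have [z ->] := h1 n k ny kk1 w Aw wk.
  have Ry n : R (y.+1 + n)%N = y.+2.
    have RS m : R m.+1 = if R m == 0%N then
       (if eval c1 w (npair x m) == 0%N then 1%N else
        if eval c1 w (npair x m) == 1%N then m.+2 else 0%N) else R m by [].
    elim: n => [|n IHn]; last by rewrite addnS RS IHn.
    by rewrite addn0 RS R0 // (h0 k kk0 w Aw wk).
  by rewrite wk -(subnKC yk) Ry.
Qed.

Lemma exists_agrees A k : exists w, agrees A w /\ nfst w = k.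
Proof.
suff [b bE] : exists b, forall i, (i < k)%N -> bit b i = A i.
  by exists (npair k b); rewrite /agrees npairK1 npairK2.
elim: k A => [|k IHk] A; first by exists 0%N.
have [b bE] := IHk (fun i => A i.+1); exists (A 0%N + b.*2)%N => -[_|i ik].
  by rewrite /bit /= oddD odd_double addbF; case: (A 0%N).
by rewrite /bit iterSr half_bit_double; apply: bE.
Qed.

(** * Recursive saturation *)

(** Determinism is read off the evaluator: one sufficiently long piece of the oracle produces both
    outputs. *)
Lemma rgraph_fun A c x y z : Defs.rgraph A c x y -> Defs.rgraph A c x z -> y = z.
Proof.
move=> /eval_complete[k1 h1] /eval_complete[k2 h2].
have [w [Aw wk]] := exists_agrees A (maxn k1 k2).
have := h1 _ (leq_maxl k1 k2) w Aw wk.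
by rewrite (h2 _ (leq_maxr k1 k2) w Aw wk) => -[].
Qed.

Fixpoint numeral (n : nat) : oterm :=
  if n is m.+1 then TAdd (numeral m) TOne else TZero.

Definition coef (y i : nat) : nat := nfst (iter i nsnd y).

Arguments coef : simpl never.

(* The number y = <a, <b, <c, <a', <b', <c', _>>>>>> stands for the disjunction of
   c x + b < a and c' x + b' >= a'. *)
Definition linear_clause (F : numDomainType) (y : nat) (x : F) : Prop :=
  (coef y 2)%:R * x + (coef y 1)%:R < (coef y 0)%:R \/
  ~ ((coef y 5)%:R * x + (coef y 4)%:R < (coef y 3)%:R).

Definition linear_form (a b c : nat) : oform :=
  FLt (TAdd (TMul (numeral c) (TVar 0)) (numeral b)) (numeral a).

Definition clause_form (y : nat) : oform :=
  FOr (linear_form (coef y 0) (coef y 1) (coef y 2))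
      (FNot (linear_form (coef y 3) (coef y 4) (coef y 5))).

(** The condition (a - b)/(e + 1) < t from [cut], with denominator cleared and b moved to the other
    side. *)
Definition cut_form (t : oterm) (i : nat) : oform :=
  FLt (numeral (coef i 0)) (TAdd (TMul (numeral (nsnd (nsnd i)).+1) t) (numeral (coef i 1))).

(** This mirrors [cut_join]: parity selects a component at each level, [j] is the variable holding
    the current parameter, and the empty join answers no. *)
Fixpoint oracle_form (n j i : nat) : oform :=
  if n is m.+1 then
    if odd i then oracle_form m j.+1 i./2 else cut_form (TVar j) i./2
  else FLt TZero TZero.

Definition agrees_form (n w : nat) : oform :=
  nat_rect (fun=> oform) (FEq TZero TZero) (fun i phi =>
    FAnd phi (if bit (nsnd w) i then oracle_form n 1 i else FNot (oracle_form n 1 i)))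
    (nfst w).

(* The first conjunct makes the code of the formula at least N, so that the set of
   these formulas is decidable and not merely recursively enumerable. *)
Definition type_form (n : nat) (c : rcode) (N : nat) : oform :=
  FAnd (FEq (numeral N) (numeral N))
    (FImp (agrees_form n (nfst N))
       (if eval c (nfst N) (nsnd N) == 0%N then FEq TZero TZero
        else clause_form (eval c (nfst N) (nsnd N)).-1)).

Section FormulaCodes.
Variable A : pred nat.
Local Notation comp := (computable_fun_in A).

Lemma comp_numeral f : comp f -> comp (fun x => tcode (numeral (f x))).
Proof.
move=> cf.
have c1 : comp (fun p => npair 3 (npair (nsnd (nsnd p)) (npair 2 0))) by comp_tac.
have [c h] := comp_rec (H := fun _ _ z => npair 3 (npair z (npair 2 0)))
  (comp_const A (npair 1 0)) c1 cf.
exists c => x; have := h x; suff -> : forall n, nat_rect (fun=> nat) (npair 1 0)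
    (fun _ z => npair 3 (npair z (npair 2 0))) n = tcode (numeral n) by [].
by elim=> //= n ->.
Qed.

Lemma comp_coef i f : comp f -> comp (fun x => coef (f x) i).
Proof. by move=> cf; rewrite /coef; apply: comp_fst; elim: i => //= i; apply: comp_snd. Qed.

Ltac comp_form_tac := repeat first
  [ comp_step
  | match goal with
    | |- computable_fun_in _ (fun x => tcode (numeral (@?f x))) => refine (@comp_numeral f _)
    | |- computable_fun_in _ (fun x => coef (@?f x) ?i) => refine (@comp_coef i f _)
    end; cbv beta ].

Lemma comp_linear_form f g h : comp f -> comp g -> comp h ->
  comp (fun x => fcode (linear_form (f x) (g x) (h x))).
Proof. by move=> cf cg ch; rewrite /=; comp_form_tac. Qed.

Lemma comp_clause_form f : comp f -> comp (fun x => fcode (clause_form (f x))).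
Proof.
move=> cf; apply: comp_pair; first exact: comp_const.
apply: comp_pair; last apply: comp_pair; first 2 last.
- by apply: comp_linear_form; apply: comp_coef.
- by apply: comp_linear_form; apply: comp_coef.
exact: comp_const.
Qed.

Lemma comp_cut_form t f : comp f -> comp (fun x => fcode (cut_form t (f x))).
Proof. by move=> cf; rewrite /=; comp_form_tac. Qed.

Lemma comp_oracle_form n j f : comp f -> comp (fun x => fcode (oracle_form n j (f x))).
Proof.
elim: n j f => [|n IHn] j f cf /=; first by comp_tac.
have c2 : comp (fun x => (f x)./2) by comp_tac.
have [c h] := comp_if (comp_odd cf) (IHn j.+1 _ c2) (comp_cut_form (TVar j) c2).
by exists c => x; have := h x; case: (odd _).
Qed.

Lemma comp_bit f g : comp f -> comp g -> comp (fun x => nat_of_bool (bit (f x) (g x))).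
Proof.
by move=> cf cg; rewrite /bit; comp_tac; apply: (comp_iter (F := fun _ z => half z)); comp_tac.
Qed.

Lemma comp_agrees_form n f : comp f -> comp (fun x => fcode (agrees_form n (f x))).
Proof.
move=> cf.
pose H x i z := npair 3 (npair z (if bit (nsnd (f x)) i then fcode (oracle_form n 1 i)
  else npair 2 (fcode (oracle_form n 1 i)))).
have cH : comp (fun p => H (nfst p) (nfst (nsnd p)) (nsnd (nsnd p))).
  rewrite /H; comp_tac; try by apply: comp_oracle_form; comp_tac.
  by apply: comp_bit; comp_tac; apply: (comp_comp cf); comp_tac.
have [c h] := comp_rec (comp_const A (fcode (FEq TZero TZero))) cH (comp_fst cf).
exists c => x; have := h x; rewrite /agrees_form; suff -> : forall k,
  nat_rect (fun=> nat) (fcode (FEq TZero TZero)) (fun j z => H x j z) k =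
  fcode (nat_rect (fun=> oform) (FEq TZero TZero) (fun i phi =>
    FAnd phi (if bit (nsnd (f x)) i then oracle_form n 1 i else FNot (oracle_form n 1 i))) k) by [].
by elim=> [//|k IHk] /=; rewrite IHk /H; case: (bit _ _).
Qed.

Lemma comp_type_form n c : comp (fun N => fcode (type_form n c N)).
Proof.
have cev f g : comp f -> comp g -> comp (fun x => eval c (f x) (g x)).
  exact: (comp2 (comp_eval A c)).
have cE : comp (fun N => eval c (nfst N) (nsnd N)) by apply: cev; comp_tac.
have cC : comp (fun N => fcode (clause_form (eval c (nfst N) (nsnd N)).-1)).
  by apply: comp_clause_form; comp_tac.
have [e h] := comp_if0 cE (comp_const A (fcode (FEq TZero TZero))) cC.
have : comp (fun N => npair 3 (npair (fcode (FEq (numeral N) (numeral N)))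
  (npair 5 (npair (fcode (agrees_form n (nfst N)))
    (if eval c (nfst N) (nsnd N) == 0%N then fcode (FEq TZero TZero)
     else fcode (clause_form (eval c (nfst N) (nsnd N)).-1)))))).
  apply: comp_pair; first by comp_tac.
  apply: comp_pair; first by rewrite /=; comp_tac; apply: comp_numeral; comp_tac.
  apply: comp_pair; first by comp_tac.
  apply: comp_pair; first by apply: comp_agrees_form; comp_tac.
  by exists e.
by move=> [e' h']; exists e' => N; have := h' N; rewrite /type_form [fcode (FAnd _ _)]/=; case: ifP.
Qed.

End FormulaCodes.

Lemma leq_npairl m n : (m <= npair m n)%N.
Proof. exact: leq_trans (leq_addr _ _) (leq_npair _ _). Qed.

Lemma leq_npairr m n : (n <= npair m n)%N.
Proof. exact: leq_trans (leq_addl _ _) (leq_npair _ _). Qed.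

Lemma leq_numeral n : (n <= tcode (numeral n))%N.
Proof.
elim: n => [//|n IHn] /=; apply: leq_ltn_trans IHn _.
apply: leq_trans (leq_npair _ _); rewrite addSn ltnS.
exact: leq_trans (leq_npairl _ _) (leq_addl _ _).
Qed.

Lemma leq_type_form n c N : (N <= fcode (type_form n c N))%N.
Proof.
rewrite /type_form [fcode _]/=.
apply: leq_trans (leq_npairr _ _); apply: leq_trans (leq_npairl _ _).
apply: leq_trans (leq_npairr _ _); apply: leq_trans (leq_npairl _ _).
exact: leq_numeral.
Qed.

Lemma type_form_computable n c :
  computable_set (fcode @` [set phi | exists N, phi = type_form n c N]).
Proof.
have cb : computable_fun_in pred0
    (fun p => nat_of_bool (fcode (type_form n c (nsnd p)) == nfst p)).
  by comp_tac; apply: (comp_comp (comp_type_form pred0 n c)); comp_tac.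
have [e he] := comp_exists (b := fun x N => fcode (type_form n c N) == x) cb
  (comp_succ (comp_id pred0)).
exists e => x; have := he x; congr (Defs.rgraph _ _ _ (nat_of_bool _)).
apply/hasP/asboolP => [[N _ /eqP NE]|[_ [N ->] NE]].
  by exists (type_form n c N) => //; exists N.
by exists N; [rewrite mem_iota /= ltnS -NE leq_type_form|rewrite NE].
Qed.

Lemma tbelow_numeral k n : tbelow k (numeral n).
Proof. by elim: n => //= n ->. Qed.

Lemma fbelow_oracle_form n j i : (0 < j)%N -> fbelow (n + j) (oracle_form n j i).
Proof.
elim: n j i => [|n IHn] j i j0 //=; case: ifP => _; first by rewrite addSnnS IHn.
by rewrite /= !tbelow_numeral /= addSn ltnS leq_addl.
Qed.

Lemma fbelow_clause_form n y : fbelow n.+1 (clause_form y).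
Proof.
have h a b c : fbelow n.+1 (linear_form a b c) by rewrite /= !tbelow_numeral.
by apply/andP; split; apply: h.
Qed.

Lemma fbelow_agrees_form n w : fbelow n.+1 (agrees_form n w).
Proof.
rewrite /agrees_form; elim: (nfst w) => [//|k IHk].
rewrite [fbelow _ _]/= IHk -addn1; case: (bit _ _).
  exact: fbelow_oracle_form.
exact: (@fbelow_oracle_form n 1 k).
Qed.

Lemma fbelow_type_form n c N : fbelow n.+1 (type_form n c N).
Proof.
rewrite /type_form [fbelow _ _]/= !tbelow_numeral fbelow_agrees_form /=.
by case: (_ == _) => //; apply: fbelow_clause_form.
Qed.

(** Finite parts are tested in Q, so the assumption does not depend on K and is met by explicit
    rationals; [rho] serves to turn elements of C into oracles. *)
Definition computably_saturated (R : realType) (C K : rcfType)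
    (rho : {rmorphism C -> R}) : Prop :=
  forall (s : seq C) (f : nat -> nat),
    computable_fun_in (cut_join [seq rho c | c <- s]) f ->
    (forall N, exists x : rat, forall m, (m < N)%N -> linear_clause (f m) x) ->
    exists x : K, forall m, linear_clause (f m) x.

Lemma linear_clause_ratr (F : rcfType) y (x : rat) :
  linear_clause y (ratr x : F) <-> linear_clause y x.
Proof.
rewrite /linear_clause; suff E a b c :
    (c%:R * ratr x + b%:R < a%:R :> F) = (c%:R * x + b%:R < a%:R) by rewrite !E.
by rewrite -!(ratr_nat F) -rmorphM -rmorphD ltr_rat.
Qed.

Section RecursiveSaturation.
Variables (R : realType) (C K : rcfType).
Variables (rho : {rmorphism C -> R}) (gamma : {rmorphism C -> K}).

(** The inequality compares elements of C, so every real closed field receiving C decides it alike;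
    in particular K knows the oracle through its parameters. *)
Lemma cut_morph (F : rcfType) (sigma : {rmorphism C -> F}) (c : C) i :
  cut (rho c) i = ((coef i 0)%:R < (nsnd (nsnd i)).+1%:R * sigma c + (coef i 1)%:R).
Proof.
rewrite /cut /coef /=; move: (nfst i) (nfst (nsnd i)) (nsnd (nsnd i)) => a b e.
rewrite ltr_pdivrMr ?ltr0n // ltrBlDr [rho c * _]mulrC.
rewrite -!(rmorph_nat rho) -(rmorphM rho) -(rmorphD rho) rcf_morph_lt.
by rewrite -!(rmorph_nat sigma) -(rmorphM sigma) -(rmorphD sigma) rcf_morph_lt.
Qed.

Local Notation M := (ring_ostruct K).

Lemma tval_numeral (e : nat -> M) n : Defs.tval e (numeral n) = n%:R :> K.
Proof. by elim: n => //= n ->; rewrite -natr1. Qed.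

Lemma sat_clause_form (e : nat -> M) y : sat e (clause_form y) <-> linear_clause y (e 0%N : K).
Proof.
have h a b c : sat e (linear_form a b c) <-> c%:R * (e 0%N : K) + b%:R < a%:R.
  by rewrite /= !tval_numeral.
by rewrite /linear_clause -!h.
Qed.

Lemma sat_cut_form (e : nat -> M) t i : sat e (cut_form t i) <->
  (coef i 0)%:R < (nsnd (nsnd i)).+1%:R * (Defs.tval e t : K) + (coef i 1)%:R.
Proof.
have h a b c : sat e (FLt (numeral a) (TAdd (TMul (numeral c) t) (numeral b))) <->
    a%:R < c%:R * (Defs.tval e t : K) + b%:R by rewrite /= !tval_numeral.
exact: h.
Qed.

Lemma sat_oracle_form (e : nat -> M) (s : seq C) j i :
  (forall k, (k < size s)%N -> e (j + k)%N = gamma (nth 0 s k) :> K) ->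
  sat e (oracle_form (size s) j i) <-> cut_join [seq rho c | c <- s] i.
Proof.
elim: s j i => [|c s IHs] j i h; first by rewrite /= ltxx.
rewrite [oracle_form _ _ _]/= -[cut_join _]/(turing_join (cut (rho c)) (cut_join [seq rho c | c <- s])) /turing_join.
case: (odd i).
  by apply: (IHs j.+1) => k ks; rewrite addSnnS (h k.+1).
rewrite (cut_morph gamma); have <- := h 0%N isT; rewrite addn0.
exact: sat_cut_form.
Qed.

Lemma sat_agrees_form (e : nat -> M) (s : seq C) w :
  (forall k, (k < size s)%N -> e k.+1 = gamma (nth 0 s k) :> K) ->
  sat e (agrees_form (size s) w) <-> agrees (cut_join [seq rho c | c <- s]) w.
Proof.
move=> h; rewrite /agrees_form /agrees; elim: (nfst w) => [|k IHk] //=.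
have ho := sat_oracle_form k (j := 1) h.
have hb : sat e (if bit (nsnd w) k then oracle_form (size s) 1 k
    else FNot (oracle_form (size s) 1 k)) <->
    bit (nsnd w) k = cut_join [seq rho c | c <- s] k.
  by case: (bit _ _) => /=; rewrite ho; case: (cut_join _ k); split.
split=> [[/IHk h1 /hb h2] i|hk].
  by rewrite ltnS leq_eqVlt => /predU1P[->|/h1].
by split; [apply/IHk => i ik; apply: hk; apply: ltnW|apply/hb/hk].
Qed.

(** The formula with index <w, m> asserts the clause that [c] computes from the finite oracle w on
    m, provided w is correct. An incorrect w makes it vacuous, and a correct one yields the clause
    [f m] or nothing. *)
Lemma saturated_clauses : recursively_saturated M -> @computably_saturated R C K rho.
Proof.
move=> M_sat s f [c cf] f_sat; pose A := cut_join [seq rho c | c <- s].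
pose n := size s; pose tau : set oform := [set phi | exists N, phi = type_form n c N].
pose a : n.-tuple M := @Tuple n M [seq (gamma c : M) | c <- s] (introT eqP (size_map _ _)).
have env (x : K) k : (k < size s)%N -> nth (x : M) (x :: a : seq M) k.+1 = gamma (nth 0 s k) :> K.
  by move=> ks; rewrite /= (nth_map 0).
have satE (x : K) N : sat (fun i => nth (x : M) (x :: a : seq M) i) (type_form n c N) <->
    (agrees A (nfst N) -> forall y, eval c (nfst N) (nsnd N) = y.+1 -> linear_clause y x).
  rewrite /type_form [sat _ _]/=; have ha := sat_agrees_form (nfst N) (env x).
  split=> [[_ h] /ha/h {}h y Ey|h]; first by move: h; rewrite Ey => /sat_clause_form.
  split; first exact: erefl.
  move=> /ha/h {}h; move: h; case: (eval _ _ _) => [|y] h; first exact: erefl.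
  by apply/sat_clause_form/h.
have [|||x xP] := M_sat n tau a.
- by move=> _ [N ->]; apply: fbelow_type_form.
- exact: type_form_computable.
- move=> D Dtau Dfin.
  have /choice[g gE] : forall phi, exists N, D phi -> phi = type_form n c N.
    by move=> phi; have [/Dtau[N ->]|] := pselect (D phi); [exists N|exists 0%N].
  have /finite_seqP[l lE] := finite_image (fun phi => nsnd (g phi)) Dfin.
  (* The formula with index N involves at most the clause number [nsnd N], so a rational satisfying
     all clauses up to the largest of these numbers realizes the finite part. *)
  have [q qP] := f_sat (\max_(i <- l) i).+1; exists (ratr q : K) => phi Dphi.
  rewrite (gE _ Dphi); apply/satE => Aw y /(eval_sound Aw)/rgraph_fun/(_ (cf _)) ->.
  have lg : nsnd (g phi) \in l.
    by have : [set` l] (nsnd (g phi)) by rewrite -lE; exists phi.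
  by apply/linear_clause_ratr/qP; rewrite ltnS; apply: (@leq_bigmax_seq _ l predT id _ lg).
(* Conversely, a correct and long enough w puts the clause [f m] into the type. *)
exists x => m; have [k0 hk] := eval_complete (cf m).
have [w [Aw wk]] := exists_agrees A k0.
have /satE := xP (type_form n c (npair w m)) (ex_intro _ _ erefl).
rewrite npairK1 npairK2; apply=> //; exact: hk wk.
Qed.

End RecursiveSaturation.

(** * Scott sets *)

Definition clause (a b c a' b' c' : nat) : nat :=
  npair a (npair b (npair c (npair a' (npair b' (npair c' 0))))).

Lemma linear_clauseE (F : numDomainType) a b c a' b' c' (x : F) :
  linear_clause (clause a b c a' b' c') x <->
  (c%:R * x + b%:R < a%:R \/ ~ (c'%:R * x + b'%:R < a'%:R)).
Proof. by rewrite /linear_clause /coef /clause /= !(npairK1, npairK2). Qed.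

Definition rat_of_code (i : nat) : rat :=
  ((nfst i)%:R - (nfst (nsnd i))%:R) / (nsnd (nsnd i)).+1%:R.

Lemma rat_of_code_surj q : exists i, rat_of_code i = q.
Proof.
have [c cE] : exists c : nat, (denq q) = c.+1 :> int.
  by have := denq_gt0 q; case: (denq q) => [[|c]|c] // _; exists c.
pose a := if 0 <= numq q then `|numq q|%N else 0%N.
pose b := if 0 <= numq q then 0%N else `|numq q|%N.
exists (npair a (npair b c)); rewrite /rat_of_code !(npairK1, npairK2).
rewrite -[RHS]divq_num_den cE; congr (_ / _); rewrite /a /b.
case: ger0P => q0; first by rewrite subr0 -[in RHS](ger0_norm q0) -abszE.
by rewrite sub0r -[in RHS](opprK (numq q)) -(ltr0_norm q0) -abszE mulrNz.
Qed.

Lemma ratr_rat_of_code (F : numFieldType) i : ratr (rat_of_code i) =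
  ((nfst i)%:R - (nfst (nsnd i))%:R) / (nsnd (nsnd i)).+1%:R :> F.
Proof. by rewrite /rat_of_code fmorph_div rmorphB !rmorph_nat. Qed.

Lemma cut_rat_of_code (R : realType) (r : R) i : cut r i = (ratr (rat_of_code i) < r).
Proof. by rewrite ratr_rat_of_code. Qed.

Lemma linear_lt (F : realFieldType) a b c (x : F) :
  (c.+1%:R * x + b%:R < a%:R) = (x < (a%:R - b%:R) / c.+1%:R).
Proof. by rewrite ltr_pdivlMr ?ltr0n // ltrBrDr [x * _]mulrC. Qed.

(** In a clause for a single inequality the other disjunct is made false: here the first is 0 < 0,
    in [upper_clause] the second is the negation of 0 < 1. *)
Definition lower_clause (i : nat) : nat :=
  clause 0 0 0 (nfst i) (nfst (nsnd i)) (nsnd (nsnd i)).+1.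

Definition upper_clause (i : nat) : nat :=
  clause (nfst i) (nfst (nsnd i)) (nsnd (nsnd i)).+1 1 0 0.

Lemma lower_clauseP (F : realFieldType) i (x : F) :
  linear_clause (lower_clause i) x <-> ratr (rat_of_code i) <= x.
Proof.
rewrite linear_clauseE mul0r addr0 ltxx linear_lt -ratr_rat_of_code.
by split=> [[//|/negP]|h]; [rewrite -leNgt|right; apply/negP; rewrite -leNgt].
Qed.

Lemma upper_clauseP (F : realFieldType) i (x : F) :
  linear_clause (upper_clause i) x <-> x < ratr (rat_of_code i).
Proof.
rewrite linear_clauseE mul0r addr0 ltr01 linear_lt -ratr_rat_of_code.
by split=> [[//|]|]; [case|left].
Qed.

Lemma ratr_rat (q : rat) : ratr q = q.
Proof. by rewrite /ratr divq_num_den. Qed.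

Section Residue.
Variables (R : realType) (C K : rcfType).
Variables (rho : {rmorphism C -> R}) (gamma : {rmorphism C -> K}).

Lemma subfield_arch (c : C) : exists n : nat, `|c| <= n%:R.
Proof.
exists (Num.bound `|rho c|); rewrite -(rcf_morph_le rho) rmorph_nat -rcf_morph_norm.
by apply: ltW; apply: archi_boundP.
Qed.

(** If c < d, then x - c would be at least d - c, which is positive in the Archimedean field C and
    hence not infinitesimal. *)
Lemma residue_le (x : K) c (d : C) : ll (x - gamma c) 1 -> gamma d <= x -> d <= c.
Proof.
move=> xc dx; rewrite leNgt; apply/negP => cd.
have := vle_gamma gamma subfield_arch (_ : d - c != 0); rewrite subr_eq0 gt_eqF // => /(_ isT).
move=> /vleNll; apply; apply: vle_ll_trans xc; apply: le_vle.
have : gamma c < gamma d by rewrite rcf_morph_lt.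
move: dx; rewrite rmorphB; move: (gamma c) (gamma d) => u v vx uv.
by rewrite !ger0_norm; lra.
Qed.

Lemma residue_ge (x : K) c (d : C) : ll (x - gamma c) 1 -> x <= gamma d -> c <= d.
Proof.
move=> xc dx; rewrite leNgt; apply/negP => cd.
have := vle_gamma gamma subfield_arch (_ : c - d != 0); rewrite subr_eq0 gt_eqF // => /(_ isT).
move=> /vleNll; apply; apply: vle_ll_trans xc; apply: le_vle.
have : gamma d < gamma c by rewrite rcf_morph_lt.
move: dx; rewrite rmorphB; move: (gamma c) (gamma d) => u v vx uv.
by rewrite [leRHS]distrC !ger0_norm; lra.
Qed.

Hypothesis residue : forall x : K, vle x 1 -> exists c, ll (x - gamma c) 1.
Hypothesis saturated : computably_saturated K rho.

(** Rational bounds around r are tightened so that none of the first N coded rationals lies strictly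
    between them; the lower bound is the witness. It may itself be coded, hence the weak
    inequality. *)
Lemma rational_approximation (r : R) (N : nat) : (forall q : rat, r != ratr q) ->
  exists x : rat, forall m, (m < N)%N -> (rat_of_code m <= x) = (ratr (rat_of_code m) < r).
Proof.
move=> r_irr; suff [lo [hi [lor rhi h]]] : exists lo hi : rat,
  [/\ ratr lo < r, r < ratr hi & forall m, (m < N)%N ->
    if ratr (rat_of_code m) < r then rat_of_code m <= lo else hi <= rat_of_code m].
  exists lo => m /h; case: ifP => [_ ->//|_ hm].
  apply/negbTE; rewrite -ltNge; apply: lt_le_trans hm.
  by rewrite -(ltr_rat R) (lt_trans lor).
elim: N => [|N [lo [hi [lor rhi h]]]].
  have [lo] : exists q : rat, ratr q \in `]r - 1, r[ by apply: rat_in_itvoo; rewrite ltrBlDr ltrDl.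
  have [hi] : exists q : rat, ratr q \in `]r, r + 1[ by apply: rat_in_itvoo; rewrite ltrDl.
  rewrite !in_itv /= => /andP[rhi _] /andP[_ lor]; by exists lo, hi.
have [qr|rq] := boolP (ratr (rat_of_code N) < r).
  exists (Num.max lo (rat_of_code N)), hi; split=> //.
    by case: (leP lo (rat_of_code N)).
  move=> m; rewrite ltnS leq_eqVlt => /predU1P[->|/h].
    by rewrite qr le_max lexx orbT.
  by case: ifP => // _ h'; rewrite le_max h'.
exists lo, (Num.min hi (rat_of_code N)); split=> //.
  by case: (leP hi (rat_of_code N)) => // _; rewrite lt_neqAle r_irr leNgt.
move=> m; rewrite ltnS leq_eqVlt => /predU1P[->|/h].
  by rewrite (negbTE rq) ge_min lexx orbT.
by case: ifP => // _ h'; rewrite ge_min h'.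
Qed.

(** Every rational imposes on x the side on which it lies of r. A solution is finite, and a rational
    strictly between r and the image of its residue would contradict one of these constraints. *)
Lemma computable_real_residue (s : seq C) (r : R) :
  computable_fun_in (cut_join [seq rho c | c <- s]) (fun n => nat_of_bool (cut r n)) ->
  exists c, rho c = r.
Proof.
move=> cr; have [[q ->]|/forallNP r_irr] := pselect (exists q : rat, r = ratr q).
  by exists (ratr q); rewrite fmorph_rat.
pose f i := if cut r i then lower_clause i else upper_clause i.
have cf : computable_fun_in (cut_join [seq rho c | c <- s]) f.
  by apply: comp_if => //; rewrite /lower_clause /upper_clause /clause; comp_tac.
have [|x xP] := saturated cf.
  move=> N; have [|x xN] := @rational_approximation r N.
    by move=> q; apply/eqP => /r_irr.
  exists x => m /xN; rewrite /f cut_rat_of_code.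
  case: ifP => _ h; first by apply/lower_clauseP; rewrite ratr_rat h.
  by apply/upper_clauseP; rewrite ratr_rat ltNge h.
have lo q : ratr q < r -> ratr q <= x.
  have [i <-] := rat_of_code_surj q; have := xP i.
  by rewrite /f cut_rat_of_code => + qr; rewrite qr => /lower_clauseP.
have hi q : r < ratr q -> x < ratr q.
  have [i <-] := rat_of_code_surj q; have := xP i.
  by rewrite /f cut_rat_of_code => + qr; rewrite ltNge (ltW qr) => /upper_clauseP.
have x1 : vle x 1.
  pose n0 := Num.bound `|r|; exists n0; rewrite normr1 mulr1.
  have /ltr_normlP[h1 h2] : `|r| < n0%:R by exact: archi_boundP.
  have nE (F : numFieldType) : ratr n0%:R = n0%:R :> F by rewrite rmorph_nat.
  have hn : ratr (- n0%:R) <= x by apply: lo; rewrite rmorphN /= nE ltrNl.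
  have hp : x < ratr n0%:R by apply: hi; rewrite nE.
  rewrite rmorphN /= !nE in hn; rewrite nE in hp.
  by rewrite ler_norml hn ltW.
have [c xc] := residue x1; exists c; apply/eqP; rewrite eq_le; apply/andP; split.
- rewrite leNgt; apply/negP => /rat_in_itvoo[q]; rewrite in_itv /= => /andP[rq qc].
  have := ltW (hi q rq); rewrite -(fmorph_rat gamma) => /(residue_ge xc).
  by rewrite -(rcf_morph_le rho) fmorph_rat leNgt qc.
- rewrite leNgt; apply/negP => /rat_in_itvoo[q]; rewrite in_itv /= => /andP[cq qr].
  have := lo q qr; rewrite -(fmorph_rat gamma) => /(residue_le xc).
  by rewrite -(rcf_morph_le rho) fmorph_rat leNgt cq.
Qed.

End Residue.

(** * Binary strings, dyadic intervals and digits *)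

Definition bval (s : seq bool) : nat := foldl (fun L (b : bool) => (L + L + b)%N) 0 s.

Lemma foldl_bval L s : foldl (fun L (b : bool) => (L + L + b)%N) L s = (L * 2 ^ size s + bval s)%N.
Proof.
rewrite /bval; elim/last_ind: s => [|s b IHs]; first by rewrite /= muln1 addn0.
rewrite !foldl_rcons IHs size_rcons expnS; lia.
Qed.

Lemma bval_cat s t : bval (s ++ t) = (bval s * 2 ^ size t + bval t)%N.
Proof. by rewrite {1}/bval foldl_cat foldl_bval. Qed.

Lemma bval_rcons s b : bval (rcons s b) = (bval s + bval s + b)%N.
Proof. by rewrite /bval foldl_rcons. Qed.

Lemma bval_lt s : (bval s < 2 ^ size s)%N.
Proof.
elim/last_ind: s => [|s b IHs] //; rewrite bval_rcons size_rcons expnS.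
by case: b; lia.
Qed.

Lemma bval_inj s t : size s = size t -> bval s = bval t -> s = t.
Proof.
elim/last_ind: s t => [|s b IHs] t; first by case: t.
case/lastP: t => [|t b']; first by rewrite size_rcons.
rewrite !size_rcons !bval_rcons => -[st] h.
have bb : b = b' by case: b b' h => [] []; lia.
by rewrite bb (IHs t) //; move: h; rewrite bb; lia.
Qed.

(** With the first letter most significant, s stands for the dyadic interval from bval s / 2^|s| to
    (bval s + 1) / 2^|s|. The hypothesis puts the left endpoint of the interval of t there, which
    forces t to start with s. *)
Lemma bval_prefix s t : (size s <= size t)%N ->
  (bval s * 2 ^ (size t - size s) <= bval t < (bval s).+1 * 2 ^ (size t - size s))%N ->
  prefix s t.
Proof.
move=> st; have tE := cat_take_drop (size s) t.
have -> : bval t = (bval (take (size s) t) * 2 ^ (size t - size s) + bval (drop (size s) t))%N.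
  by rewrite -{1}tE bval_cat size_drop.
move=> h; have h1 := bval_lt (drop (size s) t); rewrite size_drop in h1.
suff sE : s = take (size s) t by apply/prefixP; exists (drop (size s) t); rewrite {1}sE tE.
apply: bval_inj; first by rewrite size_takel.
move: h h1; move: (2 ^ _)%N (bval s) (bval (take _ _)) (bval (drop _ _)) => p a b c h1 h2.
case: (ltngtP a b) => // ab.
  have : (a.+1 * p <= b * p)%N by rewrite leq_mul2r ab orbT.
  by lia.
have : (b.+1 * p <= a * p)%N by rewrite leq_mul2r ab orbT.
by lia.
Qed.

Lemma size_bcode s : (size s <= bcode s)%N.
Proof. by elim: s => //= b s IHs; lia. Qed.

Lemma bcode_inj : injective bcode.
Proof.
elim=> [|b s IHs] [|b' t] //=; try by lia.
move=> h; have bb : b = b' by case: b b' h => [] []; lia.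
by rewrite bb (IHs t) //; move: h; rewrite bb; lia.
Qed.

Lemma bcode_surj m : exists s, bcode s = m.
Proof.
have [n] := ubnP m; elim: n m => // n IHn [|m] mn; first by exists [::].
have [|s sE] := IHn m./2; first by lia.
by exists (odd m :: s); rewrite /= sE; lia.
Qed.

Lemma bcode_lt s : ((bcode s).+2 <= 2 ^ (size s).+1)%N.
Proof. by elim: s => // b s IHs; rewrite expnS /=; case: b => /=; lia. Qed.

(** The state is <code left, <value, length>>. In [bcode] the first letter is least significant, so
    it is the parity of the code minus 1; a string is no longer than its code, so [bdecode] iterates
    often enough. *)
Definition bstep (st : nat) : nat :=
  if nfst st == 0%N then st else
  npair (nfst st).-1./2 (npair (nfst (nsnd st) + nfst (nsnd st) + odd (nfst st).-1)
                               (nsnd (nsnd st)).+1).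

Definition bdecode (m : nat) : nat := nsnd (iter m bstep (npair m (npair 0 0))).

Lemma bdecodeE s : bdecode (bcode s) = npair (bval s) (size s).
Proof.
have h j t L k : iter (size t + j) bstep (npair (bcode t) (npair L k)) =
    npair 0 (npair (foldl (fun L (b : bool) => (L + L + b)%N) L t) (k + size t)).
  elim: t L k => [|b t IHt] L k /=.
    by rewrite addn0; elim: j => //= j ->; rewrite /bstep npairK1.
  rewrite -iterS iterSr {2}/bstep !(npairK1, npairK2) /=.
  have -> : ((bcode t).*2 + b.+1 == 0)%N = false by lia.
  have -> : ((bcode t).*2 + b.+1).-1 = (b + (bcode t).*2)%N by lia.
  by rewrite half_bit_double oddD odd_double addbF oddb IHt addSnnS.
rewrite /bdecode -(subnKC (size_bcode s)) {2}(subnKC (size_bcode s)) h npairK2 //.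
Qed.

Lemma comp_pow2 A f : computable_fun_in A f -> computable_fun_in A (fun x => 2 ^ (f x))%N.
Proof.
move=> cf; have c1 : computable_fun_in A (fun p => nsnd p + nsnd p)%N by comp_tac.
have [c h] := comp_iter (F := fun _ z => (z + z)%N) c1 (comp_const A 1) cf.
exists c => x; have := h x; suff -> : iter (f x) (fun z => z + z)%N 1%N = (2 ^ f x)%N by [].
by elim: (f x) => //= n ->; rewrite expnS mul2n addnn.
Qed.

Lemma comp_bdecode A f : computable_fun_in A f -> computable_fun_in A (fun x => bdecode (f x)).
Proof.
move=> cf; rewrite /bdecode; apply: comp_snd.
have c1 : computable_fun_in A (fun p => bstep (nsnd p)) by rewrite /bstep; comp_tac.
apply: (comp_iter (F := fun _ z => bstep z)) => //; comp_tac.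
Qed.

Lemma comp_eventually_false A (f : nat -> bool) n0 :
  (forall n, (n0 <= n)%N -> f n = false) ->
  computable_fun_in A (fun n => nat_of_bool (f n)).
Proof.
elim: n0 f => [|n0 IHn] f h.
  by have [c hc] := comp_const A 0; exists c => n; rewrite h.
have cS : computable_fun_in A (fun n => nat_of_bool (f n.+1)) by apply: (IHn (fun n => f n.+1)) => n nn; apply: h.
have c1 : computable_fun_in A predn by apply: (comp_pred (comp_id A)).
have [c hc] := comp_if0 (comp_id A) (comp_const A (f 0%N)) (comp_comp cS c1).
by exists c => -[|n]; [apply: (hc 0%N)|apply: (hc n.+1)].
Qed.

Section Digits.
Variables (K : realFieldType) (x : K).
Hypothesis x01 : 0 <= x < 1.

(** The integer part of 2^n x, built digit by digit because K comes without a floor function. *)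
Fixpoint dyadic_floor (n : nat) : nat :=
  if n is m.+1 then
    let L := dyadic_floor m in (L + L + ((L + L).+1%:R <= 2 ^+ n * x)%R)%N
  else 0%N.

Definition digit (n : nat) : bool :=
  ((dyadic_floor n + dyadic_floor n).+1%:R <= 2 ^+ n.+1 * x).

Lemma dyadic_floorP n : (dyadic_floor n)%:R <= 2 ^+ n * x < (dyadic_floor n).+1%:R.
Proof.
elim: n => [|n IHn]; first by rewrite expr0 mul1r.
rewrite [dyadic_floor n.+1]/= -/(digit n) exprS -mulrA.
have E : digit n = ((dyadic_floor n + dyadic_floor n).+1%:R <= 2 * (2 ^+ n * x)).
  by rewrite /digit exprS mulrA.
move: IHn E; move: (2 ^+ n * x) (dyadic_floor n) (digit n) => y L b /andP[h1 h2].
rewrite -[L.+1%:R]natr1 in h2.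
rewrite -[(L + L).+1%:R]natr1 -[(L + L + b).+1%:R]natr1 !natrD.
by case: (leP (L%:R + L%:R + 1) (2 * y)) => h3 -> /=; rewrite ?mulr1n ?mulr0n; apply/andP; split; lra.
Qed.

Lemma dyadic_floorE n : dyadic_floor n = bval (mkseq digit n).
Proof.
elim: n => // n IHn; rewrite mkseqS bval_rcons -IHn //.
Qed.

Lemma dyadic_floor_shift n k : (dyadic_floor n * 2 ^ k <= dyadic_floor (n + k))%N.
Proof.
clear x01; elim: k => [|k IHk]; first by rewrite muln1 addn0.
by rewrite addnS expnS /=; lia.
Qed.

End Digits.

Lemma infinite_tree_long (T : set (seq bool)) N : infinite_set T ->
  exists2 t, T t & (N <= size t)%N.
Proof.
move=> Tinf; apply: contrapT => /forall2NP h; apply: Tinf.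
apply: (@sub_finite_set _ _ (bcode @^-1` `I_(2 ^ N.+1))).
  move=> t Tt; have [//|/negP] := h t; rewrite -ltnNge => tN.
  rewrite /preimage /=; apply: leq_trans (leq_trans (leqnSn _) (bcode_lt t)) _.
  by rewrite leq_exp2l // ltnW.
by apply: finite_preimage; [move=> s t _ _; apply: bcode_inj|exact: finite_II].
Qed.

(** Number 0 says x < 1, number 1 says 0 <= x, and number m + 2 says that x avoids the dyadic
    interval of the node coded by m, or is trivial if [chi] accepts that node. *)
Definition tree_clause (chi : nat -> bool) (m : nat) : nat :=
  if m == 0%N then clause 1 0 1 1 0 0 else
  if m.-1 == 0%N then clause 0 0 0 0 0 1 else
  if chi m.-2 then clause 1 0 0 0 0 0 else
  clause (nfst (bdecode m.-2)) 0 (2 ^ nsnd (bdecode m.-2))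
    (nfst (bdecode m.-2)).+1 0 (2 ^ nsnd (bdecode m.-2)).

Lemma tree_clause_node (F : realFieldType) chi s (x : F) :
  linear_clause (tree_clause chi (bcode s).+2) x <->
  chi (bcode s) \/ ~ (bval s)%:R <= 2 ^+ size s * x < (bval s).+1%:R.
Proof.
rewrite /tree_clause /=; case: ifP => chis.
  by rewrite linear_clauseE mul0r addr0 ltr01; split; left.
rewrite bdecodeE npairK1 npairK2 linear_clauseE !addr0 natrX leNgt.
split=> [[h|h]|[//|h]]; [right; rewrite h|right=> /andP[]|].
- by [].
- by move=> _ /h.
- by case: (ltP _ (bval s)%:R) h => [|_] h; [left|right=> h'; apply: h; rewrite h'].
Qed.

Lemma comp_tree_clause A (chi : nat -> bool) :
  computable_fun_in A (fun n => nat_of_bool (chi n)) -> computable_fun_in A (tree_clause chi).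
Proof.
move=> cchi.
have c0 : computable_fun_in A (fun m => m.-2) by comp_tac.
have c1 : computable_fun_in A (fun m => nat_of_bool (chi m.-2)) := comp_comp cchi c0.
have c2 := comp_bdecode c0.
have c3 : computable_fun_in A (fun m => 2 ^ nsnd (bdecode m.-2))%N.
  exact: comp_pow2 (comp_snd c2).
have c4 := comp_fst c2.
have c5 : computable_fun_in A (fun m => clause (nfst (bdecode m.-2)) 0 (2 ^ nsnd (bdecode m.-2))
    (nfst (bdecode m.-2)).+1 0 (2 ^ nsnd (bdecode m.-2))).
  by rewrite /clause; comp_tac.
by rewrite /tree_clause; comp_tac.
Qed.

Section TreePath.
Variables (R : realType) (C K : rcfType).
Variables (rho : {rmorphism C -> R}) (gamma : {rmorphism C -> K}).
Hypothesis residue : forall x : K, vle x 1 -> exists c, ll (x - gamma c) 1.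
Hypothesis saturated : computably_saturated K rho.

(** The digit n is 1 iff x is at least a dyadic q, while the oracle tells whether q lies strictly
    below the residue c. They agree when digits 1 keep occurring: a later one separates x from q by
    more than an infinitesimal. Otherwise the digits are eventually 0 and computable outright. *)
Lemma digits_computable (x : K) : 0 <= x < 1 ->
  exists c, computable_fun_in (cut (rho c)) (fun n => nat_of_bool (digit x n)).
Proof.
move=> x01; have [[n0 h]|/forallNP late] :=
  pselect (exists n0, forall n, (n0 <= n)%N -> digit x n = false).
  by exists 0; apply: comp_eventually_false h.
have x1 : vle x 1.
  by case/andP: x01 => x0 /ltW xl; exists 1%N; rewrite normr1 mul1r ger0_norm.
have [c xc] := residue x1; exists c.
(* Code of the midpoint that decides digit n; the last component is the denominator minus 1, as
   [cut] adds 1. *)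
pose q n := npair (dyadic_floor x n + dyadic_floor x n).+1 (npair 0 (2 ^ n.+1 - 1)).
have qE (F : numFieldType) n : ratr (rat_of_code (q n)) =
    (dyadic_floor x n + dyadic_floor x n).+1%:R / 2 ^+ n.+1 :> F.
  rewrite ratr_rat_of_code /q !(npairK1, npairK2) subr0 subn1 prednK ?expn_gt0 //.
  by rewrite natrX.
have p2 n : 0 < 2 ^+ n :> K by rewrite exprn_gt0.
have digitE n : digit x n = cut (rho c) (q n).
  rewrite cut_rat_of_code -(fmorph_rat rho) rcf_morph_lt; apply/idP/idP; last first.
    apply: contraLR; rewrite /digit -ltNge mulrC -ltr_pdivlMr // -qE => /ltW.
    by rewrite -(fmorph_rat gamma) -leNgt => /(residue_ge rho xc).
  move=> dn; have [m nm dm] : exists2 m, (n < m)%N & digit x m.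
    apply: contrapT => /forall2NP h; apply: (late n.+1) => m nm.
    by case: (h m) => // /negP/negbTE.
  have := dyadic_floor_shift x n.+1 (m - n.+1); rewrite subnKC // => Dm.
  have Dn : dyadic_floor x n.+1 = (dyadic_floor x n + dyadic_floor x n).+1.
    by rewrite /= -/(digit x n) dn addn1.
  (* The margin contributed by the later digit 1 at m; being in C, it survives the passage to
     residues. *)
  pose e : C := 2 ^- m.+1.
  have e0 : 0 < e by rewrite invr_gt0 exprn_gt0.
  suff : ratr (rat_of_code (q n)) + e <= c by apply: lt_le_trans; rewrite ltrDl.
  apply: (residue_le rho xc); rewrite rmorphD fmorph_rat qE /e fmorphV rmorphXn /= rmorph_nat.
  have DmK : (dyadic_floor x n + dyadic_floor x n).+1%:R * 2 ^+ (m - n.+1) <= (dyadic_floor x m)%:R :> K.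
    by rewrite -Dn -natrX -natrM ler_nat.
  have E : 2 ^+ m.+1 = 2 ^+ n.+1 * (2 * 2 ^+ (m - n.+1)) :> K.
    by rewrite -exprS -exprD; congr (_ ^+ _); lia.
  move: dm DmK; rewrite /digit E -[(dyadic_floor x m + _).+1%:R]natr1 natrD.
  move: (p2 n.+1) (p2 (m - n.+1)%N); move: (2 ^+ n.+1) (2 ^+ (m - n.+1)) => u w u0 w0.
  move: ((dyadic_floor x n + dyadic_floor x n).+1%:R : K) ((dyadic_floor x m)%:R : K) => a b h1 h2.
  have uw : 0 < u * (2 * w) by rewrite !mulr_gt0.
  rewrite -(ler_pM2l uw); apply: le_trans h1.
  have -> : u * (2 * w) * (a / u + (u * (2 * w))^-1) = a * w + a * w + 1.
    by field; rewrite !gt_eqF.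
  by rewrite lerD2r lerD.
(* The midpoint for digit j depends on the digits before it, so the floors are computed by
   recursion, with one oracle query per stage. *)
pose H (z j : nat) := (z + z + nat_of_bool (cut (rho c) (npair (z + z).+1 (npair 0 (2 ^ j.+1 - 1)))))%N.
have cH : computable_fun_in (cut (rho c)) (fun p => H (nsnd (nsnd p)) (nfst (nsnd p))).
  by rewrite /H; comp_tac; apply: comp_pow2; comp_tac.
have [e he] := comp_rec (H := fun _ j z => H z j) (comp_const _ 0) cH (comp_id (cut (rho c))).
have DE n : nat_rect (fun=> nat) 0 (fun j z => H z j) n = dyadic_floor x n.
  by elim: n => //= n ->; rewrite /H -/(digit x n) digitE.
have cD : computable_fun_in (cut (rho c)) (dyadic_floor x).
  by exists e => n; have := he n; rewrite DE.
have cq : computable_fun_in (cut (rho c)) q.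
  by rewrite /q; comp_tac; apply: comp_pow2; comp_tac.
have [e' he'] := comp_oracle cq.
by exists e' => n; have := he' n; rewrite digitE.
Qed.

Lemma tree_path (T : set (seq bool)) (c0 : C) : is_tree T -> infinite_set T ->
  computable_set_in (cut (rho c0)) (bcode @` T) ->
  exists2 f : nat -> bool, is_path T f &
    exists c, computable_fun_in (cut (rho c)) (fun n => nat_of_bool (f n)).
Proof.
move=> T_tree T_inf cT; pose chi n := `[< (bcode @` T) n >].
have chiP s : chi (bcode s) -> T s by move=> /asboolP[t Tt /bcode_inj <-].
have cchi : computable_fun_in (cut_join [seq rho c | c <- [:: c0]]) (fun n => nat_of_bool (chi n)).
  apply: comp_subst cT; rewrite /= /turing_join.
  have [e he] := comp_oracle (comp_add (comp_id _) (comp_id (cut_join [:: rho c0]))).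
  exists e => n; have := he n; rewrite /= /turing_join addnn odd_double.
  by rewrite doubleK.
have [|x xP] := saturated (comp_tree_clause cchi).
  move=> N; have [t Tt tN] := infinite_tree_long N T_inf.
  (* For a long t in T, the left endpoint of its interval meets the intervals of short nodes only at
     prefixes of t, and these belong to the tree. *)
  exists ((bval t)%:R / 2 ^+ size t) => -[_|[_|m mN]].
  - rewrite linear_clauseE mul1r addr0; left.
    by rewrite ltr_pdivrMr ?exprn_gt0 // mul1r -natrX ltr_nat bval_lt.
  - rewrite linear_clauseE mul1r !addr0; right; apply/negP; rewrite -leNgt.
    by rewrite divr_ge0 // exprn_ge0.
  have [s sm] := bcode_surj m; rewrite -sm; apply/tree_clause_node.
  have [|nchi] := boolP (chi (bcode s)); [by left|right=> h].
  have st : (size s <= size t)%N.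
    by apply: leq_trans (size_bcode s) _; rewrite sm; apply: leq_trans tN; lia.
  case/negP: nchi; apply/asboolP; exists s => //; apply: T_tree Tt.
  apply: bval_prefix => //; move: h.
  have -> : 2 ^+ size s * ((bval t)%:R / 2 ^+ size t) =
      (bval t)%:R / 2 ^+ (size t - size s) :> rat.
    rewrite -{1}(subnK st) exprD; field.
    by rewrite !expf_neq0.
  rewrite ler_pdivlMr ?exprn_gt0 // ltr_pdivrMr ?exprn_gt0 //.
  by rewrite -natrX -!natrM ler_nat ltr_nat.
have x01 : 0 <= x < 1.
  have := xP 0%N; rewrite linear_clauseE mul1r mul0r !addr0 ltr01 => -[->|//].
  have := xP 1%N; rewrite linear_clauseE mul1r mul0r !addr0 ltxx => -[//|/negP].
  by rewrite -leNgt => ->.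
exists (digit x); last exact: digits_computable.
(* x lies in the interval of the string of its first n digits, so that string cannot be an excluded
   node. *)
move=> n; apply: chiP.
have /tree_clause_node[//|[]] := xP (bcode (mkseq (digit x) n)).+2.
by rewrite size_mkseq -dyadic_floorE // dyadic_floorP.
Qed.

Theorem scott_set_range : scott_set (range rho).
Proof.
split; first by exists (rho 0), 0.
- move=> s r _ sC cr.
  have [s' sE] : exists s', [seq rho c | c <- s'] = s.
    elim: s sC {cr} => [|a s IHs] sC; first by exists [::].
    have [c _ ca] := sC a (mem_head _ _).
    have [s' sE] := IHs (fun b bs => sC b (mem_behead (s := a :: s) bs)).
    by exists (c :: s'); rewrite /= ca sE.
  rewrite -sE in cr; have [c <-] := computable_real_residue residue saturated cr.
  by exists c.
- move=> T r [c0 _ <-] T_tree T_inf cT.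
  have [f fT [c cf]] := tree_path T_tree T_inf cT.
  by exists f => //; exists (rho c) => //; exists c.
Qed.

End TreePath.

(** * Integer parts that are models of PA *)

Lemma chinese_remainder_seq n (m z : nat -> nat) :
  (forall i j, (i < j < n)%N -> coprime (m i) (m j)) ->
  exists c, forall i, (i < n)%N -> c = z i %[mod m i].
Proof.
elim: n => [|n IHn] mm; first by exists 0%N.
have [|c cP] := IHn; first by move=> i j /andP[ij jn]; apply: mm; rewrite ij ltnW.
have co : coprime (\prod_(i < n) m i) (m n).
  apply: (big_ind (fun x => coprime x (m n))); first exact: coprime1n.
    by move=> x y cx cy; rewrite coprimeMl cx.
  by move=> i _; apply: mm; rewrite ltn_ord /=.
exists (chinese (\prod_(i < n) m i) (m n) c (z n)) => i.
rewrite ltnS leq_eqVlt => /predU1P[->|ni]; first exact: chinese_modr.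
rewrite -cP //.
have dv : (m i %| \prod_(i < n) m i)%N by rewrite (bigD1 (Ordinal ni)) //= dvdn_mulr.
by rewrite -(modn_dvdm _ dv) chinese_modl // modn_dvdm.
Qed.

(** A common divisor of two moduli is prime to d, since each modulus is 1 modulo d, and divides (j -
    i) d; so it divides j - i, which divides d = b!, and is 1. The Chinese remainder theorem then
    gives c. *)
Lemma godel_beta k (z : nat -> nat) :
  exists c d, forall i, (i <= k)%N -> (c %% (i.+1 * d).+1)%N = z i.
Proof.
(* b exceeds all differences of indices and all values, so that the remainders are the values
   themselves. *)
pose b := (k + \sum_(i < k.+1) z i).+1; pose d := b`!.
have small i : (i <= k)%N -> (z i < (i.+1 * d).+1)%N.
  move=> ik; rewrite ltnS; apply: (@leq_trans b).
    rewrite /b leqW // (leq_trans _ (leq_addl _ _)) //.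
    by rewrite (bigD1 (Ordinal (ik : (i < k.+1)%N))) //= leq_addr.
  by apply: leq_trans (fact_geq b) _; rewrite leq_pmull.
have [|c cP] := @chinese_remainder_seq k.+1 (fun i => (i.+1 * d).+1) z.
  move=> i j /andP[ij jk]; rewrite /coprime; apply/eqP.
  set g := gcdn _ _.
  have gi : (g %| (i.+1 * d).+1)%N := dvdn_gcdl _ _.
  have gj : (g %| (j.+1 * d).+1)%N := dvdn_gcdr _ _.
  have gd : coprime g d.
    apply/eqP; set h := gcdn g d.
    have hd : (h %| i.+1 * d)%N by apply: dvdn_mull; apply: dvdn_gcdr.
    have hg : (h %| (i.+1 * d).+1)%N := dvdn_trans (dvdn_gcdl _ _) gi.
    by apply/eqP; rewrite -dvdn1 -(dvdn_addr _ hd) addn1.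
  have gji : (g %| (j - i) * d)%N.
    have := dvdn_sub gj gi; rewrite subSS -mulnBl subSS.
    by [].
  rewrite Gauss_dvdl // in gji.
  have jid : (j - i %| d)%N by apply: dvdn_fact; rewrite subn_gt0 ij /= /b; lia.
  have gdd : (g %| d)%N := dvdn_trans gji jid.
  by move/eqP: gd; rewrite (gcdn_idPl gdd).
by exists c, d => i ik; rewrite cP // modn_small // small.
Qed.

(** * Formulas for the graphs of programs *)

Fixpoint ren_term (r : nat -> nat) (t : oterm) : oterm :=
  match t with
  | TVar i => TVar (r i)
  | TZero => TZero
  | TOne => TOne
  | TAdd t1 t2 => TAdd (ren_term r t1) (ren_term r t2)
  | TMul t1 t2 => TMul (ren_term r t1) (ren_term r t2)
  end.

Definition ren_up (r : nat -> nat) (i : nat) : nat := if i is j.+1 then (r j).+1 else 0.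

Fixpoint ren_form (r : nat -> nat) (f : oform) : oform :=
  match f with
  | FEq t1 t2 => FEq (ren_term r t1) (ren_term r t2)
  | FLt t1 t2 => FLt (ren_term r t1) (ren_term r t2)
  | FNot f1 => FNot (ren_form r f1)
  | FAnd f1 f2 => FAnd (ren_form r f1) (ren_form r f2)
  | FOr f1 f2 => FOr (ren_form r f1) (ren_form r f2)
  | FImp f1 f2 => FImp (ren_form r f1) (ren_form r f2)
  | FAll f1 => FAll (ren_form (ren_up r) f1)
  | FEx f1 => FEx (ren_form (ren_up r) f1)
  end.

Lemma tval_ren (M : ostruct) (e : nat -> M) r t :
  Defs.tval e (ren_term r t) = Defs.tval (fun i => e (r i)) t.
Proof. by elim: t => //= t1 -> t2 ->. Qed.

Lemma sat_ren (M : ostruct) (e : nat -> M) r f :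
  sat e (ren_form r f) = sat (fun i => e (r i)) f.
Proof.
have up (x : M) e' r' : (fun i => scons x e' (ren_up r' i)) = scons x (fun i => e' (r' i)).
  by apply/funext => -[].
elim: f e r => //= [t1 t2|t1 t2|f IHf|f IHf g IHg|f IHf g IHg|f IHf g IHg|f IHf|f IHf] e r;
  rewrite ?tval_ren ?IHf ?IHg //.
- by apply/propext; split=> h x; have := h x; rewrite IHf up.
- by apply/propext; split=> -[x]; rewrite ?IHf ?up => h; exists x; rewrite ?IHf ?up.
Qed.

(* f, a formula in the variables 0 and 1 with parameters from 2 on, applied to the
   variables a and b, where the parameters are now numbered from k on. *)
Definition app2 (f : oform) (a b k : nat) : oform :=
  ren_form (fun i => match i with 0 => a | 1 => b | j.+2 => k + j end)%N f.

Lemma sat_app2 (M : ostruct) (e : nat -> M) f a b k :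
  sat e (app2 f a b k) <-> sat (scons (e a) (scons (e b) (fun i => e (k + i)%N))) f.
Proof.
rewrite /app2 sat_ren; suff -> : (fun i => e match i with 0 => a | 1 => b | j.+2 => k + j end)%N =
  scons (e a) (scons (e b) (fun i => e (k + i)%N)) by [].
by apply/funext => -[|[|i]].
Qed.

(** Cantor's pairing in doubled form, since arithmetic terms have no halving. *)
Definition pair_form (w x y : oterm) : oform :=
  FEq (TAdd w w) (TAdd (TAdd y y) (TMul (TAdd y x) (TAdd (TAdd y x) TOne))).

Definition rename_to (l : seq nat) (f : oform) : oform := ren_form (fun i => nth 0%N l i) f.

Lemma sat_rename_to (M : ostruct) (e : nat -> M) l f :
  sat e (rename_to l f) <-> sat (fun i => e (nth 0%N l i)) f.
Proof. by rewrite /rename_to sat_ren. Qed.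

(* Goedel's beta function: the variable 3 is the remainder of the variable 0 modulo
   1 + (i + 1) d, where d is the variable 1 and i the value of t. *)
Definition beta_form (t : oterm) : oform :=
  let m u d := TAdd TOne (TMul (TAdd u TOne) (TVar d)) in
  FAnd (FLt (TVar 3) (m t 1%N))
    (FEx (FEq (TVar 1) (TAdd (TMul (TVar 0) (m (ren_term S t) 2)) (TVar 4)))).

(* The graph of c, from the variable 0 to the variable 1, where orc defines the
   graph of the oracle; the parameters are the variables from 2 on. *)
Fixpoint graph_form (orc : oform) (c : rcode) : oform :=
  match c with
  | RZero => FEq (TVar 1) TZero
  | RSucc => FEq (TVar 1) (TAdd (TVar 0) TOne)
  | RFst => FEx (pair_form (TVar 1) (TVar 2) (TVar 0))
  | RSnd => FEx (pair_form (TVar 1) (TVar 0) (TVar 2))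
  | ROracle => orc
  | RPair c1 c2 => FEx (FEx (FAnd (app2 (graph_form orc c1) 2 1 4)
      (FAnd (app2 (graph_form orc c2) 2 0 4) (pair_form (TVar 3) (TVar 1) (TVar 0)))))
  | RComp c1 c2 =>
      FEx (FAnd (app2 (graph_form orc c2) 1 0 3) (app2 (graph_form orc c1) 0 2 3))
  | RPrec c1 c2 =>
      (* Variables 3, 2, 1, 0 are the argument a, the recursion length k and the two numbers of the
         beta code; 4 and 5 are input and output. *)
      FEx (FEx (FEx (FEx (FAnd (pair_form (TVar 4) (TVar 3) (TVar 2)) (FAnd
        (FEx (FAnd (rename_to [:: 2; 1; 0; 0]%N (beta_form TZero))
                   (app2 (graph_form orc c1) 4 0 7)))
        (FAnd
        (FAll (FImp (FLt (TVar 0) (TVar 3)) (FEx (FEx (FEx (FEx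
           (FAnd (rename_to [:: 6; 5; 4; 3]%N (beta_form (TVar 2)))
           (FAnd (rename_to [:: 6; 5; 4; 2]%N (beta_form (TAdd (TVar 2) TOne)))
           (FAnd (pair_form (TVar 1) (TVar 4) (TVar 3))
           (FAnd (pair_form (TVar 0) (TVar 8) (TVar 1))
                 (app2 (graph_form orc c2) 0 2 11)))))))))))
        (rename_to [:: 1; 0; 2; 5]%N (beta_form (TVar 2)))))))))
  | RMu c1 =>
      FAnd (FEx (FEx (FAnd (pair_form (TVar 1) (TVar 2) (TVar 3))
              (FAnd (FEq (TVar 0) TZero) (app2 (graph_form orc c1) 1 0 4)))))
        (FAll (FImp (FLt (TVar 0) (TVar 2)) (FEx (FEx
           (FAnd (pair_form (TVar 1) (TVar 3) (TVar 2))
              (FAnd (FNot (FEq (TVar 0) TZero)) (app2 (graph_form orc c1) 1 0 5)))))))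
  end.

Lemma npair_double m n : (npair m n + npair m n = n + n + (n + m) * (n + m + 1))%N.
Proof.
have := Cantor.to_nat_spec m n; rewrite -/(npair m n); set w := npair m n.
rewrite -!plusE -!multE; lia.
Qed.

(** * Standard and non-standard elements of the cone *)

Section ConeSemantics.
Variables (K : realFieldType) (Z : subringClosed K).
Hypothesis Z_discrete : forall z, z \in Z -> 0 < z -> 1 <= z.
Local Notation M := (cone_ostruct Z).

Definition cval (m : M) : K := val (m : cone Z).

Lemma cval_inj (m n : M) : cval m = cval n -> m = n.
Proof. exact: val_inj. Qed.

Lemma cval_ge0 (m : M) : 0 <= cval m.
Proof. by have /andP[] := valP (m : cone Z). Qed.

Lemma cval_in (m : M) : cval m \in Z.
Proof. by have /andP[] := valP (m : cone Z). Qed.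

Lemma cone_mk (x : K) : x \in Z -> 0 <= x -> exists m : M, cval m = x.
Proof. by move=> xZ x0; exists (exist _ x (introT andP (conj xZ x0))). Qed.

Fixpoint std (n : nat) : M := if n is m.+1 then oadd (std m) (oone M) else ozero M.

Lemma cval_std n : cval (std n) = n%:R.
Proof. by elim: n => // n IHn; rewrite -natr1 -IHn. Qed.

Lemma std_inj m n : std m = std n -> m = n.
Proof.
move=> /(congr1 cval); rewrite !cval_std => /eqP.
by rewrite eqr_nat => /eqP.
Qed.

(** By discreteness an element above n is at least n + 1, so the standard elements form an initial
    segment. *)
Lemma std_le (m : M) n : cval m <= n%:R -> exists2 k, (k <= n)%N & m = std k.
Proof.
elim: n => [|n IHn] mn.
  by exists 0%N => //; apply: cval_inj; apply/eqP; rewrite cval_std eq_le mn cval_ge0.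
have [/IHn[k kn ->]|nm] := leP (cval m) n%:R; first by exists k => //; rewrite leqW.
exists n.+1 => //; apply: cval_inj; rewrite cval_std; apply/eqP.
rewrite eq_le mn /= -natr1; have := Z_discrete (_ : cval m - n%:R \in Z).
by rewrite subr_gt0 lerBrDl => -> //; rewrite rpredB ?rpred_nat ?cval_in.
Qed.

Fixpoint kval (e : nat -> M) (t : oterm) : K :=
  match t with
  | TVar i => cval (e i)
  | TZero => 0
  | TOne => 1
  | TAdd t1 t2 => kval e t1 + kval e t2
  | TMul t1 t2 => kval e t1 * kval e t2
  end.

Lemma cval_tval e t : cval (Defs.tval e t) = kval e t.
Proof. by elim: t => //= t1 <- t2 <-. Qed.

Lemma sat_FEq e t1 t2 : sat e (FEq t1 t2) <-> kval e t1 = kval e t2.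
Proof. by rewrite -!cval_tval; split=> [/= ->|/cval_inj]. Qed.

Lemma sat_FLt e t1 t2 : sat e (FLt t1 t2) <-> kval e t1 < kval e t2.
Proof. by rewrite -!cval_tval. Qed.

Lemma kval_ren e r t : kval e (ren_term r t) = kval (fun i => e (r i)) t.
Proof. by elim: t => //= t1 -> t2 ->. Qed.

Definition cpair (w x y : M) : Prop :=
  cval w + cval w = cval y + cval y + (cval y + cval x) * (cval y + cval x + 1).

Lemma sat_pair_form e i j k :
  sat e (pair_form (TVar i) (TVar j) (TVar k)) <-> cpair (e i) (e j) (e k).
Proof. exact: sat_FEq. Qed.

Lemma cpair_std m n : cpair (std (npair m n)) (std m) (std n).
Proof.
by rewrite /cpair !cval_std -!natrD natr1 -addn1 -natrM -natrD npair_double.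
Qed.

Lemma cpair_uniq w m n : cpair w (std m) (std n) -> w = std (npair m n).
Proof.
move=> h; apply: cval_inj; have := cpair_std m n; move: h; rewrite /cpair => <-.
by rewrite -!mulr2n => /eqP; rewrite eqrMn2r //= => /eqP ->.
Qed.

(** Both components are at most 2w and hence standard, where Cantor's pairing can be inverted. *)
Lemma cpair_unpair w u v : cpair (std w) u v -> u = std (nfst w) /\ v = std (nsnd w).
Proof.
move=> h; have u0 := cval_ge0 u; have v0 := cval_ge0 v.
have [hu hv] : cval u <= (w + w)%:R /\ cval v <= (w + w)%:R.
  move: h; rewrite /cpair cval_std natrD => ->.
  have : 0 <= (cval v + cval u) * (cval v + cval u) by rewrite mulr_ge0 // addr_ge0.
  have -> : (cval v + cval u) * (cval v + cval u + 1) =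
    (cval v + cval u) * (cval v + cval u) + (cval v + cval u) by ring.
  by move: (_ * _) => p p0; split; lra.
have [a _ ua] := std_le hu; have [b _ vb] := std_le hv.
move: h; rewrite ua vb => /cpair_uniq/std_inj ->.
by rewrite npairK1 npairK2.
Qed.

Lemma cpairE w m n : cpair (std w) m n <-> m = std (nfst w) /\ n = std (nsnd w).
Proof.
split=> [/cpair_unpair//|[-> ->]].
by rewrite -{1}(npairK w); apply: cpair_std.
Qed.

Definition cbeta (c d : M) (i : K) (v : M) : Prop :=
  cval v < 1 + (i + 1) * cval d /\
  exists q : M, cval c = cval q * (1 + (i + 1) * cval d) + cval v.

Lemma sat_beta_form e t :
  sat e (beta_form t) <-> cbeta (e 0%N) (e 1%N) (kval e t) (e 3).
Proof.
rewrite /beta_form -[sat _ _]/(sat e (FLt _ _) /\ exists q, sat (scons q e) (FEq _ _)).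
rewrite sat_FLt; split=> -[h1 [q h2]]; split=> //; exists q.
  by move/sat_FEq: h2; rewrite /= kval_ren.
by apply/sat_FEq; rewrite /= kval_ren.
Qed.

(** Uniqueness of remainders, also for non-standard c and d: different quotients differ by at least
    1, so the remainders would differ by at least the modulus. *)
Lemma cbeta_uniq c d i u v : i \in Z -> 0 <= i -> cbeta c d i u -> cbeta c d i v -> u = v.
Proof.
move=> iZ i0 [ub [q cq]] [vb [r cr]].
set m := 1 + (i + 1) * cval d in ub cq vb cr.
suff main (u' v' q' r' : M) : cval u' < m -> cval v' < m ->
    cval q' * m + cval u' = cval r' * m + cval v' -> cval q' <= cval r'.
  apply: cval_inj; have qr : cval q = cval r.
    by apply/le_anti/andP; split; [apply: (main u v)|apply: (main v u)] => //; rewrite -cq.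
  by move: cq; rewrite cr qr => /addrI/esym.
move=> u1 v1 h; rewrite leNgt; apply/negP => qr.
have := Z_discrete (_ : cval q' - cval r' \in Z).
rewrite rpredB ?cval_in // subr_gt0 => /(_ isT qr) qr1.
have m0 : 0 < m by apply: le_lt_trans (cval_ge0 u') u1.
have : m <= (cval q' - cval r') * m by apply: ler_peMl => //; apply: ltW.
have := cval_ge0 u'.
by rewrite mulrBl; move: h; move: (_ * m) (_ * m) => a b; lra.
Qed.

Lemma cbeta_std c d i : cbeta (std c) (std d) i%:R (std (c %% (i.+1 * d).+1)).
Proof.
have E : 1 + (i%:R + 1) * d%:R = ((i.+1 * d).+1)%:R :> K.
  by rewrite natr1 -natrM addrC natr1.
split; rewrite !cval_std E; first by rewrite ltr_nat ltn_pmod.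
exists (std (c %/ (i.+1 * d).+1)); rewrite cval_std -natrM -natrD.
by rewrite -divn_eq.
Qed.

End ConeSemantics.

Lemma prec_graph_seq (P Q : nat -> nat -> Prop) a k y : prec_graph P Q a k y ->
  exists z : nat -> nat, [/\ P a (z 0%N), z k = y
    & forall j, (j < k)%N -> Q (npair a (npair j (z j))) (z j.+1)].
Proof.
elim: k y => [|k IHk] y /=; first by move=> Pa; exists (fun=> y).
move=> [u [/IHk[z [Pz zk zQ]] Qu]]; exists (fun i => if (i <= k)%N then z i else y).
split=> //=; first by rewrite ltnn.
move=> j; rewrite ltnS => jk; rewrite jk; case: ltnP => kj; first exact: zQ.
have -> : j = k by apply/eqP; rewrite eqn_leq jk.
by rewrite zk.
Qed.

Lemma sat_FEx (M : ostruct) (e : nat -> M) f :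
  sat e (FEx f) <-> exists x, sat (scons x e) f.
Proof. by []. Qed.

Lemma sat_FAll (M : ostruct) (e : nat -> M) f :
  sat e (FAll f) <-> forall x, sat (scons x e) f.
Proof. by []. Qed.

Lemma sat_FAnd (M : ostruct) (e : nat -> M) f g :
  sat e (FAnd f g) <-> sat e f /\ sat e g.
Proof. by []. Qed.

Lemma sat_FImp (M : ostruct) (e : nat -> M) f g :
  sat e (FImp f g) <-> (sat e f -> sat e g).
Proof. by []. Qed.

Section GraphForm.
Variables (K : realFieldType) (Z : subringClosed K).
Hypothesis Z_discrete : forall z, z \in Z -> 0 < z -> 1 <= z.
Local Notation M := (cone_ostruct Z).
Local Notation std := (std Z).
Variables (A : pred nat) (orc : oform) (p : nat -> M).
Hypothesis orcP : forall n (y : M),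
  sat (scons (std n) (scons y p)) orc <-> y = std (A n).

Let cpairE := cpairE Z_discrete.

(* Only inputs on which c halts are considered: this makes the graph formula
   functional there, even among the non-standard elements of M. *)
Theorem graph_formP c x y : Defs.rgraph A c x y -> forall y' : M,
  sat (scons (std x) (scons y' p)) (graph_form orc c) <-> y' = std y.
Proof.
elim: c x y => [x y xy|x y xy|x y xy|x y xy|x y xy|c1 IH1 c2 IH2 x y xy
  |c1 IH1 c2 IH2 x y xy|c1 IH1 c2 IH2 x y xy|c1 IH1 x y xy] y'.
- by rewrite (xy : y = 0%N).
- by rewrite (xy : y = x.+1).
- rewrite (xy : y = nfst x); split=> [[b]|->].
    by move=> /sat_pair_form /= /cpairE[].
  by exists (std (nsnd x)); apply/sat_pair_form/cpairE.
- rewrite (xy : y = nsnd x); split=> [[b]|->].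
    by move=> /sat_pair_form /= /cpairE[].
  by exists (std (nfst x)); apply/sat_pair_form/cpairE.
- by rewrite (xy : y = A x); apply: orcP.
- move: xy => [y1 [y2 [/IH1 h1 /IH2 h2 ->]]]; split.
    move=> [u [v [/sat_app2/h1 hu [/sat_app2/h2 hv /sat_pair_form]]]].
    by move: hu hv => /= -> ->; apply: cpair_uniq.
  move=> ->; exists (std y1), (std y2); split; first exact/sat_app2/h1.
  split; first exact/sat_app2/h2.
  exact/sat_pair_form/cpair_std.
- move: xy => [z /IH2 h2 /IH1 h1]; split.
    by move=> [u [/sat_app2/h2 /= -> /sat_app2/h1]].
  by move=> ->; exists (std z); split; apply/sat_app2; [apply/h2|apply/h1].
- move: xy => /prec_graph_seq[z [/IH1 z0 <- zS]]; set a := nfst x in z0 zS *; set k := nsnd x in zS *.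
  split.
    move=> /sat_FEx[a' /sat_FEx[k' /sat_FEx[c' /sat_FEx[d' /sat_FAnd[/sat_pair_form hx
      /sat_FAnd[/sat_FEx[v0 /sat_FAnd[/sat_rename_to/sat_beta_form hb0 /sat_app2 h0]]
      /sat_FAnd[/sat_FAll hj /sat_rename_to/sat_beta_form hy]]]]]]].
    have [aE kE] : a' = std a /\ k' = std k by apply/cpairE.
    rewrite aE kE in h0 hj hy => {hx aE kE}.
    have v0E : v0 = std (z 0%N) by apply/z0.
    rewrite /= in hb0 hy.
    (* The code c', d' may be non-standard, but its entries up to the standard k are determined one
       after the other by [cbeta_uniq]. *)
    have key j : (j <= k)%N -> forall v, cbeta c' d' j%:R v -> v = std (z j).
      elim: j => [|j IHj] jk v hv.
        by rewrite (cbeta_uniq Z_discrete _ _ hv hb0) ?rpred0.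
      have jlt : cval (std j) < cval (std k) by rewrite !cval_std ltr_nat.
      have /sat_FImp hjj := hj (std j).
      have /sat_FEx[u /sat_FEx[v' /sat_FEx[w' /sat_FEx[w /sat_FAnd[/sat_rename_to/sat_beta_form hu
        /sat_FAnd[/sat_rename_to/sat_beta_form hv'
        /sat_FAnd[/sat_pair_form hw' /sat_FAnd[/sat_pair_form hw /sat_app2 hP]]]]]]]] :=
        hjj (iffRL (sat_FLt (scons (std j) (scons d' (scons c' (scons (std k) (scons (std a)
          (scons (std x) (scons y' p))))))) (TVar 0) (TVar 3)) jlt).
      rewrite /= in hw hw'; rewrite /= cval_std in hu hv'.
      have uE := IHj (ltnW jk) _ hu; rewrite uE in hw'.
      rewrite (cpair_uniq hw') in hw; have wE := cpair_uniq hw.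
      have /(IH2 _ _ (zS j jk)) v'E : sat (scons (std (npair a (npair j (z j)))) (scons v' p))
        (graph_form orc c2) by rewrite -wE.
      by rewrite -natr1 in hv; rewrite (cbeta_uniq Z_discrete _ _ hv hv') ?rpredD ?rpred1 ?rpred_nat ?addr_ge0.
    by rewrite cval_std in hy; apply: key hy.
  move=> ->; have [c' [d' cd]] := godel_beta k z.
  have hb j : (j <= k)%N -> cbeta (std c') (std d') j%:R (std (z j)).
    by move=> /cd <-; apply: cbeta_std.
  apply/sat_FEx; exists (std a); apply/sat_FEx; exists (std k).
  apply/sat_FEx; exists (std c'); apply/sat_FEx; exists (std d').
  apply/sat_FAnd; split; first exact/sat_pair_form/cpairE.
  apply/sat_FAnd; split.
    apply/sat_FEx; exists (std (z 0%N)); apply/sat_FAnd; split.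
      exact/sat_rename_to/sat_beta_form/hb.
    exact/sat_app2/z0.
  apply/sat_FAnd; split; last first.
    by apply/sat_rename_to/sat_beta_form; rewrite /= cval_std; apply: hb.
  apply/sat_FAll => j; apply/sat_FImp => /sat_FLt jk; rewrite /= cval_std in jk.
  have [j' _ jE] := std_le Z_discrete (ltW jk); rewrite jE cval_std ltr_nat in jk.
  rewrite {j}jE; apply/sat_FEx; exists (std (z j')); apply/sat_FEx; exists (std (z j'.+1)).
  apply/sat_FEx; exists (std (npair j' (z j'))).
  apply/sat_FEx; exists (std (npair a (npair j' (z j')))).
  apply/sat_FAnd; split.
    by apply/sat_rename_to/sat_beta_form; rewrite /= cval_std; apply: hb; apply: ltnW.
  apply/sat_FAnd; split.
    by apply/sat_rename_to/sat_beta_form; rewrite /= cval_std natr1; apply: hb.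
  apply/sat_FAnd; split; first exact/sat_pair_form/cpair_std.
  apply/sat_FAnd; split; first exact/sat_pair_form/cpair_std.
  exact/sat_app2/(IH2 _ _ (zS j' jk)).
- move: xy => [/IH1 h0 h]; split.
    move=> [[w [o [/sat_pair_form hw [/sat_FEq ho /sat_app2 hP]]]] hall].
    rewrite /= in hw ho.
    have o0 : o = std 0 by apply: cval_inj; rewrite cval_std.
    (* Up to y, a candidate is standard, and below y the program has a positive output there. A
       larger, possibly non-standard, candidate is refuted by the universal part of the formula at
       y, where the output is 0. *)
    have [y'y|yy'] := leP (cval y') y%:R.
      have [k ky y'E] := std_le Z_discrete y'y; rewrite y'E; congr std.
      rewrite y'E in hw; have wE := cpair_uniq hw.
      move: ky; rewrite leq_eqVlt => /predU1P[//|/h[z /IH1/(_ (std 0)) hz]].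
      have : sat (scons (std (npair x k)) (scons (std 0) p)) (graph_form orc c1).
        by rewrite -wE -o0.
      by move=> /hz/std_inj.
    have [|w' [z' [/sat_pair_form hw' [hz' /sat_app2 hP']]]] := hall (std y).
      by apply/sat_FLt; rewrite /= cval_std.
    rewrite /= in hw'.
    have : sat (scons (std (npair x y)) (scons z' p)) (graph_form orc c1).
      by rewrite -(cpair_uniq hw').
    by move=> /h0 z'E; case: hz'; apply/sat_FEq; rewrite /= z'E cval_std.
  move=> ->; split.
    exists (std (npair x y)), (std 0); split; first exact/sat_pair_form/cpair_std.
    by split; [apply/sat_FEq; rewrite /= (cval_std Z 0)|apply/sat_app2/h0].
  move=> k /sat_FLt /=; rewrite cval_std => ky.
  have [k' _ kE] := std_le Z_discrete (ltW ky); rewrite kE cval_std ltr_nat in ky.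
  have [z /IH1 hz] := h k' ky; exists (std (npair x k')), (std z.+1).
  rewrite kE; split; first exact/sat_pair_form/cpair_std.
  split; last exact/sat_app2/hz.
  move=> z0; have : cval (std z.+1) = 0 by rewrite [std z.+1]z0.
  by rewrite cval_std => /eqP; rewrite pnatr_eq0.
Qed.
End GraphForm.

(** * Cuts, clauses and overspill in the cone *)

Definition cut_condition (a b e n z z' : oterm) : oform :=
  FLt (TAdd (TMul a n) (TMul z' (TAdd e TOne))) (TAdd (TMul b n) (TMul z (TAdd e TOne))).

Definition cut_graph_form : oform :=
  FEx (FEx (FEx (FEx (FAnd (pair_form (TVar 4) (TVar 3) (TVar 2))
    (FAnd (pair_form (TVar 2) (TVar 1) (TVar 0))
    (FOr (FAnd (cut_condition (TVar 3) (TVar 1) (TVar 0) (TVar 7) (TVar 8) (TVar 9))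
               (FEq (TVar 6) TOne))
         (FAnd (FNot (cut_condition (TVar 3) (TVar 1) (TVar 0) (TVar 7) (TVar 8) (TVar 9)))
               (FEq (TVar 6) TZero)))))))).

(* The graph of cut_join s for a list s of length n; the parameters come in triples
   N, z, z' such that (z - z') / N has the same standard cut as the real. *)
Fixpoint join_graph_form (n : nat) : oform :=
  if n is m.+1 then
    FEx (FOr (FAnd (FEq (TVar 1) (TAdd (TVar 0) (TVar 0))) cut_graph_form)
             (FAnd (FEq (TVar 1) (TAdd (TAdd (TVar 0) (TVar 0)) TOne))
                   (app2 (join_graph_form m) 0 2 6)))
  else FEq (TVar 1) TZero.

Definition scaled_clause (a b c u u' w : oterm) : oform :=
  FLt (TAdd (TMul c u) (TMul b w)) (TAdd (TMul a w) (TMul c u')).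

(* The clause of m, whose i-th coefficient is defined by g i, holds at (u - u') / w;
   here m, w, u', u are the variables 0, 1, 2, 3. *)
Definition clause_at_form (g : nat -> oform) : oform :=
  FAll (FAll (FAll (FAll (FAll (FAll
      (FImp (app2 (g 0%N) 6 5 11) (FImp (app2 (g 1%N) 6 4 11) (FImp (app2 (g 2%N) 6 3 11)
      (FImp (app2 (g 3) 6 2 11) (FImp (app2 (g 4) 6 1 11) (FImp (app2 (g 5) 6 0 11)
      (FOr (scaled_clause (TVar 5) (TVar 4) (TVar 3) (TVar 9) (TVar 8) (TVar 7))
      (FNot (scaled_clause (TVar 2) (TVar 1) (TVar 0) (TVar 9) (TVar 8) (TVar 7))))))))))))))).

Definition overspill_form (g : nat -> oform) : oform :=
  FEx (FEx (FEx (FAnd (FLt TZero (TVar 0))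
    (FAll (FImp (FLt (TVar 0) (TVar 4)) (clause_at_form g)))))).

Lemma sat_FOr (M : ostruct) (e : nat -> M) f g :
  sat e (FOr f g) <-> sat e f \/ sat e g.
Proof. by []. Qed.

Lemma sat_FNot (M : ostruct) (e : nat -> M) f : sat e (FNot f) <-> ~ sat e f.
Proof. by []. Qed.

(** Justifies [cut_condition]: denominators are cleared and negative terms moved across, since the
    cone has neither division nor negatives. *)
Lemma scaled_cut (F : realFieldType) (a b E N z z' : F) : 0 < N -> 0 < E ->
  (a * N + z' * E < b * N + z * E) = ((a - b) / E < (z - z') / N).
Proof.
move=> N0 E0; rewrite ltr_pdivrMr // mulrAC ltr_pdivlMr //.
rewrite -subr_gt0 -[RHS]subr_gt0; congr (0 < _); ring.
Qed.

Lemma scaled_linear (F : realFieldType) (a b c u u' w : F) : 0 < w ->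
  (c * u + b * w < a * w + c * u') = (c * ((u - u') / w) + b < a).
Proof.
move=> w0; rewrite -[RHS](ltr_pM2r w0).
have -> : (c * ((u - u') / w) + b) * w = c * (u - u') + b * w by field; rewrite gt_eqF.
by rewrite mulrBr; apply/idP/idP => h; lra.
Qed.

Section PeanoSaturation.
Variables (R : realType) (C K : rcfType).
Variables (rho : {rmorphism C -> R}) (gamma : {rmorphism C -> K}).
Variable Z : subringClosed K.
Hypothesis Z_part : integer_part Z.
Hypothesis K_infinite : exists x : K, ll 1 x.
Hypothesis Z_induction : induction_scheme (cone_ostruct Z).

Local Notation M := (cone_ostruct Z).
Local Notation std := (std Z).
Let Z_discrete := proj1 Z_part.

Lemma cone_infinite : exists N : M, forall n : nat, n%:R < cval N.
Proof.
have [x x1] := K_infinite; have [z zZ /andP[_ zx]] := proj2 Z_part `|x|.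
have h n : n%:R < z + 1 by apply: lt_trans zx; have := x1 n; rewrite normr1 mulr1.
have [||N NE] := @cone_mk K Z (z + 1); first by rewrite rpredD // rpred1.
  exact: ltW (h 0%N).
by exists N => n; rewrite NE.
Qed.

Definition cut_params (c : C) (N z z' : M) : Prop := forall i,
  cut (rho c) i = ((nfst i)%:R * cval N + cval z' * (nsnd (nsnd i)).+1%:R <
                   (nfst (nsnd i))%:R * cval N + cval z * (nsnd (nsnd i)).+1%:R).

Lemma cut_params_frac (c : C) (N z z' : M) : 0 < cval N ->
  (forall q : rat, (ratr q < rho c) = (ratr q < (cval z - cval z') / cval N)) ->
  cut_params c N z z'.
Proof.
move=> N0 h i; rewrite scaled_cut ?ltr0n // -ratr_rat_of_code cut_rat_of_code.
exact: h.
Qed.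

(** A rational c is its own fraction. For irrational c take z - z' the integer part of N c with N
    infinite: the error is below 1/N, thus infinitesimal, and changes no comparison of c with a
    rational. Two numbers z, z' allow for a negative integer part. *)
Lemma exists_cut_params c : exists N z z', cut_params c N z z'.
Proof.
have [[q ->]|/forallNP c_irr] := pselect (exists q : rat, c = ratr q).
  have [i <-] := rat_of_code_surj q.
  exists (std (nsnd (nsnd i)).+1), (std (nfst i)), (std (nfst (nsnd i))).
  apply: cut_params_frac; rewrite !cval_std ?ltr0n // => q'.
  by rewrite fmorph_rat -ratr_rat_of_code !ltr_rat.
have [N Ninf] := cone_infinite; have N0 := Ninf 0%N; rewrite mulr0n in N0.
have [y yZ /andP[yl yr]] := proj2 Z_part (cval N * gamma c).
have [z [z' zE]] : exists z z' : M, y = cval z - cval z'.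
  have [y0|y0] := leP 0 y.
    have [z zE] := cone_mk yZ y0; exists z, (std 0).
    by rewrite zE (cval_std Z 0) subr0.
  have [||z zE] := @cone_mk K Z (- y); first by rewrite rpredN.
    by rewrite oppr_ge0 ltW.
  by exists (std 0), z; rewrite zE (cval_std Z 0) sub0r opprK.
exists N, z, z'; apply: cut_params_frac => // q; rewrite -zE.
have tc : ll (y / cval N - gamma c) 1.
  have -> : y / cval N - gamma c = - ((cval N * gamma c - y) / cval N).
    by field; rewrite gt_eqF.
  move=> n; rewrite normr1 normrN ger0_norm ?divr_ge0 ?subr_ge0 // ?ltW //.
  rewrite mulrA ltr_pdivrMr // mul1r; apply: le_lt_trans (Ninf n).
  by rewrite -[leRHS]mulr1 ler_wpM2l // lerBlDr addrC ltW.
rewrite -(fmorph_rat rho) rcf_morph_lt -(fmorph_rat gamma).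
apply/idP/idP => h.
  rewrite ltNge; apply/negP => /(residue_ge rho tc).
  by rewrite leNgt h.
have := residue_le rho tc (ltW h); rewrite le_eqVlt => /predU1P[qc|//].
by case: (c_irr q).
Qed.

Fixpoint join_params (s : seq C) (p : nat -> M) : Prop :=
  if s is c :: s' then
    cut_params c (p 0%N) (p 1%N) (p 2) /\ join_params s' (fun i => p (3 + i)%N)
  else True.

Lemma exists_join_params s : exists p, join_params s p.
Proof.
elim: s => [|c s [p ps]]; first by exists (fun=> std 0).
have [N [z [z' h]]] := exists_cut_params c.
by exists (scons N (scons z (scons z' p))).
Qed.

Lemma sat_cut_condition (e : nat -> M) a b u n z z' :
  sat e (cut_condition a b u n z z') <->
  kval e a * kval e n + kval e z' * (kval e u + 1) <
  kval e b * kval e n + kval e z * (kval e u + 1) :> K.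
Proof. exact: sat_FLt. Qed.

Lemma sat_cut_graph_form (e : nat -> M) c i : e 0%N = std i ->
  cut_params c (e 3) (e 4) (e 5) ->
  sat e cut_graph_form <-> e 2 = std (cut (rho c) i).
Proof.
move=> e0 ep; pose a := std (nfst i); pose g := std (nsnd i).
pose b := std (nfst (nsnd i)); pose u := std (nsnd (nsnd i)).
pose e4 := scons u (scons b (scons g (scons a e))).
have cutE : sat e4 (cut_condition (TVar 3) (TVar 1) (TVar 0) (TVar 7) (TVar 8) (TVar 9)) <->
    cut (rho c) i.
  by rewrite sat_cut_condition ep /= !cval_std natr1.
have y1 : sat e4 (FEq (TVar 6) TOne) <-> e 2 = std 1.
  rewrite sat_FEq -[kval e4 (TVar 6)]/(cval (e 2)) -[kval e4 TOne]/(1%:R) -(cval_std Z 1).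
  by split=> [/cval_inj|->].
have y0 : sat e4 (FEq (TVar 6) TZero) <-> e 2 = std 0.
  rewrite sat_FEq -[kval e4 (TVar 6)]/(cval (e 2)) -[kval e4 TZero]/(0%:R) -(cval_std Z 0).
  by split=> [/cval_inj|->].
split.
  move=> /sat_FEx[a' /sat_FEx[g' /sat_FEx[b' /sat_FEx[u' /sat_FAnd[/sat_pair_form h1
    /sat_FAnd[/sat_pair_form h2 h]]]]]].
  have [aE gE] : a' = a /\ g' = g by apply/(cpairE Z_discrete); rewrite -e0.
  have [bE uE] : b' = b /\ u' = u by apply/(cpairE Z_discrete); rewrite -/g -gE.
  rewrite aE gE bE uE in h; case/sat_FOr: h => /sat_FAnd[].
    by move=> /cutE -> /y1.
  by move=> /sat_FNot hn /y0 ->; case: (cut (rho c) i) cutE => // -[_ h]; case: hn; apply: h.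
move=> e2; apply/sat_FEx; exists a; apply/sat_FEx; exists g.
apply/sat_FEx; exists b; apply/sat_FEx; exists u.
apply/sat_FAnd; split; first by apply/sat_pair_form; rewrite /= e0; apply/(cpairE Z_discrete).
apply/sat_FAnd; split; first by apply/sat_pair_form/(cpairE Z_discrete).
apply/sat_FOr; case: (cut (rho c) i) e2 cutE => e2 cutE; [left|right].
  by apply/sat_FAnd; split; [apply/cutE|apply/y1].
by apply/sat_FAnd; split; [apply/sat_FNot => /cutE|apply/y0].
Qed.

Lemma join_graph_formP s p : join_params s p -> forall n (y : M),
  sat (scons (std n) (scons y p)) (join_graph_form (size s)) <->
  y = std (cut_join [seq rho c | c <- s] n).
Proof.
elim: s p => [|c s IHs] p ps n y; first by [].
have [cp sp] := ps; rewrite -[cut_join _]/(turing_join (cut (rho c)) (cut_join [seq rho c | c <- s])).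
have half0 (h : M) : cval (std n) = cval h + cval h -> h = std n./2 /\ odd n = false.
  move=> nh; have : cval h <= n%:R by rewrite -(cval_std Z) nh lerDl cval_ge0.
  move=> /(std_le Z_discrete)[k _ hE]; move: nh; rewrite hE !cval_std -natrD.
  by move=> /eqP; rewrite eqr_nat => /eqP ->; rewrite addnn doubleK odd_double.
have half1 (h : M) : cval (std n) = cval h + cval h + 1 -> h = std n./2 /\ odd n.
  move=> nh; have : cval h <= n%:R by rewrite -(cval_std Z) nh -addrA lerDl addr_ge0 // cval_ge0.
  move=> /(std_le Z_discrete)[k _ hE]; move: nh; rewrite hE !cval_std -natrD natr1.
  by move=> /eqP; rewrite eqr_nat => /eqP ->; rewrite addnn /= uphalf_double odd_double.
rewrite /turing_join; split.
  move=> /sat_FEx[h /sat_FOr[]/sat_FAnd[/sat_FEq nh]].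
    have [hE ->] := half0 h nh.
    by rewrite (sat_cut_graph_form (c := c) (i := n./2)).
  have [hE ->] := half1 h nh => /sat_app2 hs.
  have {}hs : sat (scons (std n./2) (scons y (fun i => p (3 + i)%N))) (join_graph_form (size s)).
    by rewrite -hE.
  by move/(IHs _ sp): hs.
move=> yE; apply/sat_FEx; exists (std n./2); apply/sat_FOr.
case nodd: (odd n) in yE; [right|left]; apply/sat_FAnd; split.
- apply/sat_FEq; rewrite /= !cval_std -natrD natr1 addnn.
  by rewrite -[in LHS](odd_double_half n) nodd.
- by apply/sat_app2/(IHs _ sp).
- apply/sat_FEq; rewrite /= !cval_std -natrD addnn.
  by rewrite -[in LHS](odd_double_half n) nodd.
- by apply/(@sat_cut_graph_form _ c n./2).
Qed.

Lemma sat_scaled_clause (e : nat -> M) a b c u u' w : 0 < kval e w ->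
  sat e (scaled_clause a b c u u' w) <->
  kval e c * ((kval e u - kval e u') / kval e w) + kval e b < kval e a.
Proof. by move=> w0; rewrite sat_FLt /= scaled_linear. Qed.

Section Overspill.
Variables (f : nat -> nat) (p : nat -> M) (g : nat -> oform).
Hypothesis gP : forall i m (y : M),
  sat (scons (std m) (scons y p)) (g i) <-> y = std (coef (f m) i).

Lemma sat_clause_at_form m (u u' w U : M) : 0 < cval w ->
  sat (scons (std m) (scons w (scons u' (scons u (scons U p))))) (clause_at_form g) <->
  linear_clause (f m) ((cval u - cval u') / cval w).
Proof.
move=> w0; pose E v0 v1 v2 v3 v4 v5 := scons v5 (scons v4 (scons v3 (scons v2 (scons v1
  (scons v0 (scons (std m) (scons w (scons u' (scons u (scons U p)))))))))).
pose v i := std (coef (f m) i).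
have clauseE : sat (E (v 0%N) (v 1%N) (v 2) (v 3) (v 4) (v 5))
    (FOr (scaled_clause (TVar 5) (TVar 4) (TVar 3) (TVar 9) (TVar 8) (TVar 7))
    (FNot (scaled_clause (TVar 2) (TVar 1) (TVar 0) (TVar 9) (TVar 8) (TVar 7)))) <->
    linear_clause (f m) ((cval u - cval u') / cval w).
  by rewrite sat_FOr sat_FNot !sat_scaled_clause //= !cval_std.
split.
  move=> /sat_FAll/(_ (v 0%N))/sat_FAll/(_ (v 1%N))/sat_FAll/(_ (v 2))/sat_FAll/(_ (v 3)).
  move=> /sat_FAll/(_ (v 4))/sat_FAll/(_ (v 5)) h; apply/clauseE.
  have {}h := h (iffRL (sat_app2 (E _ _ _ _ _ _) (g 0%N) 6 5 11) (iffRL (gP 0 m _) erefl)).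
  have {}h := h (iffRL (sat_app2 (E _ _ _ _ _ _) (g 1%N) 6 4 11) (iffRL (gP 1 m _) erefl)).
  have {}h := h (iffRL (sat_app2 (E _ _ _ _ _ _) (g 2) 6 3 11) (iffRL (gP 2 m _) erefl)).
  have {}h := h (iffRL (sat_app2 (E _ _ _ _ _ _) (g 3) 6 2 11) (iffRL (gP 3 m _) erefl)).
  have {}h := h (iffRL (sat_app2 (E _ _ _ _ _ _) (g 4) 6 1 11) (iffRL (gP 4 m _) erefl)).
  exact: h (iffRL (sat_app2 (E _ _ _ _ _ _) (g 5) 6 0 11) (iffRL (gP 5 m _) erefl)).
move=> /clauseE hc.
apply/sat_FAll => v0; apply/sat_FAll => v1; apply/sat_FAll => v2.
apply/sat_FAll => v3; apply/sat_FAll => v4; apply/sat_FAll => v5.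
apply/sat_FImp => /sat_app2/gP h0; apply/sat_FImp => /sat_app2/gP h1.
apply/sat_FImp => /sat_app2/gP h2; apply/sat_FImp => /sat_app2/gP h3.
apply/sat_FImp => /sat_app2/gP h4; apply/sat_FImp => /sat_app2/gP h5.
by rewrite [v0]h0 [v1]h1 [v2]h2 [v3]h3 [v4]h4 [v5]h5.
Qed.

Lemma overspill_infinite (U : M) : (forall n : nat, n%:R < cval U) ->
  sat (scons U p) (overspill_form g) -> exists x : K, forall m, linear_clause (f m) x.
Proof.
move=> Uinf /sat_FEx[u /sat_FEx[u' /sat_FEx[w /sat_FAnd[/sat_FLt w0 /sat_FAll h]]]].
exists ((cval u - cval u') / cval w) => m.
have Um : cval (std m) < cval U by rewrite cval_std.
have /sat_FImp hm := h (std m).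
apply/(sat_clause_at_form m u u' U w0)/hm.
exact: (iffRL (sat_FLt (scons (std m) (scons w (scons u' (scons u (scons U p)))))
  (TVar 0) (TVar 4)) Um).
Qed.

Lemma overspill_standard n :
  (exists x : rat, forall m, (m < n)%N -> linear_clause (f m) x) ->
  sat (scons (std n) p) (overspill_form g).
Proof.
move=> [x xn]; have [i xE] := rat_of_code_surj x.
apply/sat_FEx; exists (std (nfst i)); apply/sat_FEx; exists (std (nfst (nsnd i))).
apply/sat_FEx; exists (std (nsnd (nsnd i)).+1).
have w0 : 0 < cval (std (nsnd (nsnd i)).+1) by rewrite cval_std ltr0n.
apply/sat_FAnd; split; first exact/sat_FLt.
apply/sat_FAll => m; apply/sat_FImp => /sat_FLt mn.
have {}mn : cval m < cval (std n) := mn.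
rewrite cval_std in mn; have [k _ mE] := std_le Z_discrete (ltW mn).
rewrite mE cval_std ltr_nat in mn; rewrite mE.
apply/(sat_clause_at_form _ _ _ _ w0); rewrite !cval_std -ratr_rat_of_code xE.
exact/linear_clause_ratr/xn.
Qed.

(** The formula holds at every standard number. If no x existed it would fail at all infinite ones,
    so it would define the standard numbers, and induction would carry it to an infinite N. *)
Lemma overspill : (forall N, exists x : rat, forall m, (m < N)%N -> linear_clause (f m) x) ->
  exists x : K, forall m, linear_clause (f m) x.
Proof.
move=> f_sat; apply: contrapT => no_x; have [N Ninf] := cone_infinite.
have std_sat (U : M) : sat (scons U p) (overspill_form g) -> exists n, U = std n.
  move=> hU; apply: contrapT => /forallNP nU; apply: no_x.
  apply: (overspill_infinite _ hU) => n; rewrite ltNge; apply/negP.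
  by move=> /(std_le Z_discrete)[k _ /nU].
have /std_sat[n NE] : sat (scons N p) (overspill_form g).
  apply: Z_induction; first exact: (@overspill_standard 0 (f_sat 0%N)).
  move=> U /std_sat[n ->]; exact: (@overspill_standard n.+1 (f_sat n.+1)).
by have := Ninf n; rewrite NE cval_std ltxx.
Qed.

End Overspill.

(** The clause formula needs the coefficients of [f m] as separate numbers, so a program is chosen
    for each coefficient function and [graph_formP] applies to it. *)
Theorem peano_saturated : computably_saturated K rho.
Proof.
move=> s f cf; have [p ps] := exists_join_params s.
have /choice[c cP] : forall i, exists c, forall x,
    Defs.rgraph (cut_join [seq rho c | c <- s]) c x (coef (f x) i).
  by move=> i; have := @comp_coef _ i _ cf; exact.
apply: (@overspill f p (fun i => graph_form (join_graph_form (size s)) (c i))).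
move=> i m y; exact: (graph_formP Z_discrete (join_graph_formP ps) (cP i m)).
Qed.

End PeanoSaturation.

Theorem mainTheorem5 (R : realType) (C : divringClosed R)
  (C_countable : countable [set` C])
  (C_real_closed : Num.real_closed_axiom (subfield C))
  (C_not_scott : ~ scott_set [set` C])
  (K : rcfType)
  (K_real_closure :
    real_closure_of (@monomial_field (hahn_sum rat (subfield C)) (subfield C)) K) :
  [/\ countable [set: K],
      ~ Num.archimedean_axiom K,
      left_exponentiation K,
      ~ recursively_saturated (ring_ostruct K)
    & ~ exists Z : subringClosed K,
        integer_part Z /\ PA_model (cone_ostruct Z)].
Proof.
pose CC : rcfType := HB.pack (subfield C)
  (Num.RealField_isClosed.Build (subfield C) C_real_closed).
pose rho : {rmorphism CC -> R} := (val : {rmorphism subfield C -> R}).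
have rho_range : range rho = [set` C].
  apply/seteqP; split=> [_ [c _ <-]|x Cx]; first exact: valP c.
  by exists (Subfield Cx).
have CC_countable : countable [set: CC].
  have /countable_injP[e e_inj] := C_countable.
  apply/countable_injP; exists (e \o subfield_val (C := C)) => c d _ _ /e_inj cd.
  by apply: val_inj; apply: cd; rewrite inE; apply: valP.
have [K_countable K_infinite K_left [gamma residue]] :=
  hahn_real_closure (subfield_arch rho) CC_countable K_real_closure.
(* Both negative conclusions contradict this: each would yield the realization property, which would
   make C a Scott set. *)
have not_saturated : ~ computably_saturated K rho.
  by move=> /(scott_set_range residue); rewrite rho_range.
split=> //.
- move=> K_arch; have [x x1] := K_infinite; have [n] := K_arch x.
  by have := x1 n; rewrite normr1 mulr1 ltNge => /negP + /ltW.
- by move=> /(saturated_clauses gamma).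
- by move=> [Z [Z_part [_ Z_ind]]]; apply/not_saturated/(peano_saturated gamma Z_part).
Qed.
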